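(* If $W_1,\dots,W_n\subset\mathbb{R}^2$ are convex bodies whose interiors contain the origin and which all have the same area, then the symplectic $2$-product $W_1\times_2\cdots\times_2 W_n\subset\mathbb{C}^n$ cuts additively.
   Context: A convex body is a compact convex set with nonempty interior. For $s\ge0$, $sA=\{sx\mid x\in A\}$. The symplectic $2$-product is $$W_1\times_2\cdots\times_2 W_n=\bigcup_{t_i\in[0,1],\ t_1+\cdots+t_n=1} t_1^{1/2}W_1\times\cdots\times t_n^{1/2}W_n\subset\mathbb{R}^{2n}\cong\mathbb{C}^n,$$ where $\mathbb{C}^n$ carries the standard symplectic form $\omega_0=\sum_i dx_i\wedge dy_i$. For a convex body $K\subset\mathbb{C}^n$, $c_{\mathrm{EHZ}}(K)$ is the Ekeland–Hofer–Zehnder capacity: the minimum of the actions $\frac12\int_0^T\omega_0(\gamma(t),\gamma'(t))\,dt$ over all generalized closed characteristics on $\partial K$, i.e. absolutely continuous loops $\gamma:\mathbb{R}/T\mathbb{Z}\to\partial K$ (with $\gamma'\in L^2$) such that for almost every $t$, $\gamma'(t)\neq 0$ and $\gamma'(t)\in iN_K(\gamma(t))$, where $N_K(x)=\{v\mid\langle v,y-x\rangle\le0\ \text{for all } y\in K\}$ is the outer normal cone. A convex body $K\subset\mathbb{C}^n$ cuts additively if, for every (real, affine) hyperplane $H$ that separates $K$ into two convex bodies $K_1$ and $K_2$ (i.e. $H$ meets the interior of $K$ and $K_1,K_2$ are the intersections of $K$ with the two closed half-spaces bounded by $H$), one has $c_{\mathrm{EHZ}}(K)=c_{\mathrm{EHZ}}(K_1)+c_{\mathrm{EHZ}}(K_2)$.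 *)

(* Defs.v *)
From HB Require Import structures.
From mathcomp Require Import all_boot all_order all_algebra.
From mathcomp Require Import all_classical all_reals all_analysis.

Set Implicit Arguments.
Unset Strict Implicit.
Unset Printing Implicit Defensive.
Import Order.TTheory GRing.Theory Num.Theory.
Import numFieldNormedType.Exports.
Local Open Scope classical_set_scope.
Local Open Scope ring_scope.

(* A point z of C^n = R^2n is an n x 2 real matrix: its i-th row is
   (x_i, y_i) = (z i 0, z i 1).  The library norm on matrices is the sup norm;
   it is used only for the topology, derivatives and absolute continuity, which
   do not depend on the choice of a norm.  Everything metric goes through the
   Euclidean inner product [dot]. *)
Definition dot (R : realType) (n : nat) (u v : 'M[R]_(n, 2)) : R :=
  \sum_(i < n) (u i 0 * v i 0 + u i 1 * v i 1).

Definition mulI (R : realType) (n : nat) (z : 'M[R]_(n, 2)) : 'M[R]_(n, 2) :=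
  \matrix_(i < n, j < 2) (if j == 0 then - z i 1 else z i 0).

Definition omega0 (R : realType) (n : nat) (u v : 'M[R]_(n, 2)) : R :=
  \sum_(i < n) (u i 0 * v i 1 - u i 1 * v i 0).

Definition convex_body (R : realType) (V : normedModType R) (K : set V) : Prop :=
  [/\ compact K, convex_set K & K° !=set0].

Definition boundary (T : topologicalType) (K : set T) : set T :=
  closure K `\` K°.

Definition normal_cone (R : realType) (n : nat) (K : set 'M[R]_(n, 2))
    (x : 'M[R]_(n, 2)) : set 'M[R]_(n, 2) :=
  [set v | forall y, K y -> dot v (y - x) <= 0].

Definition abs_continuous_on (R : realType) (V : normedModType R) (a b : R)
    (f : R -> V) : Prop :=
  forall e : R, 0 < e -> exists2 d : R, 0 < d &
    forall (m : nat) (l r : 'I_m -> R),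
      (forall i, [/\ a <= l i, l i <= r i & r i <= b]) ->
      trivIset setT (fun i => [set x | l i < x < r i]) ->
      \sum_(i < m) (r i - l i) < d ->
      \sum_(i < m) `|f (r i) - f (l i)| < e.

(* Loops R/TZ -> C^n are T-periodic maps R -> C^n. *)
Definition generalized_closed_characteristic (R : realType) (n : nat)
    (K : set 'M[R]_(n, 2)) (T : R) (gamma : R -> 'M[R]_(n, 2)) : Prop :=
  [/\ 0 < T,
      forall t, gamma (t + T) = gamma t,
      forall t, boundary K (gamma t),
      abs_continuous_on 0 T gamma /\
        (@lebesgue_measure R).-integrable `[0, T]
          (fun t => (dot ('D_1 gamma t) ('D_1 gamma t))%:E) &
      {ae @lebesgue_measure R, forall t,
        [/\ derivable gamma t 1,
            'D_1 gamma t != 0 &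
            (@mulI R n @` normal_cone K (gamma t)) ('D_1 gamma t)]}].

Definition action (R : realType) (n : nat) (T : R) (gamma : R -> 'M[R]_(n, 2)) : R :=
  2^-1 * \int[@lebesgue_measure R]_(t in `[0, T])
           omega0 (gamma t) ('D_1 gamma t).

(* For a convex body the minimum exists, so that it coincides with the infimum;
   [inf] is 0 on sets of reals that are empty or not bounded below. *)
Definition c_EHZ (R : realType) (n : nat) (K : set 'M[R]_(n, 2)) : R :=
  inf [set A | exists T gamma,
    generalized_closed_characteristic K T gamma /\ A = action T gamma].

(* The hyperplane is {x | <a, x> = b} with a != 0. *)
Definition cuts_additively (R : realType) (n : nat) (K : set 'M[R]_(n, 2)) : Prop :=
  convex_body K /\
  forall (a : 'M[R]_(n, 2)) (b : R), a != 0 ->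
    (exists2 x, K° x & dot a x = b) ->
    c_EHZ K = c_EHZ (K `&` [set x | dot a x <= b])
            + c_EHZ (K `&` [set x | b <= dot a x]).

Definition dilate (R : realType) (V : lmodType R) (s : R) (A : set V) : set V :=
  [set s *: x | x in A].

Definition symplectic_2product (R : realType) (n : nat)
    (W : 'I_n -> set (R * R)) : set 'M[R]_(n, 2) :=
  [set z | exists t : 'I_n -> R,
    [/\ forall i, 0 <= t i <= 1,
        \sum_(i < n) t i = 1 &
        forall i, dilate (Num.sqrt (t i)) (W i) (z i 0, z i 1)]].

Definition area (R : realType) (A : set (R * R)) : \bar R :=
  ((@lebesgue_measure R) \x (@lebesgue_measure R))%E A.

(* Main.v *)
(* Let A be the common area. Minkowski's first inequality in each plane, summed
   with the Cauchy-Schwarz inequality, shows that a closed polygon with edges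
   d_j satisfies 4 A area <= (sum_j h_K(d_j))^2, where h_K(d) is the maximum of
   omega0(., d) on the product K. Approximating a characteristic by polygons
   inscribed in it gives the action of a characteristic on K the lower bound A.
   Two polygons attached to the two pieces of K can be cut open and glued along
   the direction i a of the characteristic foliation of the hyperplane
   <a, x> = b, which yields the same lower bound for the sum of the actions of
   characteristics on the pieces.

   For the upper bound, parametrise the boundary of each W_i by the area swept
   out from the origin, as e_i with period A; if sum_i r_i^2 = 1, the curve
   (r_i e_i(u_i + t))_i is a characteristic of K. In the plane i, for
   0 < t < A there is a chord of the boundary of W_i parallel to i a_i cutting
   off an arc of duration t; it depends continuously on t. Choosing r_i inversely
   proportional to the lengths of these chords, in units of |a_i|, makes the
   endpoints of the arc differ by a multiple of i a, and by the intermediate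
   value theorem some t puts them on the hyperplane. The arc and its complement,
   closed up by the segment between the endpoints, are characteristics of the two
   pieces, and the contributions of the segment to the two actions cancel. *)

Require Import Defs.
From HB Require Import structures.
From mathcomp Require Import all_boot all_order all_algebra.
From mathcomp Require Import all_classical all_reals all_analysis.
From mathcomp Require Import measurable_realfun ring lra.
Set Implicit Arguments.
Unset Strict Implicit.
Unset Printing Implicit Defensive.
Import Order.TTheory GRing.Theory Num.Theory.
Import numFieldNormedType.Exports.
Local Open Scope classical_set_scope.
Local Open Scope ring_scope.

(** * Absolutely continuous functions *)

Section ac.
Context {R : realType}.
Notation mu := (@lebesgue_measure R).

(** The [W i] may have corners and edges. Tangents therefore exist only off countable sets of times,
    chords are selected by a supremum, and monotonicity rests on a comparison principle for
    absolutely continuous functions. Actions and areas are used without the factor 1/2, which turns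
    the bound by [A] into one by [2 * A]. Gluing rests on Lagrange duality: a support bound for an
    edge d on the piece <a, x> <= b comes from one on all of K for d - beta i a, plus beta b, with
    beta >= 0. Collecting the multiples of i a in one segment, at the best vertex, does not decrease
    the area, and scaling one polygon makes the two segments opposite. Nothing controls the scaling
    factor r, but (L1 + r L2)^2 <= (L1 + L2)(L1 + r^2 L2) removes it. The intermediate value
    argument needs the limits at both ends. The height of a chord times its length is the
    determinant of its endpoints, asymptotic to 2t for short arcs; so the r_i become proportional to
    the maximal heights, the equality case of Cauchy-Schwarz, and the level tends to the maximum of
    <a, .> on K. At t = A the complementary arcs give the minimum. *)

Lemma abs_continuous_seq (V : normedModType R) (a b : R) (f : R -> V) :
  abs_continuous_on a b f -> forall e : R, 0 < e -> exists2 d : R, 0 < d &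
  forall s : seq (R * R),
    all (fun p => [&& a <= p.1, p.1 <= p.2 & p.2 <= b]) s ->
    pairwise (fun p q => q.2 <= p.1) s ->
    \sum_(p <- s) (p.2 - p.1) < d ->
    \sum_(p <- s) `|f p.2 - f p.1| < e.
Proof.
move=> acf e e0; have [d d0 H] := acf e e0; exists d => // s /allP sab.
move=> ss sd.
have {}H := H (size s) (fun i => (nth (0, 0) s i).1)
  (fun i => (nth (0, 0) s i).2).
rewrite (big_nth (0, 0)) big_mkord; apply: H.
- by move=> i; have /sab /and3P[] := mem_nth (0, 0) (ltn_ord i).
- move=> i j _ _ [x [/= /andP[lix xri] /andP[ljx xrj]]].
  have nle k l : (k < l)%N -> (l < size s)%N ->
      (nth (0, 0) s l).2 <= (nth (0, 0) s k).1.
    move=> kl ls; move/(pairwiseP (0, 0)) : ss; apply => //.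
    by rewrite inE (ltn_trans kl).
  apply/val_inj/eqP; rewrite /= eqn_leq; apply/andP; split; rewrite leqNgt.
    by apply/negP => /nle /(_ (ltn_ord _)); lra.
  by apply/negP => /nle /(_ (ltn_ord _)); lra.
- by move: sd; rewrite (big_nth (0, 0)) big_mkord.
Qed.

Lemma is_derive_epsP (f : R -> R) (x l : R) : is_derive x 1 f l <->
  forall e, 0 < e -> exists2 d, 0 < d &
    forall h, `|h| < d -> `|f (x + h) - f x - l * h| <= e * `|h|.
Proof.
split=> [[dfx fxl] e e0|H].
  move: dfx; rewrite /derivable => /cvg_ex[l' cl'].
  have ll' : l = l' by rewrite -fxl /derive; apply/cvg_lim.
  move: cl'; rewrite -{}ll' => /cvgrPdist_le/(_ _ e0) [d /= d0 Hd].
  exists d => // h hd; have [->|h0] := eqVneq h 0.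
    by rewrite addr0 subrr mulr0 subr0 normr0 mulr0.
  have /Hd/(_ h0) : ball_ (fun x => `|x|) 0 d h by rewrite /ball_ /= sub0r normrN.
  rewrite [_ *: _](_ : _ = h^-1 * (f (x + h) - f x)); last first.
    by rewrite /GRing.scale /= mulr1 (addrC h).
  rewrite -(ler_pM2r (_ : 0 < `|h|)) ?normr_gt0// -normrM mulrBl mulrAC mulVf//.
  by rewrite mul1r distrC.
have cl : h^-1 *: (f (h *: (1 : R) + x) - f x) @[h --> 0^'] --> l.
  apply/cvgrPdist_le => e e0; have [d d0 Hd] := H e e0.
  exists d => //= h; rewrite /ball_ /= sub0r normrN => hd h0.
  rewrite [_ *: _](_ : _ = h^-1 * (f (x + h) - f x)); last first.
    by rewrite /GRing.scale /= mulr1 (addrC h).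
  rewrite -(ler_pM2r (_ : 0 < `|h|)) ?normr_gt0// -normrM mulrBl mulrAC mulVf//.
  by rewrite mul1r distrC; exact: Hd.
by split; [apply/cvg_ex; exists l|apply/cvg_lim].
Qed.

Lemma negligible_open_cover (N : set R) (e : R) : 0 < e -> mu.-negligible N ->
  exists U : set R, [/\ open U, N `<=` U & (mu U < e%:E)%E].
Proof.
move=> e0 [A [mA A0' NA]]; have A0 : mu A = 0%E by exact: A0'.
have [|U [oU AU UA]] := lebesgue_regularity_outer mA _ e0.
  by rewrite [X in (X < _)%E]A0 ltry.
exists U; split=> //; first exact: subset_trans AU.
have mU : measurable U by exact: measurable_realfun.open_measurable.
rewrite -(setDUK AU) measureU//; last 2 first.
- exact: measurableD.
- by rewrite setDIK.
by rewrite [X in (X + _)%E]A0 add0e.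
Qed.

(** Continuous induction along [[a, b]]. Where the derivative is nonpositive, a short step raises
    [f] by at most [k] times its length. A step across an exceptional point is recorded in a list of
    intervals whose total length is bounded by the measure of a small open cover [U], so absolute
    continuity bounds the recorded increments by [k]. *)
Lemma ac_derive_le0 (a b : R) (f : R -> R) (N : set R) : a <= b ->
  abs_continuous_on a b f -> mu.-negligible N ->
  (forall x, a < x < b -> ~ N x -> exists2 l, is_derive x 1 f l & l <= 0) ->
  f b <= f a.
Proof.
move=> ab acf negN derf; apply/ler_addgt0Pr => e e0.
pose k := e / (b - a + 1).
have ba1 : 0 < b - a + 1 by rewrite ltr_wpDl// subr_ge0.
have k0 : 0 < k by rewrite divr_gt0.
have [d d0 Hd] := abs_continuous_seq acf k0.
(* The endpoints join the exceptional set, since the derivative is controlled only in the open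
   interval. *)
have negN2 : mu.-negligible (N `|` [set a; b]).
  apply: negligibleU => //; apply/negligibleP.
    by apply: measurableU; exact: measurable_set1.
  apply: countable_lebesgue_measure0.
  by apply: finite_set_countable; exact: finite_set2.
have [U [oU NU Ud]] := negligible_open_cover d0 negN2.
have mU : measurable U by exact: measurable_realfun.open_measurable.
(* [s] holds the intervals recorded up to [x], the most recent and rightmost one at the head. *)
pose P x s := [/\ all (fun p : R * R => [&& a <= p.1, p.1 <= p.2 & p.2 <= x]) s,
  pairwise (fun p q : R * R => q.2 <= p.1) s,
  ((\sum_(p <- s) (p.2 - p.1))%:E <= mu (U `&` `[a, x]))%E &
  f x - f a <= k * (x - a) + \sum_(p <- s) `|f p.2 - f p.1|].
have Pgood x y s : a <= x -> x <= y -> f y - f x <= k * (y - x) -> P x s -> P y s.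
  move=> ax xy fxy [P1 P2 P3 P4]; split=> //.
  - by apply: sub_all P1 => p /and3P[-> -> /=] px; exact: le_trans xy.
  - apply: le_trans P3 _; apply: le_measure; rewrite ?inE.
    + by apply: measurableI => //; exact: measurable_itv.
    + by apply: measurableI => //; exact: measurable_itv.
    + move=> z [Uz]; rewrite /= !in_itv /= => /andP[az zx]; split=> //.
      by rewrite /= ?in_itv/= az (le_trans zx).
  - by lra.
have Pbad x y s : a <= x -> x <= y -> `[x, y] `<=` U -> P x s -> P y ((x, y) :: s).
  move=> ax xy xyU [P1 P2 P3 P4]; split=> //=.
  - rewrite ax xy lexx /=.
    by apply: sub_all P1 => p /and3P[-> -> /=] px; exact: le_trans xy.
  - rewrite P2 andbT; apply: sub_all P1 => p /and3P[_ _ ] //.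
  - rewrite big_cons /= EFinD.
    have -> : (y - x)%:E = mu `]x, y].
      rewrite lebesgue_measure_itv /= lte_fin; move: xy; rewrite le_eqVlt.
      by case/predU1P => [->|->]; rewrite ?ltxx ?subrr// EFinB.
    apply: (@le_trans _ _ (mu (`]x, y] `|` (U `&` `[a, x])))).
      rewrite measureU//; first exact: leeD.
      + by apply: measurableI.
      + apply/seteqP; split=> // z [] /=; rewrite !in_itv /= => /andP[xz _] [_].
        by move=> /andP[_]; rewrite leNgt xz.
    apply: le_measure; rewrite ?inE.
    + by apply: measurableU => //; exact: measurableI.
    + exact: measurableI.
    + move=> z [/=|[Uz]]; rewrite /= !in_itv /= => /andP[z1 z2]; split=> //.
      * by apply: xyU; rewrite /= ?in_itv /= z2 ltW.
      * by rewrite /= ?in_itv /= z2 andbT (le_trans ax) // ltW.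
      * by rewrite /= ?in_itv /= z1 (le_trans z2).
  - rewrite big_cons /=; have := ler_norm (f y - f x).
    have : 0 <= k * (y - x) by apply: mulr_ge0; [exact: ltW|rewrite subr_ge0].
    lra.
pose E := [set x | a <= x <= b /\ exists s, P x s].
have Ea : E a.
  split; first by rewrite lexx.
  by exists [::]; split=> //; rewrite ?big_nil ?measure_ge0// !subrr mulr0 addr0.
have hE : has_sup E.
  by split; [exists a|exists b => x [/andP[]]].
pose c := sup E.
have ac : a <= c by exact: sup_upper_bound.
have cb : c <= b by apply: ge_sup => [|x [/andP[]]//]; exists a.
(* A single step carries [P] from any point just left of the supremum [c] to any point just right of
   it, whether or not [c] is exceptional. *)
have [r r0 Hr] : exists2 r, 0 < r & forall x y s, a <= x -> c - r < x -> x <= c ->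
   c <= y -> y < c + r -> P x s -> exists s', P y s'.
  have [Nc|Nc] := pselect ((N `|` [set a; b]) c).
    have /open_nbhs_nbhs/nbhs_ballP[r /= r0 rU] : open_nbhs c U.
      by split => //; exact: NU.
    exists r => // x y s ax rx xc cy yr Px; exists ((x, y) :: s); apply: Pbad => //.
      exact: le_trans cy.
    move=> z /=; rewrite in_itv /= => /andP[xz zy]; apply: rU.
    by rewrite /ball/= ltr_norml; apply/andP; split; lra.
  have cab : a < c < b.
    have ca : c != a by apply/eqP => ca; apply: Nc; right; left.
    have cb' : c != b by apply/eqP => cb0; apply: Nc; right; right.
    by rewrite !lt_neqAle ac cb cb' (eq_sym a) ca.
  have [l] := derf c cab (fun h => Nc (or_introl h)).
  move=> /is_derive_epsP /(_ k k0) [r r0 Hr] l0.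
  exists r => // x y s ax rx xc cy yr Px; exists s; apply: (Pgood x) => //.
    exact: le_trans cy.
  have := Hr (x - c); have := Hr (y - c); rewrite !(addrC c) !subrK.
  have xr : - r < x - c < r by clear -rx xc r0; apply/andP; split; lra.
  have yr' : - r < y - c < r by clear -cy yr r0; apply/andP; split; lra.
  rewrite !ltr_norml => /(_ yr') + /(_ xr).
  rewrite !ler_norml (ger0_norm (_ : 0 <= y - c)) ?subr_ge0//.
  rewrite (ler0_norm (_ : x - c <= 0)) ?subr_le0// => /andP[h1 h2] /andP[h3 h4].
  have : l * (y - c) <= 0 by rewrite mulr_le0_ge0 // subr_ge0.
  have : 0 <= l * (x - c) by rewrite mulr_le0 // subr_le0.
  lra.
have [s Pb] : exists s, P b s.
  have [x [/andP[ax xb] [s Px]] cx] := sup_adherent r0 hE.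
  have xc : x <= c by apply: sup_upper_bound => //; split; [rewrite ax|exists s].
  have [bcr|crb] := ltP b (c + r); first exact: (Hr x b s).
  have [s' Ps'] : exists s', P (c + r / 2) s' by apply: (Hr x _ s) => //; lra.
  have : c + r / 2 <= c.
    by apply: sup_upper_bound => //; split; [apply/andP; split; lra|exists s'].
  lra.
case: Pb => P1 P2 P3 P4.
have := Hd s P1 P2.
have -> : \sum_(p <- s) (p.2 - p.1) < d.
  rewrite -lte_fin; apply: le_lt_trans P3 _; apply: le_lt_trans Ud.
  apply: le_measure; rewrite ?inE //; exact: measurableI.
move=> /(_ isT) sk.
have -> : e = k * (b - a) + k by rewrite -{2}(mulr1 k) -mulrDr /k divfK// gt_eqF.
lra.
Qed.

Lemma lipschitz_abs_continuous (V : normedModType R) (a b C : R) (f : R -> V) :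
  (forall x y, a <= x -> x <= y -> y <= b -> `|f y - f x| <= C * (y - x)) ->
  abs_continuous_on a b f.
Proof.
move=> lf e e0; have D0 : 0 < `|C| + 1 by rewrite ltr_wpDl.
exists (e / (`|C| + 1)); first exact: divr_gt0.
move=> m l r lr _; rewrite ltr_pdivlMr// => lre; apply: le_lt_trans lre.
rewrite mulr_suml; apply: ler_sum => i _; have [al lr' rb] := lr i.
apply: le_trans (lf _ _ al lr' rb) _; rewrite mulrC ler_wpM2l ?subr_ge0//.
by have := ler_norm C; lra.
Qed.

Lemma abs_continuousB (V : normedModType R) (a b : R) (f g : R -> V) :
  abs_continuous_on a b f -> abs_continuous_on a b g ->
  abs_continuous_on a b (f \- g).
Proof.
move=> acf acg e e0; have e2 : 0 < e / 2 by rewrite divr_gt0.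
have [d1 d10 H1] := acf _ e2; have [d2 d20 H2] := acg _ e2.
exists (Num.min d1 d2); first by rewrite lt_min d10.
move=> m l r lr tr; rewrite lt_min => /andP[ld1 ld2].
have := H1 _ _ _ lr tr ld1; have := H2 _ _ _ lr tr ld2 => h2 h1.
apply: (@le_lt_trans _ _ (\sum_(i < m) (`|f (r i) - f (l i)| + `|g (r i) - g (l i)|))).
  apply: ler_sum => i _; rewrite [X in `|X|](_ : _ =
    (f (r i) - f (l i)) - (g (r i) - g (l i))) ?ler_normB//.
  by rewrite /= !opprB addrACA [RHS]addrACA; congr (_ + _); rewrite addrC.
by rewrite big_split /=; lra.
Qed.

Lemma abs_continuous_integral (a b : R) (g : R -> R) :
  mu.-integrable setT (EFin \o g) ->
  abs_continuous_on a b (fun x => \int[mu]_(t in `[a, x]) g t).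
Proof.
move=> ig e e0; have [d [d0 Hd]] := integral_normr_continuous ig e0.
exists d => // m l r lr tr ld.
pose F i := `]l i, r i[%classic : set R.
have tF : trivIset setT F.
  by apply: sub_trivIset tr => //.
have mF i : measurable (F i) by exact: measurable_itv.
have ig' A : measurable A -> mu.-integrable A (EFin \o g).
  by move=> mA; apply: integrableS ig.
apply: (@le_lt_trans _ _ (\sum_(i < m) \int[mu]_(t in F i) `|g t|)).
  apply: ler_sum => i _; have [al lri rb] := lr i.
  rewrite (@Rintegral_itvB _ g (BLeft a) (BRight (r i)) (l i))//; last exact: ig'.
  rewrite -Rintegral_itv_bndo_bndc; last exact: ig'.
  by apply: le_normr_Rintegral => //; exact: ig'.
have tF' : trivIset [set` index_enum 'I_m] F by exact: sub_trivIset tF.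
have mD : measurable (\big[setU/set0]_(i < m) F i) by apply: bigsetU_measurable => i _.
rewrite (_ : \sum_(i < m) _ = \int[mu]_(t in \big[setU/set0]_(i < m) F i) `|g t|).
  apply: Hd => //; rewrite measure_bigsetU_ord//.
  apply: le_lt_trans (_ : (_ <= (\sum_(i < m) (r i - l i))%:E)%E) _; last by rewrite lte_fin.
  rewrite -sumEFin; apply: lee_sum => i _; apply: (@le_trans _ _ (mu (F i))) => //.
  rewrite /F lebesgue_measure_itv /= lte_fin.
  by have [_ lri _] := lr i; case: ifP => // _; rewrite lee_fin subr_ge0.
have ign A : measurable A -> mu.-integrable A (fun t => `|g t|%:E).
  by move=> mA; have := integrable_abse (ig' _ mA).
rewrite /Rintegral integral_bigsetU_EFin//=; last 2 first.
- exact: index_enum_uniq.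
- exact: (measurable_int mu (ign _ mD)).
rewrite sum_fine// => i _.
by apply: integrable_fin_num (ign _ (mF i)) => //; exact: mF.
Qed.

(** Subtracting the primitive of [g], whose derivative is [g] almost everywhere by Lebesgue
    differentiation, reduces this to the monotonicity criterion [ac_derive_le0]. *)
Lemma ac_le_integral (a b : R) (f g : R -> R) (N : set R) : a <= b ->
  abs_continuous_on a b f -> mu.-integrable `[a, b] (EFin \o g) ->
  mu.-negligible N ->
  (forall x, a < x < b -> ~ N x -> exists2 l, is_derive x 1 f l & l <= g x) ->
  f b - f a <= \int[mu]_(t in `[a, b]) g t.
Proof.
move=> ab acf ig negN derf.
pose h := g \_ `[a, b].
have ih : mu.-integrable setT (EFin \o h).
  by rewrite /h -restrict_EFin; apply/(integrable_mkcond _ _).1.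
have lh : locally_integrable setT h by exact: integrable_locally.
pose G x := \int[mu]_(t in `[a, x]) h t.
have [|M [mM M0 MG]] := @FTC1 R h (BLeft a) _ lh.
  by move=> y; apply: integrableS ih.
have negM : mu.-negligible M by apply/negligibleP.
have hg : G b = \int[mu]_(t in `[a, b]) g t.
  by apply: eq_Rintegral => x xab; rewrite /h patchE xab.
have Ga : G a = 0 by rewrite /G set_itv1 Rintegral_set1.
suff : (f \- G) b <= (f \- G) a by rewrite /= Ga hg; lra.
apply: (@ac_derive_le0 a b (f \- G) (N `|` M) ab _ (negligibleU negN negM)).
  exact: abs_continuousB acf (@abs_continuous_integral a b h ih).
move=> x /andP[ax xb] /not_orP[Nx Mx].
have [l fl lg] := derf x (ltac:(by rewrite ax)) Nx.
have /= [|dG Gx] := contra_notP (MG x) Mx; first by rewrite ?bnd_simp ?lte_fin.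
exists (l - h x).
  have dGx : is_derive x 1 G (h x) by apply: DeriveDef; [exact: dG|rewrite -derive1E; exact: Gx].
  exact: (is_deriveB fl dGx).
by rewrite subr_le0 /h patchE mem_set// /= in_itv /= !ltW.
Qed.

End ac.

(** * Measurability of the derivative of a continuous curve *)

Section measurable_derive.
Context {R : realType}.
Notation mu := (@lebesgue_measure R).

Lemma invrS_lt (e : R) : 0 < e -> exists m : nat, m.+1%:R^-1 < e.
Proof. by move=> /ltr_add_invr[k]; rewrite add0r => ke; exists k. Qed.

Definition difference_quotient (f : R -> R) (t h : R) : R := h^-1 * (f (t + h) - f t).

Lemma difference_quotientE (f : R -> R) (t : R) :
  (fun h : R => h^-1 *: (f (h *: (1 : R) + t) - f t)) = difference_quotient f t.
Proof.
by apply/funext => h; rewrite /difference_quotient /GRing.scale /= mulr1 (addrC h).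
Qed.

(** The Cauchy form names no candidate for the derivative, so that differentiability becomes a
    condition on [t] built from values of [f] alone. *)
Lemma derivable_cauchy (f : R -> R) (t : R) : derivable f t 1 <->
  forall k : nat, exists m : nat, forall h h', h != 0 -> `|h| < m.+1%:R^-1 ->
    h' != 0 -> `|h'| < m.+1%:R^-1 ->
    `|difference_quotient f t h - difference_quotient f t h'| <= k.+1%:R^-1.
Proof.
rewrite /derivable difference_quotientE; split => [/cvg_ex[l /cvgrPdist_le H] k|H].
  have [d /= d0 Hd] := H (k.+1%:R^-1 / 2) ltac:(by rewrite divr_gt0).
  have [m md] := invrS_lt d0.
  exists m => h h' h0 hm h0' hm'.
  have := Hd h; rewrite /ball_ /= sub0r normrN => /(_ (lt_trans hm md) h0) a1.
  have := Hd h'; rewrite /ball_ /= sub0r normrN => /(_ (lt_trans hm' md) h0') a2.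
  rewrite (splitr (k.+1%:R^-1)) -(subrKA l) (le_trans (ler_normD _ _))// lerD//.
  by rewrite distrC.
apply: cauchy_cvg; apply: cauchy_exP => e e0.
have [m mk] := invrS_lt e0.
have [n Hn] := H m; exists (difference_quotient f t (n.+2%:R^-1)).
have n0 : 0 < n.+1%:R^-1 :> R by rewrite invr_gt0.
exists (n.+1%:R^-1) => //= h; rewrite /ball_ /= sub0r normrN => hn h0.
rewrite /ball /=; apply: le_lt_trans mk; apply: Hn => //.
  rewrite ger0_norm ?invr_ge0// ltf_pV2 ?posrE ?ltr_nat//.
Qed.

Lemma continuous_difference_quotient (f : R -> R) (h : R) : continuous f ->
  continuous (difference_quotient f ^~ h).
Proof.
move=> cf t; apply: cvgM; first exact: cvg_cst.
apply: cvgB; last exact: cf.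
apply: (@continuous_comp _ _ _ (fun x => x + h) f); last exact: cf.
by apply: cvgD; [exact: cvg_id|exact: cvg_cst].
Qed.

(** For fixed [k] and [m] the Cauchy condition is an intersection over uncountably many pairs of
    increments, but it is closed because [f] is continuous. Only countable operations over [k] and
    [m] remain. *)
Lemma measurable_derivable (f : R -> R) : continuous f ->
  measurable [set t | derivable f t 1].
Proof.
move=> cf.
pose C (k : nat) (p : R * R) := [set t : R |
  `|difference_quotient f t p.1 - difference_quotient f t p.2| <= k.+1%:R^-1].
pose J (m : nat) := [set p : R * R | [/\ p.1 != 0, `|p.1| < m.+1%:R^-1,
   p.2 != 0 & `|p.2| < m.+1%:R^-1]].
rewrite (_ : [set _ | _] = \bigcap_k \bigcup_m \bigcap_(p in J m) C k p); last first.
  apply/seteqP; split => t /=.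
    move=> /derivable_cauchy H k _; have [m Hm] := H k; exists m => // p [p1 p2 p3 p4].
    exact: Hm.
  move=> H; apply/derivable_cauchy => k; have [m _ Hm] := H k I; exists m => h h' *.
  exact: (Hm (h, h')).
apply: bigcapT_measurable => k; apply: bigcupT_measurable => m.
apply: measurable_realfun.closed_measurable; apply: closed_bigI => p _.
rewrite (_ : C k p = (fun t => `|difference_quotient f t p.1 -
  difference_quotient f t p.2|) @^-1` [set x | x <= k.+1%:R^-1]) //.
apply: closed_comp; last exact: closed_le.
move=> t _; apply: cvg_norm; apply: cvgB; exact: continuous_difference_quotient.
Qed.

Lemma measurable_derive (f : R -> R) (D : set R) : continuous f ->
  (forall t, D t -> derivable f t 1) -> measurable_fun D (fun t => 'D_1 f t).
Proof.
move=> cf dD.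
apply: (@measurable_realfun.measurable_fun_cvg _ _ _ _
  (fun n t => difference_quotient f t n.+1%:R^-1)).
  move=> m; apply: measurable_funTS.
  apply: measurable_realfun.continuous_measurable_fun.
  exact: continuous_difference_quotient.
move=> t /dD; rewrite /derivable difference_quotientE => ct.
rewrite /derive difference_quotientE.
move/cvgrPdist_le : ct => ct; apply/cvgrPdist_le => e e0.
have [d /= d0 Hd] := ct e e0; have [m md] := invrS_lt d0.
exists m => // n /= mn; apply: Hd; last by rewrite gt_eqF.
rewrite /ball_ /= sub0r normrN ger0_norm ?invr_ge0//; apply: le_lt_trans md.
by rewrite lef_pV2 ?posrE// ler_nat.
Qed.

Lemma measurable_derive_mx m n (g : R -> 'M[R]_(m, n)) i j : continuous g ->
  measurable_fun setT (fun t => ('D_1 g t) i j).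
Proof.
move=> cg; have cgij k l : continuous (fun t => g t k l).
  by move=> t; apply: (@continuous_comp _ _ _ g (fun M : 'M[R]_(m, n) => M k l));
    [exact: cg|exact: coord_continuous].
pose D := [set t | derivable g t 1].
have mD : measurable D.
  rewrite (_ : D = \bigcap_(p in @setT ('I_m * 'I_n)%type) ([set t | derivable (fun x => g x (fst p) (snd p)) t 1])).
    by apply: fin_bigcap_measurable => // p _; exact: measurable_derivable.
  apply/seteqP; split => t /=; first by move=> /derivable_mxP H p _; exact: H.
  by move=> H; apply/derivable_mxP => k l; exact: (H (k, l)).
rewrite -(setUv D); apply/measurable_funU => //; first exact: measurableC.
split.
  apply: (@eq_measurable_fun _ _ _ _ _ (fun t => 'D_1 (fun x => g x i j) t)).
    by move=> t /set_mem Dt; rewrite derive_mx// mxE.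
  by apply: measurable_derive => // t /derivable_mxP.
(* Where [g] is not differentiable, ['D_1 g] has the constant default value [point]. *)
apply: (@eq_measurable_fun _ _ _ _ _ (fun=> (point : 'M[R]_(m, n)) i j)).
  by move=> t /set_mem Dt; rewrite /derive dvgP.
exact: measurable_cst.
Qed.

End measurable_derive.

(** * Symplectic areas of polygons *)

Section pairsum.
Context {R : realType} {V : lmodType R}.

Record symplectic_form (w : V -> V -> R) : Prop := {
  sformDl : forall x y z, w (x + y) z = w x z + w y z;
  sformZl : forall a x y, w (a *: x) y = a * w x y;
  sformC : forall x y, w x y = - w y x }.

Variable w : V -> V -> R.
Hypothesis sw : symplectic_form w.

Lemma sformDr x y z : w z (x + y) = w z x + w z y.
Proof. by rewrite sformC// sformDl// opprD -!(sformC sw z). Qed.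

Lemma sformZr a x y : w y (a *: x) = a * w y x.
Proof. by rewrite sformC// sformZl// -mulrN -(sformC sw). Qed.

Lemma sformxx x : w x x = 0.
Proof. by have := sformC sw x x; lra. Qed.

Lemma sformNl x y : w (- x) y = - w x y.
Proof. by rewrite -scaleN1r sformZl// mulN1r. Qed.

Lemma sformNr x y : w y (- x) = - w y x.
Proof. by rewrite -scaleN1r sformZr mulN1r. Qed.

Lemma sform0l x : w 0 x = 0.
Proof. by rewrite -(scale0r (0 : V)) sformZl// mul0r. Qed.

(* Twice the symplectic area of the polygon with successive edges [s], closed up
   by a segment. *)
Fixpoint pairsum (s : seq V) : R :=
  if s is d :: s' then w d (\sum_(x <- s') x) + pairsum s' else 0.

Lemma pairsum_cat s1 s2 : pairsum (s1 ++ s2) =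
  pairsum s1 + pairsum s2 + w (\sum_(x <- s1) x) (\sum_(x <- s2) x).
Proof.
elim: s1 => [|d s1 IH] /=; first by rewrite big_nil sform0l; lra.
by rewrite IH big_cat /= big_cons sformDr sformDl//; lra.
Qed.

Lemma pairsum_scale a s : pairsum [seq a *: x | x <- s] = a ^+ 2 * pairsum s.
Proof.
elim: s => [|d s IH] /=; first by rewrite mulr0.
by rewrite IH big_map -scaler_sumr sformZl// sformZr; ring.
Qed.

Lemma argmax_split (T : Type) (f : seq T -> R) (s : seq T) : exists s1 s2,
  s = s1 ++ s2 /\ forall t1 t2, s = t1 ++ t2 -> f t1 <= f s1.
Proof.
pose k := [arg max_(i > (ord0 : 'I_(size s).+1)) f (take i s)]%O.
exists (take k s), (drop k s); rewrite cat_take_drop; split=> // t1 t2 st.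
rewrite /k; case: arg_maxP => // i _ Hi.
have ht : (size t1 < (size s).+1)%N by rewrite ltnS st size_cat leq_addr.
by have := Hi (Ordinal ht) isT; rewrite /= {1}st take_size_cat.
Qed.

(** Adding b e to the edge from p to p + v contributes b (w(p, e) + w(p + v, e)), up to a shift by
    w(u, e), and this is at most 2 b M. Different contributions do not interact because w(e, e) = 0.
    The starting vertex [u] is there for the induction. *)
Lemma pairsum_split_le (e : V) (M : R) (s : seq (V * R)) (u : V) :
  (forall p, p \in s -> 0 <= p.2) ->
  (forall t1 t2, s = t1 ++ t2 -> w (u + \sum_(p <- t1) p.1) e <= M) ->
  w (u + \sum_(p <- s) p.1) e = 0 ->
  pairsum [seq p.1 + p.2 *: e | p <- s] + (\sum_(p <- s) p.2) * w u e <=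
  pairsum [seq p.1 | p <- s] + 2 * (\sum_(p <- s) p.2) * M.
Proof.
elim: s u => [|[v b] s IH] u b0 hM h0 /=; first by rewrite !big_nil; lra.
have {}IH := IH (u + v) _ _ _.
rewrite !big_cons /= !big_map in h0 *.
have hv : w (u + v) e <= M.
  by have := hM [:: (v, b)] s erefl; rewrite big_cons big_nil /= addr0.
have {IH} : pairsum [seq p.1 + p.2 *: e | p <- s] +
    (\sum_(p <- s) p.2) * w (u + v) e <=
    pairsum [seq p.1 | p <- s] + 2 * (\sum_(p <- s) p.2) * M.
  apply: IH.
  - by move=> p ps; apply: b0; rewrite inE ps orbT.
  - move=> t1 t2 st; have := hM ((v, b) :: t1) t2.
    by rewrite st big_cons /= addrA; apply.
  - by rewrite -addrA.
have -> : \sum_(i <- s) (i.1 + i.2 *: e) = \sum_(i <- s) i.1 + (\sum_(i <- s) i.2) *: e.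
  by rewrite big_split /= scaler_suml.
rewrite !(sformDl, sformDr, sformZl, sformZr, sformxx)//.
have hb : 0 <= b by apply: (b0 (v, b)); rewrite inE eqxx.
have : b * (w e (\sum_(i <- s) i.1) + w u e) <= b * (2 * M).
  rewrite ler_wpM2l//.
  have h1 : w e (\sum_(i <- s) i.1) = w (u + v) e.
    rewrite (sformC sw e); move: h0; rewrite addrA !sformDl//; lra.
  have := hM [::] ((v, b) :: s) erefl; rewrite big_nil addr0.
  by rewrite h1; lra.
lra.
Qed.

(** The cut goes at the vertex of the path of first components where w(., e) is maximal. Moving all
    multiples of [e] there keeps the total length of these multiples and cannot decrease the
    area. *)
Lemma concentrate (e : V) (s : seq (V * R)) :
  (forall p, p \in s -> 0 <= p.2) ->
  \sum_(p <- s) (p.1 + p.2 *: e) = 0 ->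
  exists s1 s2, s = s1 ++ s2 /\
  pairsum [seq p.1 + p.2 *: e | p <- s] <= pairsum ([seq p.1 | p <- s1] ++
    (\sum_(p <- s) p.2) *: e :: [seq p.1 | p <- s2]).
Proof.
move=> b0 s0; set B := \sum_(p <- s) p.2.
have [s1 [s2 [ss hM]]] := argmax_split (fun t => w (\sum_(p <- t) p.1) e) s.
exists s1, s2; split=> //.
have hs : \sum_(p <- s) p.1 = - (B *: e).
  by apply/eqP; rewrite -addr_eq0; apply/eqP; rewrite -[RHS]s0 big_split /= scaler_suml.
have := @pairsum_split_le e (w (\sum_(p <- s1) p.1) e) s 0 b0.
rewrite sform0l mulr0 addr0 => H.
apply: le_trans (H _ _) _.
- by move=> t1 t2 st; rewrite add0r; apply: hM st.
- by rewrite add0r hs sformNl sformZl// sformxx mulr0 oppr0.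
rewrite ss map_cat !pairsum_cat /= !big_map big_cons !big_map.
have : \sum_(p <- s1) p.1 + \sum_(p <- s2) p.1 = - (B *: e) by rewrite -big_cat -ss.
move/(canRL (addKr _)) => ->; rewrite -ss -/B.
rewrite !(sformDr, sformNr, sformZr, sformDl, sformNl, sformZl, sformxx)//.
by rewrite (sformC sw e); lra.
Qed.

(** Scaling by [B1 / B2] makes the edge [- B2 *: e] of the second polygon opposite to the edge
    [B1 *: e] of the first. Replacing the latter by the rest of the scaled polygon, read cyclically
    as [b2 ++ b1], adds the two areas. *)
Lemma glue_pairsum (e : V) (B1 B2 : R) (a1 a2 b1 b2 : seq V) : B2 != 0 ->
  \sum_(x <- a1) x + \sum_(x <- a2) x = - (B1 *: e) ->
  \sum_(x <- b1) x + \sum_(x <- b2) x = B2 *: e ->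
  pairsum (a1 ++ [seq (B1 / B2) *: x | x <- b2 ++ b1] ++ a2) =
  pairsum (a1 ++ B1 *: e :: a2) +
  (B1 / B2) ^+ 2 * pairsum (b1 ++ (- B2) *: e :: b2).
Proof.
move=> B20 ha hb.
rewrite !pairsum_cat pairsum_scale !pairsum_cat /= !big_cat /= !big_map -scaler_sumr.
rewrite !big_cat /= big_cons.
have hb' : \sum_(x <- b2) x + \sum_(x <- b1) x = B2 *: e by rewrite addrC.
rewrite hb' big_cons; move/(canRL (addKr _)) : hb => ->.
rewrite scalerA divfK//.
rewrite !(sformDr, sformNr, sformZr, sformDl, sformNl, sformZl, sformxx)//.
rewrite (sformC sw e (\sum_(x <- b1) x)).
by field.
Qed.

End pairsum.

(** * Polygons attached to the two pieces of a cut convex set *)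

Definition segment_closed {R : realType} {V : lmodType R} (K : set V) :=
  forall x y t, K x -> K y -> 0 <= t <= 1 -> K (t *: x + (1 - t) *: y).

Lemma convex_set_segment_closed {R : realType} {V : lmodType R} (K : set V) :
  convex_set K <-> segment_closed K.
Proof.
split=> [cK x y t Kx Ky t01|cK x y l /set_mem Kx /set_mem Ky].
  have := cK x y (Itv01 (andP t01).1 (andP t01).2) (mem_set Kx) (mem_set Ky).
  by move/set_mem.
by apply/mem_set; apply: cK => //; rewrite ge0 le1.
Qed.

(** Lagrange duality for one affine constraint. The multiplier is the largest slope seen from the
    level [(b, H)] on the side [b < f]. A segment from that side to a point with [f < b] crosses
    [f = b], where [g <= H], and this bounds the slopes. *)
Lemma constraint_multiplier {R : realType} {V : lmodType R} (K : set V)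
    (f g : V -> R) (b H : R) :
  (forall x y t, f (t *: x + (1 - t) *: y) = t * f x + (1 - t) * f y) ->
  (forall x y t, g (t *: x + (1 - t) *: y) = t * g x + (1 - t) * g y) ->
  segment_closed K -> (exists2 x0, K x0 & f x0 < b) ->
  (forall x, K x -> f x <= b -> g x <= H) ->
  exists2 be, 0 <= be & forall x, K x -> g x - be * (f x - b) <= H.
Proof.
move=> flin glin cK [x0 Kx0 fx0] gH.
(* Adjoining 0 makes the multiplier nonnegative, also when no point of [K] has [b < f]. *)
pose S := [set 0] `|` [set (g x - H) / (f x - b) | x in K `&` [set x | b < f x]].
have Sub x : K x -> f x < b -> ubound S ((H - g x) / (b - f x)).
  move=> Kx fx _ [->|[y [Ky /= fy] <-]].
    by rewrite divr_ge0// ?subr_ge0 ?(ltW fx)//; apply: gH => //; exact: ltW.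
  rewrite ler_pdivlMr ?subr_gt0// mulrAC ler_pdivrMr ?subr_gt0//.
  pose t := (b - f x) / (f y - f x).
  have d0 : 0 < f y - f x by lra.
  have t01 : 0 <= t <= 1.
    by apply/andP; split; [apply: divr_ge0; lra|rewrite ler_pdivrMr// mul1r; lra].
  have tE : t * (f y - f x) = b - f x by rewrite divfK// gt_eqF.
  have := gH _ (cK y x t Ky Kx t01); rewrite flin glin.
  move=> /(_ ltac:(by lra)) h.
  have : (t * g y + (1 - t) * g x) * (f y - f x) <= H * (f y - f x).
    by rewrite ler_wpM2r// ltW.
  have -> : (t * g y + (1 - t) * g x) * (f y - f x) =
     (t * (f y - f x)) * g y + ((f y - f x) - t * (f y - f x)) * g x by ring.
  by rewrite tE; lra.
have hS : has_sup S by split; [exists 0; left|exists ((H - g x0) / (b - f x0)); exact: Sub].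
exists (sup S); first by apply: sup_upper_bound => //; left.
move=> x Kx; have [fx|fx|fx] := ltgtP (f x) b.
- have : sup S <= (H - g x) / (b - f x).
    by apply: ge_sup; [case: hS|exact: Sub].
  by rewrite ler_pdivlMr ?subr_gt0//; lra.
- have : (g x - H) / (f x - b) <= sup S.
    by apply: sup_upper_bound => //; right; exists x.
  by rewrite ler_pdivrMr ?subr_gt0//; lra.
- by rewrite fx subrr mulr0 subr0; apply: gH => //; rewrite fx.
Qed.

Section cut_polygons.
Context {R : realType} {V : lmodType R} (w : V -> V -> R).
Hypothesis sw : symplectic_form w.
Variables (K : set V) (e : V) (b C : R).
Hypothesis C0 : 0 <= C.
Hypothesis cK : segment_closed K.
Hypothesis isoK : forall s : seq (V * R), \sum_(p <- s) p.1 = 0 ->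
  (forall p, p \in s -> forall x, K x -> w x p.1 <= p.2) ->
  C * pairsum w [seq p.1 | p <- s] <= (\sum_(p <- s) p.2) ^+ 2.

(** An edge d is written as d' + beta e', where d' satisfies a support inequality on the whole of
    [K]; [s'] stores d', its support value and beta. *)
Lemma multipliers (e' : V) (b' : R) (s : seq (V * R)) :
  (exists2 x0, K x0 & w x0 e' < b') ->
  (forall p, p \in s -> forall x, K x -> w x e' <= b' -> w x p.1 <= p.2) ->
  exists s' : seq (V * R * R), [/\
    [seq p.1.1 + p.2 *: e' | p <- s'] = [seq p.1 | p <- s],
    [seq p.1.2 + b' * p.2 | p <- s'] = [seq p.2 | p <- s] &
    forall p, p \in s' -> 0 <= p.2 /\ forall x, K x -> w x p.1.1 <= p.1.2].
Proof.
move=> x0; elim: s => [|[d H] s IH] hs; first by exists [::].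
have [|s' [s1 s2 s3]] := IH.
  by move=> p ps; apply: hs; rewrite inE ps orbT.
have [|||||be be0 hbe] := @constraint_multiplier R V K (w^~ e') (w^~ d) b' H.
- by move=> *; rewrite (sformDl sw) !(sformZl sw).
- by move=> *; rewrite (sformDl sw) !(sformZl sw).
- exact: cK.
- exact: x0.
- by apply: (hs (d, H)); rewrite inE eqxx.
exists ((d - be *: e', H - b' * be, be) :: s'); split => /=.
- by rewrite subrK s1.
- by rewrite subrK s2.
- move=> p; rewrite inE => /predU1P[->|/s3//]; split => //= x /hbe.
  by rewrite (sformDr sw) (sformNr sw) (sformZr sw); lra.
Qed.

(** If all multipliers of one piece vanish, its polygon obeys the inequality of [K] alone. Otherwise
    the multiples of [e] in each polygon are gathered in one segment and the polygons are glued with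
    the factor [r = B1 / B2]. The terms [b * B1] and [- b * B2] of the two lengths cancel with the
    same factor, so the glued polygon has length [L1 + r * L2]. *)
Lemma cut_polygon_inequality (s1 s2 : seq (V * R)) :
  (exists2 x, K x & w x e < b) -> (exists2 x, K x & b < w x e) ->
  \sum_(p <- s1) p.1 = 0 -> \sum_(p <- s2) p.1 = 0 ->
  (forall p, p \in s1 -> forall x, K x -> w x e <= b -> w x p.1 <= p.2) ->
  (forall p, p \in s2 -> forall x, K x -> b <= w x e -> w x p.1 <= p.2) ->
  let L1 := \sum_(p <- s1) p.2 in let L2 := \sum_(p <- s2) p.2 in
  let Q1 := pairsum w [seq p.1 | p <- s1] in
  let Q2 := pairsum w [seq p.1 | p <- s2] in
  [\/ C * Q1 <= L1 ^+ 2, C * Q2 <= L2 ^+ 2 |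
   exists2 r, 0 < r & C * (Q1 + r ^+ 2 * Q2) <= (L1 + r * L2) ^+ 2].
Proof.
move=> x1 [x2 Kx2 x2b] z1 z2 h1 h2 L1 L2 Q1 Q2.
have [t1 [t11 t12 t13]] := multipliers x1 h1.
(* The second piece is a sublevel set for [- e] and [- b]; its segment therefore points the opposite
   way. *)
have [||t2 [t21 t22 t23]] := @multipliers (- e) (- b) s2.
- by exists x2 => //; rewrite (sformNr sw) ltrN2.
- by move=> p ps x Kx; rewrite (sformNr sw) lerN2 => /(h2 p ps x Kx).
have sum0 (t : seq (V * R * R)) : \sum_(p <- t) p.2 = 0 ->
    (forall p, p \in t -> 0 <= p.2) -> forall p, p \in t -> p.2 = 0.
  move=> t00 t0 p pt; apply/eqP; rewrite eq_le t0// andbT.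
  rewrite -t00 (perm_big _ (perm_to_rem pt)) big_cons lerDl big_seq sumr_ge0// => q.
  by move/mem_rem; exact: t0.
have easy (e' : V) (b' : R) (t : seq (V * R * R)) (s : seq (V * R)) :
    [seq p.1.1 + p.2 *: e' | p <- t] = [seq p.1 | p <- s] ->
    [seq p.1.2 + b' * p.2 | p <- t] = [seq p.2 | p <- s] ->
    (forall p, p \in t -> 0 <= p.2 /\ forall x, K x -> w x p.1.1 <= p.1.2) ->
    \sum_(p <- s) p.1 = 0 -> \sum_(p <- t) p.2 = 0 ->
    C * pairsum w [seq p.1 | p <- s] <= (\sum_(p <- s) p.2) ^+ 2.
  move=> ts1 ts2 ht s0 t0.
  have t00 : forall p, p \in t -> p.2 = 0 by apply: sum0 => // p /ht[].
  rewrite -ts1 (_ : [seq _ | p <- t] = [seq p.1 | p <- [seq p.1 | p <- t]]); last first.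
    rewrite -map_comp; apply/eq_in_map => p pt /=; by rewrite t00// scale0r addr0.
  rewrite (_ : \sum_(p <- s) p.2 = \sum_(p <- [seq p.1 | p <- t]) p.2); last first.
    have -> : \sum_(p <- s) p.2 = \sum_(x <- [seq p.2 | p <- s]) x by rewrite big_map.
    rewrite -ts2 !big_map; apply: eq_big_seq => p pt /=.
    by rewrite t00// mulr0 addr0.
  apply: isoK.
    have : \sum_(x <- [seq p.1 | p <- s]) x = 0 by rewrite big_map.
    rewrite -ts1 !big_map => H0; rewrite -[RHS]H0; apply: eq_big_seq => p pt /=.
    by rewrite t00// scale0r addr0.
  by move=> p /mapP[q qt ->]; have [] := ht q qt.
pose B1 := \sum_(p <- t1) p.2; pose B2 := \sum_(p <- t2) p.2.
have [B10|B10] := eqVneq B1 0; first by apply: Or31; exact: easy t11 t12 t13 z1 B10.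
have [B20|B20] := eqVneq B2 0; first by apply: Or32; exact: easy t21 t22 t23 z2 B20.
have {}B10 : 0 < B1.
  by rewrite lt_def B10 /B1 big_seq sumr_ge0// => p /t13[].
have {}B20 : 0 < B2.
  by rewrite lt_def B20 /B2 big_seq sumr_ge0// => p /t23[].
apply: Or33; exists (B1 / B2); first exact: divr_gt0.
have split2 (e' : V) (t : seq (V * R * R)) :
    (forall p, p \in t -> 0 <= p.2) -> \sum_(p <- t) (p.1.1 + p.2 *: e') = 0 ->
    exists a1 a2, t = a1 ++ a2 /\ pairsum w [seq p.1.1 + p.2 *: e' | p <- t] <=
    pairsum w ([seq p.1.1 | p <- a1] ++
      (\sum_(p <- t) p.2) *: e' :: [seq p.1.1 | p <- a2]).
  move=> t0 te; have [||a1 [a2 [aE]]] := @concentrate _ _ w sw e' [seq (p.1.1, p.2) | p <- t].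
  - by move=> p /mapP[q /t0 q0 ->].
  - by rewrite big_map.
  rewrite big_map -map_comp => H.
  have aE1 : [seq (p.1.1, p.2) | p <- take (size a1) t] = a1 by rewrite map_take aE take_size_cat.
  have aE2 : [seq (p.1.1, p.2) | p <- drop (size a1) t] = a2 by rewrite map_drop aE drop_size_cat.
  exists (take (size a1) t), (drop (size a1) t); rewrite cat_take_drop; split=> //.
  by move: H; rewrite -{1}aE1 -{1}aE2 -!map_comp.
have [||a1 [a2 [ta ha]]] := split2 e t1.
- by move=> p /t13[].
- have : \sum_(x <- [seq p.1 | p <- s1]) x = 0 by rewrite big_map.
  by rewrite -t11 big_map.
have [||c1 [c2 [tc hc]]] := split2 (- e) t2.
- by move=> p /t23[].
- have : \sum_(x <- [seq p.1 | p <- s2]) x = 0 by rewrite big_map.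
  by rewrite -t21 big_map.
pose r := B1 / B2; rewrite -/r.
have r0 : 0 < r by exact: divr_gt0.
pose M := [seq p.1 | p <- a1] ++ [seq (r *: p.1.1, r * p.1.2) | p <- c2 ++ c1] ++
  [seq p.1 | p <- a2].
have sa : \sum_(p <- a1) p.1.1 + \sum_(p <- a2) p.1.1 = - (B1 *: e).
  rewrite -big_cat -ta; apply/eqP; rewrite -addr_eq0 /B1 scaler_suml -big_split.
  have : \sum_(x <- [seq p.1 | p <- s1]) x = 0 by rewrite big_map.
  by rewrite -t11 big_map => ->.
have sc : \sum_(p <- c1) p.1.1 + \sum_(p <- c2) p.1.1 = B2 *: e.
  rewrite -big_cat -tc; apply/eqP; rewrite -subr_eq0 /B2 scaler_suml -sumrN -big_split.
  under eq_bigr do rewrite /= -scalerN.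
  have : \sum_(x <- [seq p.1 | p <- s2]) x = 0 by rewrite big_map.
  by rewrite -t21 big_map => ->.
have rB2 : r * B2 = B1 by rewrite divfK// gt_eqF.
have M1 : \sum_(p <- M) p.1 = 0.
  rewrite /M !big_cat /= !big_map /= -scaler_sumr big_cat /= (addrC (\sum_(p <- c2) _)) sc.
  by rewrite scalerA rB2 addrCA sa subrr.
have l1 : \sum_(p <- t1) p.1.2 + b * B1 = L1.
  have -> : L1 = \sum_(x <- [seq p.2 | p <- s1]) x by rewrite big_map.
  by rewrite -t12 big_map big_split mulr_sumr.
have l2 : \sum_(p <- t2) p.1.2 - b * B2 = L2.
  have -> : L2 = \sum_(x <- [seq p.2 | p <- s2]) x by rewrite big_map.
  by rewrite -t22 big_map big_split -mulNr mulr_sumr.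
have M2 : \sum_(p <- M) p.2 = L1 + r * L2.
  rewrite /M !big_cat /= !big_map /= -mulr_sumr -l1 -l2 {1}ta tc !big_cat /=.
  by rewrite -rB2; ring.
have := isoK M1; rewrite M2 => H.
apply: le_trans (H _).
  rewrite ler_wpM2l// (_ : [seq p.1 | p <- M] = [seq p.1.1 | p <- a1] ++
    [seq r *: x | x <- [seq p.1.1 | p <- c2] ++ [seq p.1.1 | p <- c1]] ++
    [seq p.1.1 | p <- a2]); last by rewrite /M !map_cat -!map_comp.
  rewrite (@glue_pairsum _ _ w sw e) ?big_map// ?gt_eqF//; apply: lerD.
    by rewrite /Q1 -t11.
  rewrite ler_wpM2l ?sqr_ge0// /Q2 -t21.
  by move: hc; rewrite scalerN -scaleNr.
move=> p; rewrite /M !mem_cat => /or3P[/mapP[q qa ->]|/mapP[q qc ->]|/mapP[q qa ->]] x Kx.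
- by have [|_] := t13 q; [rewrite ta mem_cat qa|exact].
- have [|_] := t23 q; first by rewrite tc mem_cat orbC -mem_cat.
  by move=> /(_ x Kx) h; rewrite /= (sformZr sw) ler_pM2l.
- by have [|_] := t13 q; [rewrite ta mem_cat qa orbT|exact].
Qed.

End cut_polygons.

(** [h] is the relative loss of area when characteristics are replaced by inscribed polygons.
    Cauchy-Schwarz, in the step [a2], compares the two sides with a bound free of [r]. *)
Lemma superadditive_limit {R : realType} (C L1 L2 : R) : 0 < L1 -> 0 < L2 ->
  (forall h, 0 < h -> h < 1 -> exists Q1 Q2, [/\ (1 - h) * L1 <= Q1, (1 - h) * L2 <= Q2 &
    [\/ C * Q1 <= L1 ^+ 2, C * Q2 <= L2 ^+ 2 |
      exists2 r, 0 < r & C * (Q1 + r ^+ 2 * Q2) <= (L1 + r * L2) ^+ 2]]) ->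
  C <= L1 + L2.
Proof.
move=> L10 L20 H; have [C0|C0] := leP C 0; first lra.
suff H1 : forall h, 0 < h -> h < 1 -> C * (1 - h) <= L1 + L2.
  apply/ler_addgt0Pr => e e0; pose k := Num.min (e / C) (1 / 2).
  have k0 : 0 < k by rewrite lt_min divr_gt0//=; lra.
  have k1 : k < 1 by rewrite gt_min; apply/orP; right; lra.
  have : k * C <= e by rewrite -ler_pdivlMr// ge_min lexx.
  by have := H1 k k0 k1; lra.
move=> h0 h00 h01; have [Q1 [Q2 [q1 q2]]] := H h0 h00 h01.
have d0 : 0 < 1 - h0 by lra.
have aux L Q : 0 < L -> (1 - h0) * L <= Q -> C * Q <= L ^+ 2 -> C * (1 - h0) <= L.
  move=> L0 LQ CQ; rewrite -(ler_pM2r L0) -mulrA; apply: le_trans CQ.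
  by rewrite ler_pM2l.
case=> [c1|c2|[r r0 c3]].
- by have := aux _ _ L10 q1 c1; lra.
- by have := aux _ _ L20 q2 c2; lra.
have X0 : 0 < L1 + r * L2 by rewrite addr_gt0// mulr_gt0.
have r20 : 0 < r ^+ 2 by rewrite exprn_gt0.
have a1 : C * ((1 - h0) * (L1 + r ^+ 2 * L2)) <= (L1 + r * L2) ^+ 2.
  apply: le_trans c3; rewrite ler_pM2l//.
  have : r ^+ 2 * ((1 - h0) * L2) <= r ^+ 2 * Q2 by rewrite ler_pM2l.
  lra.
have a2 : (L1 + r * L2) ^+ 2 <= (L1 + L2) * (L1 + r ^+ 2 * L2).
  have : 0 <= L1 * L2 * (1 - r) ^+ 2 by apply: mulr_ge0 (sqr_ge0 _); apply: mulr_ge0; exact: ltW.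
  by lra.
have Y0 : 0 < L1 + r ^+ 2 * L2 by rewrite addr_gt0// mulr_gt0.
by rewrite -(ler_pM2r Y0) -mulrA (le_trans a1).
Qed.

(** * Planar convex bodies *)

Section planar_profile.
Context {R : realType}.
Notation mu := (@lebesgue_measure R).
Implicit Types (W : set (R * R)).

Lemma segment_closed_pair W (p q : R * R) (t : R) : segment_closed W ->
  W p -> W q -> 0 <= t <= 1 ->
  W (t * p.1 + (1 - t) * q.1, t * p.2 + (1 - t) * q.2).
Proof. by move=> cW Wp Wq t01; have := cW p q t Wp Wq t01. Qed.

Lemma compact_snd_bounded W : compact W -> exists2 C, 0 < C & forall p, W p -> `|p.2| <= C.
Proof.
move=> cW; have [->|/set0P W0] := eqVneq W set0; first by exists 1.
have [|c _ Hc] := @compact_EVT_max _ R (fun p : R * R => `|p.2|) W W0 cW.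
  by apply: continuous_subspaceT => p; apply: cvg_norm; exact: cvg_snd.
exists (`|c.2| + 1); first by rewrite ltr_wpDl.
by move=> p Wp; rewrite (le_trans (Hc p (mem_set Wp)))// lerDl.
Qed.

Lemma clamp_dist (a b x y : R) :
  `|Num.max a (Num.min x b) - Num.max a (Num.min y b)| <= `|x - y|.
Proof.
wlog xy : x y / x <= y => [H|].
  by case: (leP x y) => [|/ltW] xy; [|rewrite distrC (distrC x)]; exact: H.
have h1 : Num.max a (Num.min x b) <= Num.max a (Num.min y b).
  have h : Num.min x b <= Num.min y b.
    by rewrite le_min !ge_min lexx xy orbT.
  by rewrite ge_max !le_max lexx h orbT.
rewrite !ler0_norm ?subr_le0// !opprB lerBlDr ge_max; apply/andP; split.
  have : a <= Num.max a (Num.min x b) by rewrite le_max lexx.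
  lra.
have [h|h] := leP x b; have : Num.min x b <= Num.max a (Num.min x b) by rewrite le_max lexx orbT.
  have : Num.min y b <= y by rewrite ge_min lexx.
  by rewrite (min_idPl h); lra.
have : Num.min y b <= b by rewrite ge_min lexx orbT.
by rewrite (min_idPr (ltW h)); lra.
Qed.

(** Upper semicontinuity comes from compactness and lower semicontinuity from convexity, ends of the
    interval included. The function is continued by constants, so that it has a primitive on the
    whole line. *)
Lemma upper_profile W (xl xr : R) : compact W -> segment_closed W -> xl < xr ->
  (exists y, W (xl, y)) -> (exists y, W (xr, y)) ->
  exists2 h : R -> R, continuous h &
  forall x, xl <= x <= xr -> W (x, h x) /\ forall y, W (x, y) -> y <= h x.
Proof.
move=> cW sW lr [yl Wl] [yr Wr].
have ex x : exists y, xl <= x <= xr -> W (x, y) /\ forall z, W (x, z) -> z <= y.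
  have [xlr|_] := boolP (xl <= x <= xr); last by exists 0.
  have cS : compact (W `&` fst @^-1` [set x]).
    apply: compact_closedI => //; apply: closed_comp; last exact: closed_eq.
    by move=> p _; exact: cvg_fst.
  have S0 : W `&` fst @^-1` [set x] !=set0.
    pose t := (xr - x) / (xr - xl); exists (x, t * yl + (1 - t) * yr).
    have t01 : 0 <= t <= 1.
      case/andP: xlr => h1 h2; apply/andP; split; first by apply: divr_ge0; lra.
      by rewrite ler_pdivrMr; lra.
    split=> //; have := segment_closed_pair sW Wl Wr t01 => /=.
    have -> // : t * xl + (1 - t) * xr = x by rewrite /t; field; lra.
  have [|c /set_mem[Wc cx] Hc] := @compact_EVT_max _ R snd _ S0 cS.
    by apply: continuous_subspaceT => p; exact: cvg_snd.
  exists c.2 => _; split; first by rewrite -[x]cx -surjective_pairing.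
  by move=> z Wz; apply: (Hc (x, z)); exact: mem_set.
have {ex} [h Hh] := choice ex.
have [C C0 HC] := compact_snd_bounded cW.
pose cl x := Num.max xl (Num.min x xr).
have clP x : xl <= cl x <= xr.
  by rewrite /cl; case: (leP x xr) => ?; [case: (leP xl x)|case: (leP xl xr)] => ?; lra.
have clid x : xl <= x <= xr -> cl x = x.
  by rewrite /cl; case: (leP x xr) => ?; [case: (leP xl x)|case: (leP xl xr)] => ?; lra.
have cll x y : `|cl x - cl y| <= `|x - y| by exact: clamp_dist.
have hC x : xl <= x <= xr -> - C <= h x <= C.
  by move=> /Hh[/HC + _]; rewrite ler_norml.
(* The part of [W] at height at least [h x0 + e] projects to a closed set that misses [x0]. *)
have usc x0 e : 0 < e -> xl <= x0 <= xr -> exists2 d, 0 < d &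
    forall x, xl <= x <= xr -> `|x - x0| < d -> h x < h x0 + e.
  move=> e0 x0lr; pose B := W `&` snd @^-1` [set y | h x0 + e <= y].
  have cB : compact B.
    apply: compact_closedI => //; apply: closed_comp; last exact: closed_ge.
    by move=> p _; exact: cvg_snd.
  have cfB : closed (fst @` B).
    apply: compact_closed; first exact: Rhausdorff.
    by apply: continuous_compact => //; apply: continuous_subspaceT => p; exact: cvg_fst.
  have nx0 : (~` (fst @` B)) x0.
    move=> [[x y] [Wxy /= hy] /= xx0]; have [_ /(_ y)] := Hh _ x0lr.
    by rewrite -xx0 => /(_ Wxy); rewrite xx0; lra.
  have /nbhs_ballP[d /= d0 Hd] := open_nbhs_nbhs (conj (closed_openC cfB) nx0).
  exists d => // x xlr xd; rewrite ltNge; apply/negP => hx.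
  apply: (Hd x); first by rewrite /ball/= distrC.
  by exists (x, h x) => //; split => //; have [] := Hh x xlr.
(* The segment from [(x0, h x0)] to [(x1, h x1)] lies in [W], hence below [h], and the bound [C] on
   [|h|] limits how steeply it can fall. *)
have lsc1 x0 x x1 : xl <= x0 <= xr -> xl <= x1 <= xr -> xl <= x <= xr -> x1 != x0 ->
    0 <= (x - x0) / (x1 - x0) <= 1 ->
    h x0 - 2 * C * ((x - x0) / (x1 - x0)) <= h x.
  move=> i0 i1 ix x10; set t := (_ / _) => t01.
  have [W1 _] := Hh x1 i1; have [W0 _] := Hh x0 i0; have [_ Hx] := Hh x ix.
  have := segment_closed_pair sW W1 W0 t01 => /=.
  have -> : t * x1 + (1 - t) * x0 = x.
    rewrite mulrBl mul1r addrCA -mulrBr /t divfK ?subr_eq0//; lra.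
  move=> /Hx; case/andP : (hC _ i0) => _ h0; case/andP : (hC _ i1) => h1 _.
  have : t * (h x1 - h x0) >= t * (- (2 * C)) by apply: ler_wpM2l; [case/andP: t01|lra].
  lra.
have lsc x0 e : 0 < e -> xl <= x0 <= xr -> exists2 d, 0 < d &
    forall x, xl <= x <= xr -> `|x - x0| < d -> h x0 - e < h x.
  clear -lsc1 C0; move=> e0 x0lr; pose k := e / (2 * C).
  have k0 : 0 < k by rewrite divr_gt0// mulr_gt0.
  have hk t : t < k -> 2 * C * t < e.
    by rewrite /k ltr_pdivlMr ?mulr_gt0// mulrC.
  have right x : xl <= x <= xr -> x0 < x -> x - x0 < k * (xr - x0) -> h x0 - e < h x.
    move=> ix x0x xk; have xr0 : 0 < xr - x0 by lra.
    have := lsc1 x0 x xr x0lr; move=> /(_ ltac:(lra) ix ltac:(rewrite gt_eqF; lra)).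
    rewrite divr_ge0 ?ler_pdivrMr// ?mul1r; try lra.
    move=> /(_ ltac:(apply/andP; split; lra)).
    have : (x - x0) / (xr - x0) < k by rewrite ltr_pdivrMr.
    by move=> /hk; lra.
  have left x : xl <= x <= xr -> x < x0 -> x0 - x < k * (x0 - xl) -> h x0 - e < h x.
    move=> ix x0x xk; have xr0 : 0 < x0 - xl by lra.
    have E : (x - x0) / (xl - x0) = (x0 - x) / (x0 - xl) by field; apply/andP; split; lra.
    have := lsc1 x0 x xl x0lr; move=> /(_ ltac:(lra) ix ltac:(rewrite lt_eqF; lra)).
    rewrite E divr_ge0 ?ler_pdivrMr// ?mul1r; try lra.
    move=> /(_ ltac:(apply/andP; split; lra)).
    have : (x0 - x) / (x0 - xl) < k by rewrite ltr_pdivrMr.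
    by move=> /hk; lra.
  pose dr := if x0 == xr then 1 else k * (xr - x0).
  pose dl := if x0 == xl then 1 else k * (x0 - xl).
  have dr0 : 0 < dr.
    by rewrite /dr; case: eqVneq => // ne; rewrite mulr_gt0// subr_gt0 lt_neqAle ne; case/andP: x0lr.
  have dl0 : 0 < dl.
    by rewrite /dl; case: eqVneq => // ne; rewrite mulr_gt0// subr_gt0 lt_neqAle eq_sym ne; case/andP: x0lr.
  exists (Num.min dr dl); first by rewrite lt_min dr0.
  move=> x ix; rewrite lt_min => /andP[xdr xdl].
  have [xx0|x0x|->] := ltgtP x x0; last lra.
    apply: left => //; move: xdl; rewrite /dl; case: eqVneq => [?|_]; first lra.
    by rewrite distrC ger0_norm; lra.
  apply: right => //; move: xdr; rewrite /dr; case: eqVneq => [?|_]; first lra.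
  by rewrite ger0_norm; lra.
exists (h \o cl); last by move=> x xlr /=; rewrite clid//; exact: Hh.
move=> x0; apply/cvgrPdist_lt => e e0.
have [d1 d10 H1] := usc (cl x0) e e0 (clP x0).
have [d2 d20 H2] := lsc (cl x0) e e0 (clP x0).
near=> x; have xd : `|x0 - x| < Num.min d1 d2.
  by near: x; apply: cvgr_dist_lt; [exact: cvg_id|rewrite lt_min d10].
move: xd; rewrite lt_min distrC => /andP[x1 x2].
have := H1 (cl x) (clP x) (le_lt_trans (cll _ _) x1).
have := H2 (cl x) (clP x) (le_lt_trans (cll _ _) x2).
by rewrite /= ltr_norml; lra.
Unshelve. all: by end_near. Qed.

End planar_profile.

Section primitive.
Context {R : realType}.
Notation mu := (@lebesgue_measure R).

Lemma is_derive_near_eq (f g : R -> R) (x l d : R) : 0 < d ->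
  (forall y, `|y - x| < d -> f y = g y) -> is_derive x 1 f l -> is_derive x 1 g l.
Proof.
move=> d0 fg /is_derive_epsP H; apply/is_derive_epsP => e e0.
have [d1 d10 H1] := H e e0; exists (Num.min d d1); first by rewrite lt_min d0.
move=> h; rewrite lt_min => /andP[hd hd1].
have -> : g (x + h) = f (x + h) by rewrite fg// addrAC subrr add0r.
have -> : g x = f x by rewrite fg// subrr normr0.
exact: H1.
Qed.

Lemma continuous_itv_integrable (k : R -> R) (a b : R) : continuous k ->
  mu.-integrable `[a, b] (EFin \o k).
Proof.
move=> ck; apply: continuous_compact_integrable; first exact: segment_compact.
exact: continuous_subspaceT.
Qed.

Lemma continuous_primitive (k : R -> R) : continuous k ->
  exists S : R -> R, forall x : R, is_derive x 1 S (k x).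
Proof.
move=> ck; pose I a b := \int[mu]_(t in `[a, b]) k t.
pose S y := if 0 <= y then I 0 y else - I y 0.
have IB a b c : a <= b -> b <= c -> I a c - I a b = I b c.
  move=> ab bc; rewrite /I Rintegral_itvB ?bnd_simp//; last exact: continuous_itv_integrable.
  rewrite Rintegral_itv_obnd_cbnd//.
  by apply: integrableS (continuous_itv_integrable b c ck) => //; exact: subset_itv_oc_cc.
have dI (a x : R) : a < x -> is_derive x 1 (I a) (k x).
  move=> ax; have xx1 : x < x + 1 by rewrite ltrDl.
  have [|dI Ix] := @continuous_FTC1 R k (BLeft a) x (x + 1) xx1
    (continuous_itv_integrable a (x + 1) ck) _ (ck x); first by rewrite /= lte_fin.
  by rewrite -Ix derive1E; exact: derivableP.
clearbody I.
exists S => x; pose m := `|x| + 1.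
have m0 : 0 <= m by rewrite addr_ge0.
have mx : - m + 1 <= x by have := ler_norm (- x); rewrite normrN /m; lra.
have SE y : - m <= y -> I (- m) y - I (- m) 0 = S y.
  rewrite /S; case: ifPn => y0 my; first by rewrite IB//; lra.
  rewrite -ltNge in y0; rewrite -(IB (- m) y 0) ?(ltW y0)//; lra.
apply: (@is_derive_near_eq (fun y => I (- m) y - I (- m) 0) S x (k x) 1) => //.
  by move=> y; rewrite ltr_norml => /andP[y1 y2]; apply: SE; lra.
apply: is_derive_eq; first by apply: is_deriveB; apply: dI; lra.
by rewrite subr0.
Qed.

End primitive.

Section planar_body.
Context {R : realType}.
Notation mu := (@lebesgue_measure R).
Implicit Types (W : set (R * R)).

(** [Lo] and [Hi] are global primitives of the lower and upper boundary functions. They turn the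
    area, and later the integrals along the boundary, into differences. *)
Record planar_profile W (xl xr : R) (lo hi Lo Hi : R -> R) : Prop := {
  profile_lt : xl < xr ;
  profile_lo : forall x : R, is_derive x 1 Lo (lo x) ;
  profile_hi : forall x : R, is_derive x 1 Hi (hi x) ;
  profile_in : forall x, xl <= x <= xr -> W (x, lo x) /\ W (x, hi x) ;
  profile_sub : forall x y, W (x, y) -> xl <= x <= xr /\ lo x <= y <= hi x ;
  profile_area : area W = ((Hi xr - Hi xl) - (Lo xr - Lo xl))%:E }.

(** The upper boundary function is constructed for [W] and for its mirror image. The area follows by
    integrating the lengths of the vertical sections. *)
Lemma planar_profile_exists W : convex_body W ->
  exists xl xr lo hi Lo Hi, planar_profile W xl xr lo hi Lo Hi.
Proof.
move=> [cW /convex_set_segment_closed sW [p0 /= Wp0]].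
have W0 : W !=set0 by exists p0; exact: nbhs_singleton.
have cfst : {within W, continuous (@fst R R)}.
  by apply: continuous_subspaceT => p; exact: cvg_fst.
have [cl /set_mem Wcl Hcl] := compact_EVT_min W0 cW cfst.
have [cr /set_mem Wcr Hcr] := compact_EVT_max W0 cW cfst.
have lr : cl.1 < cr.1.
  have /nbhs_ballP[e /= e0 He] := Wp0.
  have Wq : W (p0.1 + e / 2, p0.2).
    apply: He; split => /=; last exact: ballxx.
    by rewrite /ball /= opprD addNKr normrN gtr0_norm; lra.
  have := Hcl _ (mem_set (nbhs_singleton Wp0)); have := Hcr _ (mem_set Wq).
  by move=> /=; lra.
have Wl : exists y, W (cl.1, y) by exists cl.2; rewrite -surjective_pairing.
have Wr : exists y, W (cr.1, y) by exists cr.2; rewrite -surjective_pairing.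
have [hi chi Hhi] := upper_profile cW sW lr Wl Wr.
pose refl (p : R * R) := (p.1, - p.2).
have reflK : involutive refl by move=> [x y]; rewrite /refl /= opprK.
pose W' := refl @` W.
have W'E x y : W' (x, y) <-> W (x, - y).
  split; first by move=> [[a b] Wab [<- <-]]; rewrite opprK.
  by move=> Wxy; exists (x, - y) => //; exact: (reflK (x, y)).
have cW' : compact W'.
  apply: continuous_compact => //; apply: continuous_subspaceT => p.
  move=> A [[B C] /= [pB pC] BC].
  have h1 : \forall q \near p, B q.1 by exact: (cvg_fst pB).
  have h2 : \forall q \near p, C (- q.2) by exact: (cvgN cvg_snd pC).
  suff : \forall q \near p, A (refl q) by [].
  by apply: filterS2 h1 h2 => q q1 q2; apply: (BC (refl q)); split.
have sW' : segment_closed W'.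
  move=> [x1 y1] [x2 y2] t /W'E h1 /W'E h2 t01; apply/W'E.
  have := segment_closed_pair sW h1 h2 t01 => /=.
  by rewrite opprD -!mulrN.
have [||lo clo Hlo] := upper_profile cW' sW' lr.
- by have [y Wy] := Wl; exists (- y); apply/W'E; rewrite opprK.
- by have [y Wy] := Wr; exists (- y); apply/W'E; rewrite opprK.
have cNlo : continuous (\- lo) by move=> x; apply: cvgN; exact: clo.
have [Hi HHi] := continuous_primitive chi.
have [Lo HLo] := continuous_primitive cNlo.
have sub x y : W (x, y) -> cl.1 <= x <= cr.1 /\ - lo x <= y <= hi x.
  move=> Wxy; have xlr : cl.1 <= x <= cr.1.
    by rewrite (Hcl _ (mem_set Wxy)) (Hcr _ (mem_set Wxy)).
  split=> //; have [_ /(_ _ Wxy) ->] := Hhi x xlr; rewrite andbT lerNl.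
  by have [_] := Hlo x xlr; apply; apply/W'E; rewrite opprK.
have inn x : cl.1 <= x <= cr.1 -> W (x, - lo x) /\ W (x, hi x).
  by move=> xlr; have [/W'E h1 _] := Hlo x xlr; have [h2 _] := Hhi x xlr.
exists cl.1, cr.1, (\- lo), hi, Lo, Hi; split => //.
rewrite /area /product_measure1.
transitivity (\int[mu]_(x in `[cl.1, cr.1]) (hi x - - lo x)%:E)%E.
  rewrite [RHS]integral_mkcond; apply: eq_integral => x _; rewrite patchE.
  case: ifPn => [/set_mem /=|/negP]; rewrite ?in_itv /= => xlr.
    have -> : xsection W x = `[- lo x, hi x]%classic.
      apply/seteqP; split => y /=; rewrite /xsection /= inE in_itv /=.
        by move=> /sub[].
      move=> /andP[y1 y2]; have [h1 h2] := inn x xlr.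
      have [yE|ne] := eqVneq (hi x) (- lo x).
        by have -> : y = hi x by apply/eqP; rewrite eq_le y2 yE y1.
      have d0 : 0 < hi x - - lo x by rewrite subr_gt0 lt_neqAle eq_sym ne (le_trans y1).
      pose t := (y - - lo x) / (hi x - - lo x).
      have t01 : 0 <= t <= 1.
        apply/andP; split; first by apply: divr_ge0; lra.
        by rewrite ler_pdivrMr// mul1r; lra.
      have := segment_closed_pair sW h2 h1 t01 => /=.
      have -> : t * x + (1 - t) * x = x by ring.
      have -> // : t * hi x + (1 - t) * - lo x = y.
      have : t * (hi x - - lo x) = y - - lo x by rewrite divfK// gt_eqF.
      lra.
    rewrite lebesgue_measure_itv /= lte_fin; case: ltP => [_|h]; first by rewrite EFinB.
    have [h1 _] := inn x xlr; have [_] := sub _ _ h1 => /andP[_ h2].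
    by have -> : hi x - - lo x = 0 by lra.
  rewrite (_ : xsection W x = set0) ?measure0//.
  apply/seteqP; split => // y; rewrite /xsection /= inE => /sub[h _].
  by apply: xlr; rewrite inE /= in_itv.
have chl : continuous (fun x => hi x - - lo x).
  by move=> x; apply: cvgB; [exact: chi|exact: cNlo].
have dF (x : R) : is_derive x 1 (fun x => Hi x - Lo x) (hi x - - lo x).
  exact: is_deriveB.
have cF : continuous (fun x => Hi x - Lo x).
  by move=> x; apply: differentiable_continuous; apply/derivable1_diffP; have [] := dF x.
rewrite (@continuous_FTC2 _ _ (fun x => Hi x - Lo x))//.
- by rewrite -EFinB; congr EFin; lra.
- exact: continuous_subspaceT.
- split => [x _| |].
  + by have [] := dF x.
  + by apply: cvg_at_right_filter; exact: cF.
  + by apply: cvg_at_left_filter; exact: cF.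
- by move=> x _; rewrite derive1E; have [_] := dF x.
Qed.

End planar_body.

(** * Minkowski's first inequality for polygons and a planar body *)

Section planar_isoperimetry.
Context {R : realType}.
Implicit Types (W : set (R * R)).

Definition det2 (u v : R * R) : R := u.1 * v.2 - u.2 * v.1.

Lemma det2_form : symplectic_form det2.
Proof.
split => [x y z|a x y|x y]; rewrite /det2 /=; last ring.
  by rewrite !mulrDl; ring.
by rewrite /GRing.scale /=; ring.
Qed.

Lemma is_derive_nonincreasing (f df : R -> R) (a b : R) : a <= b ->
  (forall x : R, is_derive x 1 f (df x)) -> (forall x, a <= x <= b -> df x <= 0) ->
  f b <= f a.
Proof.
move=> ab fd d0.
have [|c /[!in_itv] /= cab fba] := @MVT_segment R f df a b ab (fun x _ => fd x).
  apply: continuous_subspaceT => x.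
  by apply: differentiable_continuous; apply/derivable1_diffP; have [] := fd x.
by rewrite -subr_le0 fba mulr_le0_ge0 ?subr_ge0// d0.
Qed.

(** Schmidt's comparison: abscissas of the edge are matched affinely, with factor [r], to abscissas
    of the graph of [f]. The support inequality at the matched point of the graph, multiplied by [r]
    and integrated along the edge, is the claim; [G] is the integrated form and [dG] its
    derivative. *)
Lemma edge_inequality (f F : R -> R) (xl xr r m h x : R) (d : R * R) : 0 < r ->
  (forall x : R, is_derive x 1 F (f x)) ->
  (forall z, xl <= z <= xr -> det2 (z, f z) d <= h) ->
  xl <= xl + (x - m) / r <= xr -> xl <= xl + (x + d.1 - m) / r <= xr ->
  (x + d.1 / 2 + (r * xl - m)) * d.2 -
  r ^+ 2 * (F (xl + (x + d.1 - m) / r) - F (xl + (x - m) / r)) <= r * h.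
Proof.
move=> r0 dF hf h0 h1; case: d hf h1 => dx dy /= hf h1.
pose xi s := xl + (x + s * dx - m) / r.
pose G s := (x + r * xl - m) * dy * s + dx * dy / 2 * s ^+ 2 - r ^+ 2 * F (xi s) - r * h * s.
pose dG s := (x + r * xl - m) * dy + dx * dy * s - r * dx * f (xi s) - r * h.
have r0' : r != 0 by rewrite gt_eqF.
have dxi (s : R) : is_derive s 1 xi (dx / r).
  by rewrite /xi; apply: is_derive_eq; rewrite /GRing.scale /=; ring.
have dGE (s : R) : is_derive s 1 G (dG s).
  have dFxi : is_derive s 1 (fun s => F (xi s)) (f (xi s) * (dx / r)).
    exact: (is_derive1_comp (dF (xi s)) (dxi s)).
  rewrite /G; apply: is_derive_eq; rewrite /GRing.scale /= /dG.
  by field.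
have xiE s : r * xi s = x + s * dx + (r * xl - m) by rewrite /xi; field.
have : G 1 <= G 0.
  apply: (is_derive_nonincreasing ler01 dGE) => s /andP[s0 s1].
  have xis : xl <= xi s <= xr.
    have -> : xi s = (1 - s) * xi 0 + s * xi 1 by rewrite /xi; field.
    rewrite /xi mul0r addr0 mul1r.
    move: h0 h1; move: (xl + (x - m) / r) (xl + (x + dx - m) / r) => p q /andP[p1 p2] /andP[q1 q2].
    have : (1 - s) * xl <= (1 - s) * p <= (1 - s) * xr by rewrite !ler_wpM2l//; lra.
    have : s * xl <= s * q <= s * xr by rewrite !ler_wpM2l.
    lra.
  have := hf _ xis; rewrite /det2 /= /dG -subr_le0 => H.
  have : r * (xi s * dy - f (xi s) * dx - h) <= 0 by rewrite mulr_ge0_le0// ltW.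
  rewrite !mulrBr mulrA xiE; lra.
rewrite /G /xi mul1r mul0r addr0; lra.
Qed.

(** The integral of x dy along the path with edges [p.1] that starts at abscissa [x]. *)
Fixpoint moment (x : R) (l : seq ((R * R) * R)) : R :=
  if l is p :: l' then (x + p.1.1 / 2) * p.1.2 + moment (x + p.1.1) l' else 0.

Lemma moment_cat x l1 l2 :
  moment x (l1 ++ l2) = moment x l1 + moment (x + \sum_(p <- l1) p.1.1) l2.
Proof.
elim: l1 x => [|p l1 IH] x /=; first by rewrite big_nil addr0 add0r.
by rewrite IH big_cons !addrA.
Qed.

Lemma sum_fst (l : seq (R * R)) : (\sum_(p <- l) p).1 = \sum_(p <- l) p.1.
Proof. by elim: l => [|p l IH]; rewrite ?big_nil// !big_cons /= IH. Qed.

Lemma sum_snd (l : seq (R * R)) : (\sum_(p <- l) p).2 = \sum_(p <- l) p.2.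
Proof. by elim: l => [|p l IH]; rewrite ?big_nil// !big_cons /= IH. Qed.

Lemma moment_pairsum x l : 2 * moment x l = pairsum det2 [seq p.1 | p <- l] +
  2 * x * (\sum_(p <- l) p.1.2) + (\sum_(p <- l) p.1.1) * (\sum_(p <- l) p.1.2).
Proof.
elim: l x => [|p l IH] x /=; first by rewrite !big_nil; ring.
rewrite mulrDr IH !big_cons /det2 sum_fst sum_snd !big_map; by field.
Qed.

Section isoperimetry.
Variables (W : set (R * R)) (xl xr : R) (lo hi Lo Hi : R -> R).
Hypothesis HW : planar_profile W xl xr lo hi Lo Hi.
Let A := (Hi xr - Hi xl) - (Lo xr - Lo xl).

Lemma profile_area_ge0 : 0 <= A.
Proof.
have [lt_lr dlo dhi inW subW _] := HW.
have : (Lo \- Hi) xr <= (Lo \- Hi) xl.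
  apply: (@is_derive_nonincreasing (fun x => Lo x - Hi x) (fun x => lo x - hi x)).
  - exact: ltW.
  -  move=> x /inW[/subW[_ + _]]; lra.
by rewrite /A /=; lra.
Qed.

Lemma piece_inequality (r m : R) (F f : R -> R) (x : R) (l : seq ((R * R) * R)) : 0 < r ->
  (forall x : R, is_derive x 1 F (f x)) ->
  (forall z, xl <= z <= xr -> W (z, f z)) ->
  (forall p, p \in l -> forall w, W w -> det2 w p.1 <= p.2) ->
  (forall t1 t2, l = t1 ++ t2 ->
     xl <= xl + (x + \sum_(p <- t1) p.1.1 - m) / r <= xr) ->
  moment x l + (r * xl - m) * \sum_(p <- l) p.1.2 -
    r ^+ 2 * (F (xl + (x + \sum_(p <- l) p.1.1 - m) / r) - F (xl + (x - m) / r))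
  <= r * \sum_(p <- l) p.2.
Proof.
move=> r0 dF fW; elim: l x => [|[d h] l IH] x hl pre /=.
  by rewrite !big_nil addr0 subrr; lra.
have pre' t1 t2 : l = t1 ++ t2 ->
    xl <= xl + (x + d.1 + \sum_(p <- t1) p.1.1 - m) / r <= xr.
  by move=> lt; have := pre ((d, h) :: t1) t2; rewrite big_cons /= addrA lt; apply.
have hl' p : p \in l -> forall w, W w -> det2 w p.1 <= p.2.
  by move=> pl; apply: hl; rewrite inE pl orbT.
have H2 := IH (x + d.1) hl' pre'.
have H1 := @edge_inequality f F xl xr r m h x d r0 dF.
have {}H1 : (x + d.1 / 2 + (r * xl - m)) * d.2 -
  r ^+ 2 * (F (xl + (x + d.1 - m) / r) - F (xl + (x - m) / r)) <= r * h.
  apply: H1.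
  - by move=> z zlr; apply: (hl (d, h)); [rewrite inE eqxx|exact: fW].
  - by have := pre [::] _ erefl; rewrite big_nil addr0.
  - by have := pre' [::] _ erefl; rewrite big_nil addr0.
rewrite !big_cons /= (addrA x d.1); lra.
Qed.

(** Splitting a closed polygon at two vertices lets the outer pieces be compared with one boundary
    graph and the middle piece with the other. *)
Lemma three_piece_inequality (r m : R) (F1 f1 F2 f2 : R -> R) (a u c : seq ((R * R) * R)) :
  0 < r ->
  (forall x : R, is_derive x 1 F1 (f1 x)) -> (forall z, xl <= z <= xr -> W (z, f1 z)) ->
  (forall x : R, is_derive x 1 F2 (f2 x)) -> (forall z, xl <= z <= xr -> W (z, f2 z)) ->
  \sum_(p <- a ++ u ++ c) p.1 = 0 ->
  (forall p, p \in a ++ u ++ c -> forall w, W w -> det2 w p.1 <= p.2) ->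
  (forall t1 t2, a ++ u ++ c = t1 ++ t2 ->
     xl <= xl + (\sum_(p <- t1) p.1.1 - m) / r <= xr) ->
  pairsum det2 [seq p.1 | p <- a ++ u ++ c] / 2 -
    r ^+ 2 * (F1 (xl + (\sum_(p <- a) p.1.1 - m) / r) - F1 (xl + (\sum_(p <- a ++ u) p.1.1 - m) / r) +
     F2 (xl + (\sum_(p <- a ++ u) p.1.1 - m) / r) - F2 (xl + (\sum_(p <- a) p.1.1 - m) / r))
  <= r * \sum_(p <- a ++ u ++ c) p.2.
Proof.
move=> r0 dF1 fW1 dF2 fW2 s0 hs pre.
have ha : forall p, p \in a -> forall w, W w -> det2 w p.1 <= p.2.
  by move=> p pa; apply: hs; rewrite mem_cat pa.
have hu : forall p, p \in u -> forall w, W w -> det2 w p.1 <= p.2.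
  by move=> p pa; apply: hs; rewrite !mem_cat pa orbT.
have hc : forall p, p \in c -> forall w, W w -> det2 w p.1 <= p.2.
  by move=> p pa; apply: hs; rewrite !mem_cat pa !orbT.
have sX : \sum_(p <- a ++ u ++ c) p.1.1 = 0.
  by rewrite -(big_map fst xpredT fst) -sum_fst big_map s0.
have sY : \sum_(p <- a ++ u ++ c) p.1.2 = 0.
  by rewrite -(big_map fst xpredT snd) -sum_snd big_map s0.
have := moment_pairsum 0 (a ++ u ++ c).
rewrite sX sY !mulr0 !addr0 !moment_cat !add0r => Q.
have Ia := piece_inequality (m := m) (x := 0) r0 dF1 fW1 ha _.
have Iu := piece_inequality (m := m) (x := \sum_(p <- a) p.1.1) r0 dF2 fW2 hu _.
have Ic := piece_inequality (m := m) (x := \sum_(p <- a) p.1.1 + \sum_(p <- u) p.1.1) r0 dF1 fW1 hc _.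
have pa t1 t2 : a = t1 ++ t2 -> xl <= xl + (0 + \sum_(p <- t1) p.1.1 - m) / r <= xr.
  by move=> E; rewrite add0r; apply: (pre t1 (t2 ++ u ++ c)); rewrite E -catA.
have pu t1 t2 : u = t1 ++ t2 ->
    xl <= xl + (\sum_(p <- a) p.1.1 + \sum_(p <- t1) p.1.1 - m) / r <= xr.
  by move=> E; rewrite -big_cat; apply: (pre (a ++ t1) (t2 ++ c)); rewrite E -!catA.
have pc t1 t2 : c = t1 ++ t2 ->
    xl <= xl + (\sum_(p <- a) p.1.1 + \sum_(p <- u) p.1.1 + \sum_(p <- t1) p.1.1 - m) / r <= xr.
  by move=> E; rewrite -!big_cat; apply: (pre ((a ++ u) ++ t1) t2); rewrite E -!catA.
have {}Ia := Ia pa; have {}Iu := Iu pu; have {}Ic := Ic pc.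
rewrite !big_cat /= in sX sY Q *.
rewrite addrA in sX; rewrite sX in Ic; rewrite !add0r in Ia Ic.
have cE : \sum_(p <- c) p.1.2 = - (\sum_(p <- a) p.1.2 + \sum_(p <- u) p.1.2) by lra.
rewrite cE in Ic; lra.
Qed.

(** With [r] the ratio of the widths and cuts at the extremal vertices, the way to the right is
    compared with the lower graph and the way back with the upper one. This gives
    [Q / 2 + r ^+ 2 * A <= r * L], and the inequality of arithmetic and geometric means removes
    [r]. *)
Lemma planar_isoperimetric (l : seq ((R * R) * R)) :
  \sum_(p <- l) p.1 = 0 ->
  (forall p, p \in l -> forall w, W w -> det2 w p.1 <= p.2) ->
  2 * A * pairsum det2 [seq p.1 | p <- l] <= (\sum_(p <- l) p.2) ^+ 2.
Proof.
move=> s0 hl; have [lt_lr dlo dhi inW subW _] := HW.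
have A0 := profile_area_ge0.
set Q := pairsum _ _; set L := \sum_(p <- l) p.2.
have [Q0|Q0] := leP Q 0.
  by apply: le_trans (sqr_ge0 L); rewrite mulr_ge0_le0// mulr_ge0.
have L0 : 0 <= L.
  have [Wxl _] := inW xl ltac:(lra).
  have -> : 0 = \sum_(p <- l) det2 (xl, lo xl) p.1.
    rewrite /det2 /= big_split /= sumrN -!mulr_sumr.
    rewrite -(big_map fst xpredT fst) -sum_fst big_map s0.
    by rewrite -(big_map fst xpredT snd) -sum_snd big_map s0 !mulr0 subr0.
  by rewrite /L !big_seq; apply: ler_sum => p pl; exact: hl.
have [s1 [s2 [ls Hs]]] := argmax_split (fun t => \sum_(p <- t) p.1.1) l.
have [t1 [t2 [lt Ht]]] := argmax_split (fun t => - \sum_(p <- t) p.1.1) l.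
pose M := \sum_(p <- s1) p.1.1; pose m := \sum_(p <- t1) p.1.1.
have preM u1 u2 : l = u1 ++ u2 -> m <= \sum_(p <- u1) p.1.1 <= M.
  by move=> E; have := Hs _ _ E; have := Ht _ _ E; rewrite /M /m; lra.
have pre r : 0 < r -> M - m <= r * (xr - xl) -> forall u1 u2, l = u1 ++ u2 ->
    xl <= xl + (\sum_(p <- u1) p.1.1 - m) / r <= xr.
  move=> r0 hr u1 u2 /preM h; apply/andP; split.
    by rewrite lerDl; apply: divr_ge0; lra.
  by rewrite -lerBrDl ler_pdivrMr//; lra.
have [Mm|Mm] := eqVneq M m.
  (* A polygon of width zero fits into the strip for every [r > 0]. Comparison with a single graph
     then gives [Q / 2 <= r * L], which is false for this [r]. *)
  exfalso; pose r := Q / (4 * (L + 1)).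
  have L1 : 0 < 4 * (L + 1) by lra.
  have r0 : 0 < r by rewrite divr_gt0.
  have := @three_piece_inequality r m Lo lo Lo lo l [::] [::] r0 dlo
    (fun z h => (inW z h).1) dlo (fun z h => (inW z h).1).
  rewrite !cats0 => /(_ s0 hl) H; have {}H := H (pre r r0 _).
  have {}H := H ltac:(by rewrite Mm subrr mulr_ge0 ?subr_ge0 ?ltW).
  have : r * (4 * (L + 1)) = Q by rewrite divfK// gt_eqF.
  by move: H; rewrite -/L -/Q; lra.
have mM : m < M.
  rewrite lt_neqAle eq_sym Mm; have := preM [::] _ erefl; rewrite big_nil; lra.
pose r := (M - m) / (xr - xl).
have r0 : 0 < r by rewrite divr_gt0// subr_gt0.
have rE : r * (xr - xl) = M - m by rewrite divfK// gt_eqF// subr_gt0.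
have {}pre := pre r r0 ltac:(by rewrite rE).
have xiM : xl + (M - m) / r = xr.
  by rewrite -rE mulrC mulKf ?gt_eqF// addrC subrK.
have xim : xl + (m - m) / r = xl by rewrite subrr mul0r addr0.
have fin : Q / 2 + r ^+ 2 * A <= r * L.
  (* The order of the two extremal vertices decides which graph the middle piece follows. *)
  have [st|ts] := leqP (size s1) (size t1).
    have E1 : t1 = s1 ++ drop (size s1) t1.
      have : take (size s1) (s1 ++ s2) = take (size s1) (t1 ++ t2) by rewrite -ls -lt.
      by rewrite take_size_cat// takel_cat// => Es; rewrite [X in X ++ _]Es cat_take_drop.
    have E : l = s1 ++ drop (size s1) t1 ++ t2 by rewrite catA -E1.
    have := @three_piece_inequality r m Lo lo Hi hi s1 (drop (size s1) t1) t2 r0 dlo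
      (fun z h => (inW z h).1) dhi (fun z h => (inW z h).2).
    rewrite -E -E1 -/M -/m xiM xim -/Q -/L => /(_ s0 hl pre).
    by rewrite /A; lra.
  have E1 : s1 = t1 ++ drop (size t1) s1.
    have : take (size t1) (t1 ++ t2) = take (size t1) (s1 ++ s2) by rewrite -ls -lt.
    by rewrite take_size_cat// takel_cat// ?(ltnW ts)// => Es; rewrite [X in X ++ _]Es cat_take_drop.
  have E : l = t1 ++ drop (size t1) s1 ++ s2 by rewrite catA -E1.
  have := @three_piece_inequality r m Hi hi Lo lo t1 (drop (size t1) s1) s2 r0 dhi
    (fun z h => (inW z h).2) dlo (fun z h => (inW z h).1).
  rewrite -E -E1 -/M -/m xiM xim -/Q -/L => /(_ s0 hl pre).
  by rewrite /A; lra.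
have pos : 0 <= Q / 2 + r ^+ 2 * A.
  by apply: addr_ge0; [apply: divr_ge0; lra|exact: mulr_ge0 (sqr_ge0 r) A0].
have : (Q / 2 + r ^+ 2 * A) ^+ 2 <= (r * L) ^+ 2 by rewrite lerXn2r ?nnegrE// (le_trans pos).
have : 0 <= (Q / 2 - r ^+ 2 * A) ^+ 2 by exact: sqr_ge0.
move=> h1 h2; have r2 : 0 < r ^+ 2 by rewrite exprn_gt0.
rewrite -(ler_pM2l r2) -exprMn; apply: le_trans h2.
have -> : r ^+ 2 * (2 * A * Q) = (Q / 2 + r ^+ 2 * A) ^+ 2 - (Q / 2 - r ^+ 2 * A) ^+ 2.
  by field.
by rewrite lerBlDr lerDl.
Qed.

End isoperimetry.
End planar_isoperimetry.

(** * The isoperimetric inequality for the symplectic 2-product *)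

Section product.
Context {R : realType} {n : nat}.
Local Notation M := 'M[R]_(n, 2).
Implicit Types (W : 'I_n -> set (R * R)).

Definition plane (i : 'I_n) (z : M) : R * R := (z i 0, z i 1).

Definition join_planes (f : 'I_n -> R * R) : M :=
  \matrix_(i < n, j < 2) (if j == 0 then (f i).1 else (f i).2).

Lemma join_planesK f i : plane i (join_planes f) = f i.
Proof. by rewrite /plane !mxE /=; case: (f i). Qed.

Lemma matrix2P (u v : M) : (forall i, plane i u = plane i v) -> u = v.
Proof.
move=> H; apply/matrixP => i j; have [h0 h1] := H i.
by case: j => -[|[|//]] jlt; [rewrite (_ : Ordinal jlt = 0)|rewrite (_ : Ordinal jlt = 1)];
  rewrite ?h0 ?h1//; apply/val_inj.
Qed.

Lemma planeD i (u v : M) : plane i (u + v) = plane i u + plane i v.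
Proof. by rewrite /plane !mxE. Qed.

Lemma planeZ i a (u : M) : plane i (a *: u) = a *: plane i u.
Proof. by rewrite /plane !mxE. Qed.

Lemma plane_sum i (s : seq M) : plane i (\sum_(x <- s) x) = \sum_(x <- s) plane i x.
Proof.
elim: s => [|x s IH]; first by rewrite !big_nil /plane !mxE.
by rewrite !big_cons planeD IH.
Qed.

Lemma omega0E (u v : M) : omega0 u v = \sum_(i < n) det2 (plane i u) (plane i v).
Proof. by []. Qed.

Lemma omega0_form : symplectic_form (@omega0 R n).
Proof.
have dp := @det2_form R; split => [x y z|a x y|x y]; rewrite !omega0E.
- by rewrite -big_split; apply: eq_bigr => i _; rewrite planeD (sformDl dp).
- by rewrite mulr_sumr; apply: eq_bigr => i _; rewrite planeZ (sformZl dp).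
- by rewrite -sumrN; apply: eq_bigr => i _; rewrite (sformC dp).
Qed.

Lemma dot_omega0 (u v : M) : omega0 u (mulI v) = dot u v.
Proof. by apply: eq_bigr => i _; rewrite !mxE /=; ring. Qed.

Lemma mulI_mulI (u : M) : mulI (mulI u) = - u.
Proof. by apply: matrix2P => i; rewrite /plane !mxE. Qed.

Lemma pairsum_planes (s : seq M) : pairsum (@omega0 R n) s =
  \sum_(i < n) pairsum det2 [seq plane i x | x <- s].
Proof.
elim: s => [|x s IH] /=; first by rewrite big1.
rewrite IH omega0E -big_split /=; apply: eq_bigr => i _.
by rewrite plane_sum big_map.
Qed.

Lemma symplectic_2productP W (z : M) : symplectic_2product W z <->
  exists r : 'I_n -> R, [/\ forall i, 0 <= r i, \sum_(i < n) r i ^+ 2 = 1 &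
    forall i, exists2 w, W i w & plane i z = r i *: w].
Proof.
split=> [[t [t01 t1 tW]]|[r [r0 r1 rW]]].
  exists (fun i => Num.sqrt (t i)); split => [i||i].
  - exact: sqrtr_ge0.
  - by rewrite -t1; apply: eq_bigr => i _; rewrite sqr_sqrtr//; case/andP: (t01 i).
  - by have [w Ww wE] := tW i; exists w.
exists (fun i => r i ^+ 2); split => [i||i].
- rewrite sqr_ge0 -r1 (bigD1 i)//= lerDl; apply: sumr_ge0 => j _; exact: sqr_ge0.
- exact: r1.
- by have [w Ww wE] := rW i; exists w => //; rewrite sqrtr_sqr ger0_norm.
Qed.

(** Let [l i] be the length of the projection to plane [i] measured by [W i]. Testing all edges
    against points of the product with the same weights [l i / N], where [N] is the Euclidean norm
    of [l], shows that the total length is at least [N]. The planar inequalities bound [2 * A] times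
    the area form by [N ^+ 2]. *)
Lemma product_isoperimetric W (A : R) :
  (forall i, convex_body (W i)) -> (forall i, W i 0) -> (forall i, area (W i) = A%:E) ->
  forall s : seq (M * R), \sum_(p <- s) p.1 = 0 ->
  (forall p, p \in s -> forall x, symplectic_2product W x -> omega0 x p.1 <= p.2) ->
  2 * A * pairsum (@omega0 R n) [seq p.1 | p <- s] <= (\sum_(p <- s) p.2) ^+ 2.
Proof.
move=> cW W0 WA s s0 hs.
have ex i (d : R * R) : exists w, W i w /\ forall v, W i v -> det2 v d <= det2 w d.
  have [cWi _ _] := cW i.
  have [||c /set_mem Wc Hc] := @compact_EVT_max _ R (fun v => det2 v d) (W i) _ cWi.
  - by exists 0; exact: W0.
  - apply: continuous_subspaceT => p; apply: cvgB; apply: cvgM; try exact: cvg_cst.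
      exact: cvg_fst.
    exact: cvg_snd.
  - by exists c; split=> // v Wv; apply: Hc; exact: mem_set.
pose w i d := projT1 (cid (ex i d)).
have wW i d : W i (w i d) by exact: (projT2 (cid (ex i d))).1.
have wH i d v : W i v -> det2 v d <= det2 (w i d) d.
  by exact: (projT2 (cid (ex i d))).2.
pose l i := \sum_(p <- s) det2 (w i (plane i p.1)) (plane i p.1).
have l0 i : 0 <= l i.
  apply: sumr_ge0 => p _; apply: le_trans (wH i _ _ (W0 i)).
  by rewrite (sform0l (@det2_form R)).
have lQ i : 2 * A * pairsum det2 [seq plane i p.1 | p <- s] <= l i ^+ 2.
  have [xl [xr [lo [hi [Lo [Hi HW]]]]]] := planar_profile_exists (cW i).
  have := profile_area HW; rewrite WA => -[->].
  have := @planar_isoperimetric _ _ _ _ _ _ _ _ HW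
    [seq (plane i p.1, det2 (w i (plane i p.1)) (plane i p.1)) | p <- s].
  rewrite -!map_comp !big_map /=; apply.
    by rewrite -(big_map fst xpredT (plane i)) -plane_sum big_map s0 /plane !mxE.
  by move=> q /mapP[p ps ->] v Wv /=; exact: wH.
have QE : 2 * A * pairsum (@omega0 R n) [seq p.1 | p <- s] <= \sum_(i < n) l i ^+ 2.
  rewrite pairsum_planes mulr_sumr; apply: ler_sum => i _.
  by rewrite -map_comp; exact: lQ.
apply: le_trans QE _; set N2 := \sum_(i < n) _.
have N20 : 0 <= N2 by apply: sumr_ge0 => i _; exact: sqr_ge0.
have [->|N0] := eqVneq N2 0; first exact: sqr_ge0.
pose N := Num.sqrt N2.
have N_gt0 : 0 < N by rewrite sqrtr_gt0 lt_neqAle eq_sym N0.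
have NE : N2 = N ^+ 2 by rewrite sqr_sqrtr.
suff NH : N <= \sum_(p <- s) p.2.
  by rewrite NE lerXn2r ?nnegrE ?(ltW N_gt0)// (le_trans (ltW N_gt0)).
have -> : N = \sum_(p <- s) omega0 (join_planes (fun i => (l i / N) *: w i (plane i p.1))) p.1.
  under eq_bigr do rewrite omega0E.
  rewrite exchange_big /=; transitivity (\sum_(i < n) (l i / N) * l i).
    transitivity (N2 / N); first by rewrite NE expr2 mulfK// gt_eqF.
    rewrite /N2 mulr_suml; apply: eq_bigr => i _; rewrite expr2; ring.
  apply: eq_bigr => i _; rewrite {2}/l mulr_sumr; apply: eq_bigr => p _.
  by rewrite join_planesK (sformZl (@det2_form R)).
rewrite !big_seq; apply: ler_sum => p ps; apply: hs => //.
apply/symplectic_2productP; exists (fun i => l i / N); split => [i||i].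
- by rewrite divr_ge0// ltW.
- under eq_bigr do rewrite expr_div_n.
  by rewrite -mulr_suml -/N2 NE divff// expf_neq0// gt_eqF.
- by exists (w i (plane i p.1)) => //; rewrite join_planesK.
Qed.

End product.

(** * Loops in the boundary of a body *)

Lemma lipschitz_continuous {R : realType} {U V : normedModType R} (f : U -> V) C : 0 < C ->
  (forall x y, `|f x - f y| <= C * `|x - y|) -> continuous f.
Proof.
move=> C0 H x; apply/cvgrPdist_lt => e e0; apply/nbhs_ballP.
exists (e / C) => /=; first by rewrite divr_gt0.
move=> y; rewrite -ball_normE /ball_ /= => xy; apply: le_lt_trans (H _ _) _.
by rewrite -ltr_pdivlMl// mulrC.
Qed.

Section matrix_norm.
Context {R : realType} {m n : nat}.

Lemma entry_norm (A : 'M[R]_(m, n)) i j : `|A i j| <= `|A|.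
Proof.
by rewrite [leRHS]/Num.Def.normr /= mx_normrE; apply: (le_bigmax _ (fun k : 'I_m * 'I_n => `|A k.1 k.2|) (i, j)).
Qed.

Lemma matrix_norm_le (A : 'M[R]_(m, n)) c : 0 <= c -> (forall i j, `|A i j| <= c) -> `|A| <= c.
Proof.
by move=> c0 H; rewrite [leLHS]/Num.Def.normr /= mx_normrE; apply: bigmax_le => // k _; exact: H.
Qed.

End matrix_norm.

Section forms_along_curves.
Context {R : realType} {n : nat}.
Local Notation M := 'M[R]_(n, 2).
Notation mu := (@lebesgue_measure R).

Lemma omega0_bound (y v : M) : `|omega0 y v| <=
  (\sum_(i < n) (`|y i 0| + `|y i 1|)) * `|v|.
Proof.
apply: le_trans (ler_norm_sum _ _ _) _; rewrite mulr_suml; apply: ler_sum => i _.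
apply: le_trans (ler_normB _ _) _; rewrite !normrM mulrDl.
by apply: lerD; apply: ler_wpM2l => //; exact: entry_norm.
Qed.

Lemma abs_continuousS (V : normedModType R) (a b c d : R) (f : R -> V) : a <= c -> d <= b ->
  abs_continuous_on a b f -> abs_continuous_on c d f.
Proof.
move=> ac db acf e /acf[k k0 H]; exists k => // m l r lr; apply: H => i.
by have [h1 h2 h3] := lr i; split=> //; [exact: le_trans h1|exact: le_trans db].
Qed.

Lemma abs_continuous_omega0 (y : M) (a b : R) (g : R -> M) :
  abs_continuous_on a b g -> abs_continuous_on a b (fun t => omega0 y (g t)).
Proof.
move=> acg e e0; pose C := \sum_(i < n) (`|y i 0| + `|y i 1|).
have C0 : 0 <= C by apply: sumr_ge0 => i _; rewrite addr_ge0.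
have C1 : 0 < C + 1 by rewrite ltr_wpDl.
have [d d0 H] := acg (e / (C + 1)) ltac:(by rewrite divr_gt0).
exists d => // m l r lr tr ld.
apply: (@le_lt_trans _ _ ((C + 1) * \sum_(i < m) `|g (r i) - g (l i)|)); last first.
  by rewrite mulrC -ltr_pdivlMr//; exact: H.
rewrite mulr_sumr; apply: ler_sum => i _.
have sw := @omega0_form R n.
rewrite -(sformNr sw) -(sformDr sw); apply: le_trans (omega0_bound _ _) _.
by rewrite ler_wpM2r// lerDl.
Qed.

Lemma is_derive_omega0 (y : M) (g : R -> M) (t : R) : derivable g t 1 ->
  is_derive t 1 (fun t => omega0 y (g t)) (omega0 y ('D_1 g t)).
Proof.
move=> dg; rewrite derive_mx//.
have dij i j : is_derive t 1 (fun t => g t i j) ('D_1 (fun t => g t i j) t).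
  by apply: derivableP; exact: (derivable_mxP _ _ _).1.
rewrite (_ : (fun t => _) = \sum_(i < n) (fun t => y i 0 * g t i 1 - y i 1 * g t i 0)); last first.
  by apply/funext => x; rewrite fct_sumE.
have Hi i : is_derive t 1 (fun t => y i 0 * g t i 1 - y i 1 * g t i 0)
    (y i 0 * 'D_1 (fun t => g t i 1) t - y i 1 * 'D_1 (fun t => g t i 0) t).
  apply: is_derive_eq; rewrite /GRing.scale /=; ring.
apply: (@is_derive_eq _ _ _ _ _ _ _ _ (@is_derive_sum _ _ _ n _ _ _ _ Hi)).
by apply: eq_bigr => i _; rewrite !mxE.
Qed.

End forms_along_curves.

Lemma ord2_cases (j : 'I_2) : j = 0 \/ j = 1.
Proof. by case: j => -[|[|//]] jlt; [left|right]; apply/val_inj. Qed.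

Section periodic.
Context {R : realType} {V : Type}.

Lemma periodic_int (f : R -> V) (T : R) (k : int) t :
  (forall t, f (t + T) = f t) -> f (t + k%:~R * T) = f t.
Proof.
move=> per; have pn (m : nat) u : f (u + m%:R * T) = f u.
  elim: m u => [|m IH] u; first by rewrite mul0r addr0.
  by rewrite -natr1 mulrDl mul1r addrA per IH.
case: k => m; first exact: pn.
by rewrite NegzE mulrNz mulNr -{2}(subrK (m.+1%:R * T) t) pn.
Qed.

Lemma periodic_repr (T t x : R) : 0 < T ->
  exists2 y, x <= y < x + T & forall f : R -> V, (forall t, f (t + T) = f t) -> f y = f t.
Proof.
move=> T0; have Tn : T != 0 by rewrite gt_eqF.
pose k := Num.floor ((t - x) / T); have /andP[k1 k2] := real_floor_itv (num_real ((t - x) / T)).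
exists (t + (- k)%:~R * T); last by move=> f per; exact: periodic_int.
move: k1 k2; rewrite ler_pdivlMr// ltr_pdivrMr// intrD mulrNz -/k; lra.
Qed.

End periodic.

(** * Regularity of a characteristic and its support inequality *)

Section characteristic.
Context {R : realType} {n : nat}.
Local Notation M := 'M[R]_(n, 2).
Notation mu := (@lebesgue_measure R).
Variables (K : set M) (T : R) (g : R -> M).
Hypothesis gK : generalized_closed_characteristic K T g.

Let T0 : 0 < T. Proof. by have [] := gK. Qed.
Let acg : abs_continuous_on 0 T g. Proof. by have [_ _ _ [] ] := gK. Qed.

Lemma periodicz (k : int) t : g (t + k%:~R * T) = g t.
Proof. by apply: periodic_int; have [] := gK. Qed.

(** Absolute continuity is given on one period only. Nearby times are shifted into it, and if they
    straddle its end the comparison passes through [g T = g 0]. *)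
Lemma characteristic_continuous : continuous g.
Proof.
have [_ per _ _ _] := gK.
have loc e : 0 < e -> exists2 d, 0 < d & forall s t, 0 <= s -> s <= t -> t <= T ->
    t - s < d -> `|g t - g s| < e.
  move=> /acg[d d0 H]; exists d => // s t s0 st tT std.
  have := H 1%N (fun=> s) (fun=> t); rewrite !big_ord1; apply => //.
  by move=> i j _ _ _; rewrite !ord1.
have glob e : 0 < e -> exists2 d, 0 < d & forall s t, s <= t -> t - s < d -> `|g t - g s| < e.
  move=> e0; have [d d0 H] := loc (e / 2) ltac:(by rewrite divr_gt0).
  exists (Num.min d T); first by rewrite lt_min d0.
  move=> s t st; rewrite lt_min => /andP[std stT].
  pose k := Num.floor (s / T).
  have := Num.Theory.floor_itv (s / T); rewrite -/k.
  rewrite ler_pdivlMr// ltr_pdivrMr// => /andP[k1 k2].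
  pose s' := s + (- k)%:~R * T; pose t' := t + (- k)%:~R * T.
  have s'0 : 0 <= s' by rewrite /s' mulrNz; lra.
  have s'T : s' < T by move: k2; rewrite intrD /s' mulrNz; lra.
  have ts' : t' - s' = t - s by rewrite /t' /s'; ring.
  rewrite -(periodicz (- k) t) -(periodicz (- k) s) -/s' -/t'.
  have [tT|Tt] := leP t' T.
    have := H s' t' s'0 ltac:(lra) tT ltac:(lra); lra.
  have h1 := H s' T s'0 ltac:(lra) (lexx _) ltac:(lra).
  have h2 := H 0 (t' - T) (lexx _) ltac:(lra) ltac:(lra) ltac:(lra).
  rewrite -(subrK T t') per -(subrKA (g T)) (splitr e).
  apply: le_lt_trans (ler_normD _ _) _; apply: ltrD => //.
  by have := per 0; rewrite add0r => ->.
move=> t; apply/cvgrPdist_lt => e e0; have [d d0 H] := glob e e0.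
near=> s; have : `|t - s| < d by near: s; apply: cvgr_dist_lt => //; exact: cvg_id.
have [ts|st] := leP t s.
  by rewrite distrC ger0_norm ?subr_ge0// distrC; exact: H.
by rewrite gtr0_norm ?subr_gt0//; apply: H; exact: ltW.
Unshelve. all: by end_near. Qed.

Let mD i j : measurable_fun setT (fun t => ('D_1 g t) i j).
Proof. exact: measurable_derive_mx characteristic_continuous. Qed.

Definition speed t := \sum_(i < n) (`|('D_1 g t) i 0| + `|('D_1 g t) i 1|).

(** Each entry satisfies |x| <= 1 + x^2, which derives integrability from square integrability. *)
Lemma speed_integrable : mu.-integrable `[0, T] (EFin \o speed).
Proof.
have [_ _ _ [_ id] _] := gK.
have i1 : mu.-integrable `[0, T] (fun t => (n%:R * 2 * (1 + dot ('D_1 g t) ('D_1 g t)))%:E).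
  apply: (@integrableZl _ _ _ mu _ _ (n%:R * 2) (fun t => (1 + dot ('D_1 g t) ('D_1 g t))%:E)) => //.
  rewrite (_ : (fun t => _) = (cst 1%:E \+ (fun t => (dot ('D_1 g t) ('D_1 g t))%:E))%E)//.
  apply: integrableD => //.
  apply: (@continuous_compact_integrable _ (fun=> 1)).
    exact: segment_compact.
  by apply: continuous_subspaceT => x; exact: cvg_cst.
apply: le_integrable i1 => //.
  apply/measurable_EFinP; apply: measurable_funTS; apply: measurable_sum => i.
  by apply: measurable_funD; apply: measurableT_comp => //; exact: mD.
move=> t _; rewrite lee_fin.
have sq i j : `|('D_1 g t) i j| <= 1 + dot ('D_1 g t) ('D_1 g t).
  have : ('D_1 g t) i j ^+ 2 <= dot ('D_1 g t) ('D_1 g t).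
    rewrite /dot (bigD1 i)//= -[leLHS]addr0 lerD//; last first.
      by apply: sumr_ge0 => k _; rewrite -!expr2 addr_ge0 ?sqr_ge0.
    rewrite -!expr2; have [->|->] := ord2_cases j; first by rewrite lerDl sqr_ge0.
    by rewrite lerDr sqr_ge0.
  rewrite -real_normK ?num_real//.
  have := sqr_ge0 (`|('D_1 g t) i j| - 1); have := sqr_ge0 `|('D_1 g t) i j|; lra.
have s0 : 0 <= speed t by apply: sumr_ge0 => i _; rewrite addr_ge0.
rewrite !ger0_norm//.
  rewrite /speed (le_trans (ler_sum _ (fun i _ => lerD (sq i 0) (sq i 1))))//.
  by rewrite sumr_const card_ord -mulr_natl; lra.
rewrite mulr_ge0 ?mulr_ge0// addr_ge0// /dot sumr_ge0// => k _.
by rewrite -!expr2 addr_ge0 ?sqr_ge0.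
Qed.

Lemma characteristic_bounded : exists2 C, 0 < C & forall t, 0 <= t <= T -> `|g t| <= C.
Proof.
have [|||c _ Hc] := @compact_EVT_max _ R (fun t => `|g t|) `[0, T].
- by exists 0; rewrite /= in_itv /= lexx ltW.
- exact: segment_compact.
- by apply: continuous_subspaceT => t; apply: cvg_norm; exact: characteristic_continuous.
exists (`|g c| + 1); first by rewrite ltr_wpDl.
move=> t t0T; apply: (@le_trans _ _ `|g c|); last by rewrite lerDl.
by apply: Hc; rewrite inE /= in_itv.
Qed.

Lemma omega0_speed (y : M) t : `|omega0 y ('D_1 g t)| <= `|y| * speed t.
Proof.
by rewrite (sformC (@omega0_form R n)) normrN mulrC; exact: omega0_bound.
Qed.

Lemma action_integrable : mu.-integrable `[0, T] (EFin \o (fun t => omega0 (g t) ('D_1 g t))).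
Proof.
have [C C0 HC] := characteristic_bounded.
have i1 : mu.-integrable `[0, T] (fun t => (C * speed t)%:E).
  by apply: (@integrableZl _ _ _ mu _ _ C (EFin \o speed)) => //; exact: speed_integrable.
have mg i j : measurable_fun setT (fun t => g t i j).
  apply: continuous_measurable_fun => t.
  by apply: (@continuous_comp _ _ _ g (fun A : M => A i j));
    [exact: characteristic_continuous|exact: coord_continuous].
apply: le_integrable i1 => //.
  apply/measurable_EFinP; apply: measurable_funTS; apply: measurable_sum => i.
  by apply: measurable_funB; apply: measurable_funM; first [exact: mg|exact: mD].
move=> t; rewrite /= in_itv /= => t0T; rewrite lee_fin (le_trans (omega0_speed _ _))//.
have s0 : 0 <= speed t by apply: sumr_ge0 => i _; rewrite addr_ge0.
rewrite ger0_norm ?mulr_ge0// ?(ltW C0)//.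
by rewrite ler_wpM2r// HC.
Qed.

Lemma characteristic_le_integral (y : M) (h : R -> R) (s t : R) :
  0 <= s -> s <= t -> t <= T -> mu.-integrable `[s, t] (EFin \o h) ->
  (forall x, s <= x <= t -> derivable g x 1 ->
     (@mulI R n @` normal_cone K (g x)) ('D_1 g x) -> omega0 y ('D_1 g x) <= h x) ->
  omega0 y (g t - g s) <= \int[mu]_(x in `[s, t]) h x.
Proof.
move=> s0 st tT ih hh; have [_ _ _ _ ae] := gK.
have sw := @omega0_form R n; rewrite (sformDr sw) (sformNr sw).
apply: (@ac_le_integral R s t (fun x => omega0 y (g x)) h _ st _ ih ae).
  by apply: abs_continuous_omega0; apply: abs_continuousS acg.
move=> x /andP[sx xt] /contrapT[dg _ ng]; exists (omega0 y ('D_1 g x)).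
  exact: is_derive_omega0.
by apply: hh => //; lra.
Qed.

(** The velocity is [mulI v] for a normal [v], and [omega0 y (mulI v) = dot y v], so that the
    current point maximises [omega0 _ (mulI v)] over [K]. Integrated along an arc, this bounds the
    support value of its chord. *)
Lemma characteristic_support (y : M) (s t : R) : K y ->
  0 <= s -> s <= t -> t <= T ->
  omega0 y (g t - g s) <= \int[mu]_(x in `[s, t]) omega0 (g x) ('D_1 g x).
Proof.
move=> Ky s0 st tT; apply: characteristic_le_integral => //.
  apply: integrableS action_integrable => //.
  by apply: subset_itv; rewrite bnd_simp.
move=> x _ _ [v nv <-]; rewrite !dot_omega0.
rewrite -subr_le0; have := nv y Ky.
congr (_ <= _); rewrite /dot -sumrB; apply: eq_bigr => i _.
by rewrite !mxE; ring.
Qed.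

Lemma characteristic_nonconstant : exists2 t, 0 < t < T & g t != g 0.
Proof.
apply/not_exists2P => H.
have gE t : 0 < t < T -> g t = g 0.
  by move=> t0T; apply/eqP; have [//|/negP] := H t; rewrite negbK.
have [_ _ _ _ ae] := gK.
have : mu.-negligible `]0, T[.
  apply: negligibleS ae => t; rewrite /= in_itv /= => t0T [dg + _].
  apply/negP; rewrite negbK; apply/eqP.
  have d0 : 0 < Num.min t (T - t) by rewrite lt_min subr_gt0; case/andP: t0T => -> ->.
  rewrite /derive; apply/cvg_lim => //; apply/cvgrPdist_lt => e e0.
  exists (Num.min t (T - t)) => //= h; rewrite /ball_ /= sub0r normrN lt_min => /andP[h1 h2] _.
  move: h1 h2; rewrite !ltr_norml => /andP[h1 h2] /andP[h3 h4].
  rewrite (gE t)// (gE (h *: 1 + t)) ?subrr ?scaler0 ?subrr ?normr0//.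
  by rewrite /GRing.scale /= mulr1; lra.
move/negligibleP => /(_ (measurable_itv _)).
rewrite [LHS]lebesgue_measure_itv /= lte_fin T0 sube0 => /eqP.
by rewrite eqe gt_eqF.
Qed.

End characteristic.

Section edges.
Context {R : realType} {V : lmodType R} (w : V -> V -> R).
Hypothesis sw : symplectic_form w.

Lemma sum_edges (f : nat -> V) a m :
  \sum_(x <- [seq f k.+1 - f k | k <- iota a m]) x = f (a + m)%N - f a.
Proof.
elim: m a => [|m IH] a; first by rewrite big_nil addn0 subrr.
by rewrite /= big_cons IH addSnnS addrC subrKA.
Qed.

Lemma pairsum_edges (f : nat -> V) a m :
  pairsum w [seq f k.+1 - f k | k <- iota a m] =
  \sum_(k <- iota a m) w (f k.+1) (f k.+1 - f k) - w (f a) (f (a + m)%N).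
Proof.
elim: m a => [|m IH] a; first by rewrite big_nil addn0 (sformxx sw) subrr.
rewrite /= IH sum_edges big_cons addSnnS.
rewrite !(sformDr sw, sformNr sw, sformDl sw, sformNl sw, sformxx sw).
by rewrite (sformC sw (f a.+1) (f a)); ring.
Qed.

End edges.

(** * Lower bounds for actions by inscribed polygons *)

Section lower_bound.
Context {R : realType} {n : nat}.
Local Notation M := 'M[R]_(n, 2).
Notation mu := (@lebesgue_measure R).
Local Notation w := (@omega0 R n).
Local Notation sw := (@omega0_form R n).

Definition twice_action (T : R) (g : R -> M) : R :=
  \int[mu]_(x in `[0, T]) omega0 (g x) ('D_1 g x).

Lemma sum_integral_pieces (h : R -> R) (t : nat -> R) m :
  (forall k, t k <= t k.+1) -> mu.-integrable `[t 0%N, t m] (EFin \o h) ->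
  \sum_(k <- iota 0 m) \int[mu]_(x in `[t k, t k.+1]) h x =
  \int[mu]_(x in `[t 0%N, t m]) h x.
Proof.
move=> tm; elim: m => [|m IH] ih; first by rewrite big_nil set_itv1 Rintegral_set1.
have t0m : t 0%N <= t m by elim: (m) => // k /le_trans; apply.
have im : mu.-integrable `[t 0%N, t m] (EFin \o h).
  by apply: integrableS ih => //; apply: subset_itv; rewrite bnd_simp.
rewrite -addn1 iotaD big_cat /= IH// big_seq1 add0n addn1.
apply/eqP; rewrite eq_sym addrC -subr_eq; apply/eqP.
rewrite Rintegral_itvB ?bnd_simp// Rintegral_itv_obnd_cbnd//.
apply: integrableS ih => //; apply: subset_itv; by rewrite bnd_simp.
Qed.

(** The support inequality is applied to the two arcs between [g 0] and [g t], with [p0 + e *: y] on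
    one and [p0 - e *: y] on the other. The contributions of [p0] cancel and [2 * e * omega0 y d]
    remains, which the choice [y = - mulI d] makes positive. *)
Lemma twice_action_gt0 (K : set M) T g : generalized_closed_characteristic K T g ->
  K° !=set0 -> 0 < twice_action T g.
Proof.
move=> gK [p0 Kp0]; have [t /andP[t0 tT] gt] := characteristic_nonconstant gK.
have [T0 per _ _ _] := gK; have gT : g T = g 0 by have := per 0; rewrite add0r.
pose d := g t - g 0; pose y := - mulI d.
have dd : 0 < omega0 y d.
  rewrite /y (sformNl sw) -(sformC sw) dot_omega0 lt_neqAle; apply/andP; split; last first.
    by apply: sumr_ge0 => i _; rewrite -!expr2 addr_ge0 ?sqr_ge0.
  rewrite eq_sym; apply: contra gt => /eqP d0.
  have di i : d i 0 ^+ 2 + d i 1 ^+ 2 = 0.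
    move: d0; rewrite /dot => /psumr_eq0P H; have := H _ i isT; rewrite -!expr2; apply => j _.
    by rewrite -!expr2 addr_ge0 ?sqr_ge0.
  rewrite -subr_eq0; apply/eqP/matrix2P => i; rewrite /plane !mxE.
  move: (di i) => /eqP; rewrite paddr_eq0 ?sqr_ge0// !sqrf_eq0 /d !mxE => /andP[/eqP -> /eqP ->].
  by [].
have [e e0 He] : exists2 e, 0 < e & K (p0 + e *: y) /\ K (p0 - e *: y).
  have /nbhs_ballP[r /= r0 Hr] := Kp0.
  pose e := r / (2 * (`|y| + 1)).
  have y1 : 0 < 2 * (`|y| + 1) by rewrite mulr_gt0// ltr_wpDl.
  have e0 : 0 < e by rewrite divr_gt0.
  have ey : `|e *: y| < r.
    rewrite normrZ gtr0_norm// /e mulrAC ltr_pdivrMr// ltr_pM2l//.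
    by have := normr_ge0 y; lra.
  exists e => //; split; apply: Hr; rewrite -ball_normE /ball_ /= ?opprD ?opprK addNKr ?normrN//.
clearbody y; case: He => K1 K2.
have h1 := characteristic_support gK K1 (lexx 0) (ltW t0) (ltW tT).
have h2 := characteristic_support gK K2 (ltW t0) (ltW tT) (lexx T).
have ig := action_integrable gK.
have : twice_action T g - \int[mu]_(x in `[0, t]) omega0 (g x) ('D_1 g x) =
    \int[mu]_(x in `[t, T]) omega0 (g x) ('D_1 g x).
  rewrite /twice_action Rintegral_itvB ?bnd_simp//; try exact: ltW.
  rewrite Rintegral_itv_obnd_cbnd//; apply: integrableS ig => //.
  by apply: subset_itv; rewrite bnd_simp ?lexx ?(ltW t0).
have E : g T - g t = - d by rewrite gT /d opprB.
rewrite E in h2; rewrite -/d in h1.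
move: h1 h2; rewrite !(sformDl sw, sformNl sw, sformZl sw, sformNr sw).
have : 0 < e * omega0 y d by rewrite mulr_gt0.
lra.
Qed.

(** Every edge receives the integral over its arc as support value. On a fine subdivision the area
    form differs from the total integral only through omega0 of [g x - g (t i.+1)] and the velocity,
    which uniform continuity bounds by [k] times the speed. *)
Lemma characteristic_polygon (K : set M) T g (h : R) :
  generalized_closed_characteristic K T g -> 0 < h ->
  exists s : seq (M * R), [/\ \sum_(p <- s) p.1 = 0,
    \sum_(p <- s) p.2 = twice_action T g,
    forall p, p \in s -> forall x, K x -> omega0 x p.1 <= p.2 &
    twice_action T g - h <= pairsum w [seq p.1 | p <- s]].
Proof.
move=> gK h0; have [T0 per _ _ _] := gK.
have gT : g T = g 0 by have := per 0; rewrite add0r.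
have isp := speed_integrable gK; have ig := action_integrable gK.
pose S := \int[mu]_(x in `[0, T]) speed g x.
have S0 : 0 <= S.
  by apply: Rintegral_ge0 => x _; apply: sumr_ge0 => i _; rewrite addr_ge0.
have S1 : 0 < S + 1 by rewrite ltr_wpDl.
pose k := h / (S + 1).
have k0 : 0 < k by rewrite divr_gt0.
have [d d0 Hd] : exists2 d, 0 < d & forall s t, 0 <= s -> s <= t -> t <= T ->
    t - s < d -> `|g t - g s| <= k.
  have [_ _ _ [/(_ k k0)[d d0 H] _] _] := gK; exists d => // s t s0 st tT std.
  have := H 1%N (fun=> s) (fun=> t); rewrite !big_ord1 => {}H; apply/ltW/H => //.
  by move=> i j _ _ _; rewrite !ord1.
have [m md] : exists m : nat, T / m.+1%:R < d.
  have [m mT] := invrS_lt (divr_gt0 d0 T0); exists m.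
  by rewrite mulrC -ltr_pdivlMr.
pose t (i : nat) := i%:R * (T / m.+1%:R).
have dt0 : 0 < T / m.+1%:R by rewrite divr_gt0.
have tS i : t i.+1 = t i + T / m.+1%:R by rewrite /t -natr1 mulrDl mul1r.
have t00 : t 0%N = 0 by rewrite /t mul0r.
have tm : t m.+1 = T by rewrite /t mulrC divfK.
have tmon i j : (i <= j)%N -> t i <= t j by move=> ij; rewrite /t ler_wpM2r ?ler_nat ?ltW.
have tr i : (i <= m.+1)%N -> 0 <= t i <= T.
  by move=> im; rewrite -{1}t00 -tm !tmon.
pose I i := \int[mu]_(x in `[t i, t i.+1]) omega0 (g x) ('D_1 g x).
pose s := [seq (g (t i.+1) - g (t i), I i) | i <- iota 0 m.+1].
have sE : [seq p.1 | p <- s] = [seq g (t i.+1) - g (t i) | i <- iota 0 m.+1].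
  by rewrite -map_comp.
have sub i : (i < m.+1)%N -> `[t i, t i.+1] `<=` `[0, T].
  move=> im; apply: subset_itv; rewrite bnd_simp.
    by case/andP : (tr i (ltnW im)).
  by case/andP : (tr i.+1 im).
exists s; split.
- transitivity (\sum_(x <- [seq p.1 | p <- s]) x); first by rewrite [RHS]big_map.
  by rewrite sE (sum_edges (fun i => g (t i))) add0n t00 tm gT subrr.
- rewrite big_map sum_integral_pieces; first by rewrite t00 tm.
  + by move=> i; apply: tmon.
  + by rewrite t00 tm.
- move=> p /mapP[i + ->] x Kx; rewrite mem_iota add0n => /andP[_ im].
  have /andP[a1 a2] := tr i (ltnW im); have /andP[b1 b2] := tr i.+1 im.
  by apply: (characteristic_support gK) => //; exact: tmon.
rewrite sE (pairsum_edges sw (fun i => g (t i))) add0n t00 tm gT (sformxx sw) subr0.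
have SE : \sum_(i <- iota 0 m.+1) \int[mu]_(x in `[t i, t i.+1]) (speed g x) = S.
  rewrite sum_integral_pieces; first by rewrite t00 tm.
    by move=> i; apply: tmon.
  by rewrite t00 tm.
have AE : \sum_(i <- iota 0 m.+1) I i = twice_action T g.
  rewrite sum_integral_pieces; first by rewrite t00 tm.
    by move=> i; apply: tmon.
  by rewrite t00 tm.
have : k * S <= h.
  have : k * (S + 1) = h by rewrite divfK// gt_eqF.
  have : 0 <= k * 1 by rewrite mulr1 ltW.
  lra.
rewrite -AE -SE mulr_sumr => kS.
suff : \sum_(i <- iota 0 m.+1) (I i - k * \int[mu]_(x in `[t i, t i.+1]) speed g x) <=
  \sum_(i <- iota 0 m.+1) w (g (t i.+1)) (g (t i.+1) - g (t i)).
  rewrite big_split sumrN /=; lra.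
rewrite !big_seq; apply: ler_sum => i; rewrite mem_iota add0n => /andP[_ im].
have /andP[a1 a2] := tr i (ltnW im); have /andP[b1 b2] := tr i.+1 im.
have igi : mu.-integrable `[t i, t i.+1] (EFin \o (fun t => omega0 (g t) ('D_1 g t))).
  by apply: integrableS ig => //; exact: sub.
have isi : mu.-integrable `[t i, t i.+1] (EFin \o speed g).
  by apply: integrableS isp => //; exact: sub.
have iksi : mu.-integrable `[t i, t i.+1] (EFin \o (fun x => k * speed g x)).
  by apply: (@integrableZl _ _ _ mu _ _ k (EFin \o speed g)) => //; exact: isi.
rewrite -lerN2 -(sformNl sw) opprB.
rewrite /I -RintegralZl//.
rewrite -RintegralB//.
apply: (characteristic_le_integral gK) => //; first exact: tmon.
  by apply: (@integrableB _ _ _ mu _ _ (EFin \o (fun x => k * speed g x))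
    (EFin \o (fun t => omega0 (g t) ('D_1 g t)))).
move=> x /andP[tx xt] dg _.
have := le_trans (ler_norm _) (omega0_speed g (g x - g (t i.+1)) x).
rewrite (sformDl sw) (sformNl sw) => h1.
suff : `|g x - g (t i.+1)| * speed g x <= k * speed g x by rewrite ?(sformNl sw); lra.
rewrite ler_wpM2r//; first by apply: sumr_ge0 => j _; rewrite addr_ge0.
rewrite distrC; apply: Hd => //; first by rewrite (le_trans a1).
by rewrite tS (le_lt_trans _ md)// lerBlDr addrC lerD2l.
Qed.

(** Inscribed polygons have length L equal to twice the action and an area form tending to L. In the
    limit C L <= L^2, and L > 0 can be cancelled. *)
Lemma characteristic_action_ge (K : set M) (C : R) T g :
  (forall s : seq (M * R), \sum_(p <- s) p.1 = 0 ->
    (forall p, p \in s -> forall x, K x -> w x p.1 <= p.2) ->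
    C * pairsum w [seq p.1 | p <- s] <= (\sum_(p <- s) p.2) ^+ 2) ->
  K° !=set0 -> generalized_closed_characteristic K T g -> C <= twice_action T g.
Proof.
move=> isoK K0 gK; have L0 := twice_action_gt0 gK K0.
rewrite -(ler_pM2r L0); apply/ler_addgt0Pr => e e0.
have C1 : 0 < `|C| + 1 by rewrite ltr_wpDl.
have h0 : 0 < e / (`|C| + 1) by rewrite divr_gt0.
have [s [s0 sL sK sQ]] := characteristic_polygon gK h0.
have := isoK s s0 sK; rewrite sL expr2 => H.
have [C0|C0] := leP C 0.
  have : C * twice_action T g <= 0 by rewrite mulr_le0_ge0// ltW.
  have : 0 <= twice_action T g * twice_action T g by rewrite mulr_ge0// ltW.
  lra.
have Ch : C * (e / (`|C| + 1)) <= e.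
  by rewrite gtr0_norm// mulrA ler_pdivrMr ?ltr_wpDl ?(ltW C0)//; lra.
have : C * (twice_action T g - e / (`|C| + 1)) <= C * pairsum w [seq p.1 | p <- s].
  by rewrite ler_pM2l.
lra.
Qed.

Lemma dotC (x y : M) : dot x y = dot y x.
Proof. by apply: eq_bigr => i _; ring. Qed.

(** For [e = mulI a] the form [omega0 _ e] is [dot a], so the half-spaces become the two sides of
    the cut in [cut_polygon_inequality]. *)
Lemma cut_characteristics_ge (K : set M) (C : R) (a : M) (b : R) T1 g1 T2 g2 :
  0 <= C -> segment_closed K ->
  (forall s : seq (M * R), \sum_(p <- s) p.1 = 0 ->
    (forall p, p \in s -> forall x, K x -> w x p.1 <= p.2) ->
    C * pairsum w [seq p.1 | p <- s] <= (\sum_(p <- s) p.2) ^+ 2) ->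
  (exists2 x, K x & dot a x < b) -> (exists2 x, K x & b < dot a x) ->
  (K `&` [set x | dot a x <= b])° !=set0 -> (K `&` [set x | b <= dot a x])° !=set0 ->
  generalized_closed_characteristic (K `&` [set x | dot a x <= b]) T1 g1 ->
  generalized_closed_characteristic (K `&` [set x | b <= dot a x]) T2 g2 ->
  C <= twice_action T1 g1 + twice_action T2 g2.
Proof.
move=> C0 cK isoK [x1 Kx1 xb1] [x2 Kx2 xb2] K10 K20 gK1 gK2.
have L1 := twice_action_gt0 gK1 K10; have L2 := twice_action_gt0 gK2 K20.
apply: superadditive_limit => // h h0 h1.
have [s [s0 sL sK sQ]] := characteristic_polygon gK1 (mulr_gt0 h0 L1).
have [t [t0 tL tK tQ]] := characteristic_polygon gK2 (mulr_gt0 h0 L2).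
exists (pairsum w [seq p.1 | p <- s]), (pairsum w [seq p.1 | p <- t]).
split; [by rewrite mulrBl mul1r|by rewrite mulrBl mul1r|].
have wa x : w x (mulI a) = dot a x by rewrite dot_omega0 dotC.
have := @cut_polygon_inequality _ _ w sw K (mulI a) b C C0 cK isoK s t.
rewrite sL tL; apply => //.
- by exists x1 => //; rewrite wa.
- by exists x2 => //; rewrite wa.
- by move=> p ps x Kx; rewrite wa => xb; apply: sK.
- by move=> p ps x Kx; rewrite wa => xb; apply: tK.
Qed.

End lower_bound.

(** * Gauges *)

Section convex_derivative.
Context {R : realType}.

Definition convex_fun (f : R -> R) := forall x y t, 0 <= t <= 1 ->
  f (t * x + (1 - t) * y) <= t * f x + (1 - t) * f y.

Lemma convex_slopes (f : R -> R) (y x z : R) : convex_fun f -> y < x -> x < z ->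
  (f x - f y) / (x - y) <= (f z - f x) / (z - x).
Proof.
move=> cf yx xz; rewrite ler_pdivrMr ?subr_gt0// mulrAC ler_pdivlMr ?subr_gt0//.
pose t := (z - x) / (z - y).
have d0 : 0 < z - y by lra.
have tE : t * (z - y) = z - x by rewrite divfK// gt_eqF.
have t01 : 0 <= t <= 1.
  by apply/andP; split; [apply: divr_ge0; lra|rewrite ler_pdivrMr// mul1r; lra].
have := cf y z t t01; rewrite (_ : t * y + (1 - t) * z = x); last by lra.
rewrite -(ler_pM2r d0) mulrDl mulrAC tE.
have -> : (1 - t) * f z * (z - y) = (z - y - t * (z - y)) * f z by ring.
by rewrite tE; lra.
Qed.

Lemma convex_subgradient (f : R -> R) : convex_fun f ->
  exists D : R -> R, forall x y, f x + D x * (y - x) <= f y.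
Proof.
move=> cf; suff H x : exists d, forall y, f x + d * (y - x) <= f y.
  by have [D HD] := choice H; exists D.
pose S := [set (f x - f y) / (x - y) | y in [set y | y < x]].
have Sub z : x < z -> ubound S ((f z - f x) / (z - x)).
  by move=> xz _ [y /= yx <-]; exact: convex_slopes.
have hS : has_sup S.
  split; first by exists ((f x - f (x - 1)) / (x - (x - 1))), (x - 1) => //=; lra.
  by exists ((f (x + 1) - f x) / (x + 1 - x)); apply: Sub; lra.
exists (sup S) => y; have [yx|xy|->] := ltgtP y x; last by rewrite subrr mulr0 addr0.
- have : (f x - f y) / (x - y) <= sup S by apply: sup_upper_bound => //; exists y.
  by rewrite ler_pdivrMr ?subr_gt0//; lra.
- have : sup S <= (f y - f x) / (y - x) by apply: ge_sup; [case: hS|exact: Sub].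
  by rewrite ler_pdivlMr ?subr_gt0//; lra.
Qed.

Lemma countable_setU {T : Type} (A B : set T) : countable A -> countable B -> countable (A `|` B).
Proof.
move=> cA cB; rewrite -bigcup2E; apply: bigcup_countable => // i _; rewrite /bigcup2.
by case: ifP => // _; case: ifP => // _; exact: countable0.
Qed.

Lemma subsingleton_countable (T : Type) (A : set T) :
  (forall x y, A x -> A y -> x = y) -> countable A.
Proof.
move=> H; have [->|/set0P[a Aa]] := eqVneq A set0; first exact: countable0.
by apply: (sub_countable _ (countable1 a)); apply: subset_card_le => x Ax /=; exact: H.
Qed.

(** Where the selection [D] of subgradients has no jump, [D x] is the derivative. A jump leaves room
    for a rational number, and each rational serves at most one point. *)
Lemma convex_derivable_countable (f : R -> R) : convex_fun f ->
  countable [set x : R | ~ derivable f x 1].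
Proof.
move=> /convex_subgradient[D HD].
have Dmon x y : x < y -> D x <= D y.
  move=> xy; have := HD x y; have := HD y x => h1 h2.
  have : 0 <= (D y - D x) * (y - x) by lra.
  by rewrite pmulr_lge0 ?subr_gt0// subr_ge0.
pose P (q : rat) := [set x : R | (forall y, y < x -> D y < ratr q) /\ (forall y, x < y -> ratr q < D y)].
apply: (@sub_countable _ _ _ (\bigcup_(q in [set: rat]) P q)); last first.
  apply: bigcup_countable => // q _; apply: subsingleton_countable => x y.
  wlog xy : x y / x < y => [H Px Py|].
    by have [xy|yx|->//] := ltgtP x y; [exact: H|apply/esym; exact: H].
  move=> [_ h1] [h2 _]; have := h1 ((x + y) / 2) ltac:(lra).
  by have := h2 ((x + y) / 2) ltac:(lra); lra.
apply: subset_card_le => x /= ndx.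
have [e e0 He] : exists2 e, 0 < e & forall y z, y < x -> x < z -> D y + e <= D z.
  apply: contrapT => /forall2NP H; apply: ndx.
  suff : is_derive x 1 f (D x) by case.
  apply/is_derive_epsP => e e0.
  have [//|/existsNP[y /existsNP[z H']]] := H e.
  have /not_implyP[yx /not_implyP[xz /negP]] := H'; rewrite -ltNge => De.
  exists (Num.min (x - y) (z - x)); first by rewrite lt_min !subr_gt0 yx.
  move=> h; rewrite lt_min => /andP[h1 h2].
  have d1 := HD x (x + h); have d2 := HD (x + h) x.
  rewrite addrAC subrr add0r in d1; rewrite opprD addrA subrr add0r mulrN in d2.
  have yD : D y <= D (x + h) <= D z.
    move: h1 h2; rewrite !ltr_norml => /andP[a1 a2] /andP[a3 a4].
    by apply/andP; split; apply: Dmon; lra.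
  have yDx : D y <= D x <= D z by rewrite !Dmon.
  have b1 : 0 <= f (x + h) - f x - D x * h by lra.
  rewrite ger0_norm//; apply: (@le_trans _ _ ((D (x + h) - D x) * h)); first lra.
  apply: le_trans (ler_norm _) _; rewrite normrM ler_wpM2r// ler_norml; lra.
pose S := [set D y | y in [set y | y < x]].
have hS : has_sup S.
  split; first by exists (D (x - 1)), (x - 1) => //=; lra.
  by exists (D x) => _ [y /= yx <-]; exact: Dmon.
have Se : sup S < sup S + e by rewrite ltrDl.
have [q] := rat_in_itvoo Se; rewrite in_itv /= => /andP[q1 q2].
exists q => //; split => [y yx|z xz].
  by apply: le_lt_trans q1; apply: sup_upper_bound => //; exists y.
apply: lt_le_trans q2 _; rewrite -lerBrDr; apply: ge_sup; first by case: hS.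
by move=> _ [y /= yx <-]; rewrite lerBrDr; exact: He.
Qed.

End convex_derivative.

Section gauge.
Context {R : realType}.
Variable W : set (R * R).
Hypotheses (cW : compact W) (sW : segment_closed W) (nW : nbhs (0 : R * R) W).

Definition gauge (v : R * R) : R := inf [set s | 0 < s /\ W (s^-1 *: v)].

Let W0 : W 0. Proof. exact: nbhs_singleton. Qed.

Lemma body_scale v t : W v -> 0 <= t <= 1 -> W (t *: v).
Proof. by move=> Wv t01; have := sW Wv W0 t01; rewrite scaler0 addr0. Qed.

Lemma body_ball : exists2 r, 0 < r & forall v, `|v| < r -> W v.
Proof.
have /nbhs_ballP[r /= r0 Hr] := nW; exists r => // v vr; apply: Hr.
by rewrite -ball_normE /ball_ /= sub0r normrN.
Qed.

Lemma body_bounded : exists2 C, 0 < C & forall v, W v -> `|v| <= C.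
Proof.
have [||c _ Hc] := @compact_EVT_max _ R (fun p : (R * R)%type => `|p|) W _ cW.
- by exists 0.
- by apply: continuous_subspaceT => p; exact: norm_continuous.
exists (`|c| + 1); first by rewrite ltr_wpDl.
by move=> p Wp; rewrite (le_trans (Hc p (mem_set Wp)))// lerDl.
Qed.

Let gauge_set v : has_inf [set s | 0 < s /\ W (s^-1 *: v)].
Proof.
split; last by exists 0 => s [/ltW].
have [r r0 Hr] := body_ball; have v1 : 0 < `|v| + 1 by rewrite ltr_wpDl.
exists ((`|v| + 1) / r); split; first exact: divr_gt0.
apply: Hr; rewrite normrZ gtr0_norm ?invr_gt0 ?divr_gt0// invf_div mulrAC.
by rewrite ltr_pdivrMr// ltr_pM2l// ltrDl.
Qed.

Lemma gauge_le v s : 0 < s -> W (s^-1 *: v) -> gauge v <= s.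
Proof. by move=> s0 Ws; apply: ge_inf => //; exact: (gauge_set v).2. Qed.

Lemma gauge_ge0 v : 0 <= gauge v.
Proof. by apply: lb_le_inf; [exact: (gauge_set v).1|move=> s [/ltW]]. Qed.

Lemma gauge_lt v s : gauge v < s -> W (s^-1 *: v).
Proof.
move=> vs; have d0 : 0 < s - gauge v by rewrite subr_gt0.
have [s' [s'0 Ws'] s's] := inf_adherent d0 (gauge_set v).
have {}s's : s' < s by move: s's; rewrite -/(gauge v) addrC subrK.
have s0 : 0 < s by exact: lt_trans s's.
have -> : s^-1 *: v = (s' / s) *: (s'^-1 *: v).
  by rewrite scalerA mulrAC divff ?mul1r// gt_eqF.
apply: body_scale => //; rewrite divr_ge0 ?(ltW s0) ?(ltW s'0)//=.
by rewrite ler_pdivrMr// mul1r ltW.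
Qed.

Lemma gauge_le1 v : W v <-> gauge v <= 1.
Proof.
split=> [Wv|v1]; first by apply: gauge_le => //; rewrite invr1 scale1r.
apply: contrapT => nWv.
have cl : closed W by apply: compact_closed => //; exact: norm_hausdorff.
have /nbhs_ballP[e /= e0 He] := open_nbhs_nbhs (conj (closed_openC cl) nWv).
pose k := e / (`|v| + 1); have v0 : 0 < `|v| + 1 by rewrite ltr_wpDl.
have k0 : 0 < k by rewrite divr_gt0.
apply: (He ((1 + k)^-1 *: v)); last by apply: gauge_lt; lra.
rewrite -ball_normE /ball_ /= -{1}(scale1r v) -scalerBl normrZ.
have -> : 1 - (1 + k)^-1 = k / (1 + k) by field; lra.
rewrite gtr0_norm ?divr_gt0//; last lra.
apply: (@le_lt_trans _ _ (k * `|v|)).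
  by rewrite ler_wpM2r// ler_pdivrMr; [rewrite ler_peMr; lra|lra].
by rewrite /k mulrAC ltr_pdivrMr// ltr_pM2l// ltrDl.
Qed.

Lemma gauge_scale a v : 0 < a -> gauge (a *: v) = a * gauge v.
Proof.
have le b u : 0 < b -> gauge (b *: u) <= b * gauge u.
  move=> b0; apply/ler_addgt0Pr => e e0.
  have e0' : 0 < e / b by rewrite divr_gt0.
  have -> : b * gauge u + e = b * (gauge u + e / b) by field; lra.
  have g0 : 0 < gauge u + e / b by rewrite ltr_wpDl// gauge_ge0.
  apply: gauge_le; first exact: mulr_gt0.
  rewrite scalerA invfM mulrAC mulVf ?mul1r ?gt_eqF//.
  by apply: gauge_lt; rewrite ltrDl.
move=> a0; apply/le_anti; rewrite le//= -ler_pdivlMl//.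
have := le a^-1 (a *: v); rewrite invr_gt0 => /(_ a0).
by rewrite scalerA mulVf ?scale1r// gt_eqF.
Qed.

Lemma gauge0 : gauge 0 = 0.
Proof.
apply/le_anti; rewrite gauge_ge0 andbT; apply/ler_addgt0Pr => e e0.
by rewrite add0r; apply: gauge_le => //; rewrite scaler0.
Qed.

Lemma gaugeD u v : gauge (u + v) <= gauge u + gauge v.
Proof.
apply/ler_addgt0Pr => e e0.
have e2 : 0 < e / 2 by rewrite divr_gt0.
pose s := gauge u + e / 2; pose t := gauge v + e / 2.
have s0 : 0 < s by rewrite ltr_wpDl// gauge_ge0.
have t0 : 0 < t by rewrite ltr_wpDl// gauge_ge0.
have st : 0 < s + t by rewrite addr_gt0.
have -> : gauge u + gauge v + e = s + t by rewrite /s /t; lra.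
apply: gauge_le => //.
have l01 : 0 <= s / (s + t) <= 1.
  by rewrite divr_ge0 ?(ltW s0) ?(ltW st)//= ler_pdivrMr// mul1r lerDl ltW.
have Wu : W (s^-1 *: u) by apply: gauge_lt; rewrite ltrDl.
have Wv : W (t^-1 *: v) by apply: gauge_lt; rewrite ltrDl.
have := sW Wu Wv l01; rewrite !scalerA.
have -> : s / (s + t) / s = (s + t)^-1 by field; apply/andP; split; lra.
have -> : (1 - s / (s + t)) / t = (s + t)^-1 by field; apply/andP; split; lra.
by rewrite -scalerDr.
Qed.

Lemma gauge_bounds : exists c C : R, [/\ 0 < c, 0 < C &
  forall v, c * `|v| <= gauge v <= C * `|v|].
Proof.
have [r r0 Hr] := body_ball; have [C C0 HC] := body_bounded.
exists C^-1, (2 / r); split; rewrite ?invr_gt0 ?divr_gt0// => v.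
have [->|v0] := eqVneq v 0; first by rewrite gauge0 normr0 !mulr0 lexx.
have nv : 0 < `|v| by rewrite normr_gt0.
apply/andP; split.
  apply: lb_le_inf; first exact: (gauge_set v).1.
  move=> s [s0 /HC]; rewrite normrZ gtr0_norm ?invr_gt0//.
  by rewrite ler_pdivrMl// => h; rewrite ler_pdivrMl// mulrC.
have rv : 0 < 2 / r * `|v| by rewrite mulr_gt0// divr_gt0.
apply: gauge_le => //; apply: Hr; rewrite normrZ gtr0_norm ?invr_gt0//.
have -> : (2 / r * `|v|)^-1 * `|v| = r / 2 by field; apply/andP; split; lra.
lra.
Qed.

Lemma gauge_lipschitz : exists2 C, 0 < C & forall u v, `|gauge u - gauge v| <= C * `|u - v|.
Proof.
have [c [C [_ C0 H]]] := gauge_bounds; exists C => // u v.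
have h1 := gaugeD (u - v) v; have h2 := gaugeD (v - u) u; rewrite !subrK in h1 h2.
have /andP[_ h3] := H (u - v); have /andP[_ h4] := H (v - u).
rewrite (distrC v) in h4; rewrite ler_norml; lra.
Qed.

Lemma gauge_convex p d : convex_fun (fun s => gauge (p + s *: d)).
Proof.
move=> x y t /andP[t0 t1].
have sc a v : 0 <= a -> gauge (a *: v) = a * gauge v.
  by rewrite le_eqVlt => /predU1P[<-|/gauge_scale//]; rewrite scale0r gauge0 mul0r.
rewrite -sc// -[X in _ <= _ + X]sc ?subr_ge0//.
have -> : p + (t * x + (1 - t) * y) *: d = t *: (p + x *: d) + (1 - t) *: (p + y *: d).
  by rewrite !scalerDr addrACA -scalerDl (addrC t) subrK scale1r !scalerA -scalerDl.
exact: gaugeD.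
Qed.

End gauge.

Section real_lemmas.
Context {R : realType}.

Lemma derive_lipschitz (f df : R -> R) (C : R) :
  (forall x : R, is_derive x 1 f (df x)) -> (forall x, `|df x| <= C) ->
  forall x y, `|f x - f y| <= C * `|x - y|.
Proof.
move=> fd dC x y; wlog xy : x y / y <= x => [H|].
  by case: (leP y x) => [|/ltW] xy; [|rewrite distrC (distrC x)]; exact: H.
have [|c _ ->] := @MVT_segment R f df y x xy (fun x _ => fd x).
  apply: continuous_subspaceT => z.
  by apply: differentiable_continuous; apply/derivable1_diffP; have [] := fd z.
by rewrite normrM ler_wpM2r.
Qed.

Lemma derive_expanding (f df : R -> R) (c : R) :
  (forall x : R, is_derive x 1 f (df x)) -> (forall x, c <= df x) ->
  forall x y, x <= y -> c * (y - x) <= f y - f x.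
Proof.
move=> fd dC x y xy.
have [|d _ ->] := @MVT_segment R f df x y xy (fun x _ => fd x).
  apply: continuous_subspaceT => z.
  by apply: differentiable_continuous; apply/derivable1_diffP; have [] := fd z.
by rewrite ler_wpM2r ?subr_ge0.
Qed.

Lemma right_derive_ge0 (f : R -> R) (x l d : R) : is_derive x 1 f l -> 0 < d ->
  (forall h, 0 < h -> h < d -> f x <= f (x + h)) -> 0 <= l.
Proof.
move=> /is_derive_epsP H d0 Hd; apply/ler_addgt0Pr => e e0.
have [d1 d10 H1] := H e e0; pose h := Num.min d d1 / 2.
have m0 : 0 < Num.min d d1 by rewrite lt_min d0.
have h0 : 0 < h by rewrite divr_gt0.
have hm : h < Num.min d d1 by rewrite /h; lra.
move: hm; rewrite lt_min => /andP[hd hd1].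
have := H1 h; rewrite gtr0_norm// => /(_ hd1); rewrite ler_norml => /andP[_ h2].
have h3 := Hd h h0 hd.
rewrite -(ler_pM2r h0) mul0r mulrDl; lra.
Qed.

Lemma left_derive_ge0 (f : R -> R) (x l d : R) : is_derive x 1 f l -> 0 < d ->
  (forall h, 0 < h -> h < d -> f (x - h) <= f x) -> 0 <= l.
Proof.
move=> /is_derive_epsP H d0 Hd; apply/ler_addgt0Pr => e e0.
have [d1 d10 H1] := H e e0; pose h := Num.min d d1 / 2.
have m0 : 0 < Num.min d d1 by rewrite lt_min d0.
have h0 : 0 < h by rewrite divr_gt0.
have hm : h < Num.min d d1 by rewrite /h; lra.
move: hm; rewrite lt_min => /andP[hd hd1].
have := H1 (- h); rewrite normrN gtr0_norm// => /(_ hd1); rewrite ler_norml => /andP[h2 _].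
have h3 := Hd h h0 hd.
rewrite -(ler_pM2r h0) mul0r mulrDl; lra.
Qed.

Lemma cos_lipschitz (x y : R) : `|cos x - cos y| <= `|x - y|.
Proof.
rewrite -[leRHS]mul1r; apply: (@derive_lipschitz _ (fun x => - sin x)).
by move=> z; rewrite normrN; exact: sin_max.
Qed.

Lemma sin_lipschitz (x y : R) : `|sin x - sin y| <= `|x - y|.
Proof.
rewrite -[leRHS]mul1r; apply: (@derive_lipschitz _ (@cos R)).
by move=> z; exact: cos_max.
Qed.

Lemma pair_norm_le (x y c : R) : (`|(x, y)| <= c) = (`|x| <= c) && (`|y| <= c).
Proof. by rewrite [in LHS]/Num.Def.normr /= ge_max. Qed.

Lemma circle_norm (t : R) : 1 / 2 <= `|(cos t, sin t)| <= 1.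
Proof.
apply/andP; split; last by rewrite pair_norm_le cos_max sin_max.
rewrite leNgt; apply/negP => h; have := ltW h; rewrite pair_norm_le => /andP[h1 h2].
have a1 : `|cos t| ^+ 2 <= (1 / 2) ^+ 2 by rewrite lerXn2r ?nnegrE//; lra.
have a2 : `|sin t| ^+ 2 <= (1 / 2) ^+ 2 by rewrite lerXn2r ?nnegrE//; lra.
move: a1 a2; rewrite !real_normK ?num_real//; have := cos2Dsin2 t; lra.
Qed.

(** Between consecutive zeros of cos, tan is inverted by a translate of atan. This transfers a
    countable set of exceptional slopes to the angles. *)
Lemma countable_tan_preimage (B : set R) : countable B ->
  countable [set t : R | cos t = 0 \/ B (tan t)].
Proof.
move=> cB.
pose F (k : int) := [set k%:~R * pi + a | a in [set - (pi / 2)] `|` (@atan R) @` B].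
apply: (@sub_countable _ _ _ (\bigcup_(k in [set: int]) F k)); last first.
  apply: bigcup_countable => // k _; apply: sub_countable (card_image_le _ _) _.
  by apply: countable_setU; [exact: countable1|exact: sub_countable (card_image_le _ _) cB].
apply: subset_card_le => t /= Ht.
have p0 := @pi_gt0 R.
pose k := Num.floor ((t + pi / 2) / pi).
have := Num.Theory.floor_itv ((t + pi / 2) / pi); rewrite -/k intrD.
rewrite ler_pdivlMr// ltr_pdivrMr// => /andP[k1 k2].
pose a := t - k%:~R * pi.
have ta : t = k%:~R * pi + a by rewrite /a addrC subrK.
exists k => //; exists a => //.
have [aE|aN] := eqVneq a (- (pi / 2)); first by left.
have a1 : - (pi / 2) < a < pi / 2.
  by apply/andP; split; [rewrite lt_neqAle eq_sym aN /a/=; lra|rewrite /a; lra].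
right; exists (tan a); last by rewrite tanK// in_itv.
case: Ht => [ct|]; last by rewrite ta addrC periodic_int//; exact: tanDpi.
exfalso; have ca := cos_gt0_pihalf a1.
have := @periodic_int _ _ (fun x : R => `|cos x|) pi k a.
rewrite addrC -ta ct normr0 => /(_ _)/esym/eqP; rewrite normr_eq0 gt_eqF// => H.
by have := H (fun x => etrans (congr1 _ (cosDpi x)) (normrN _)).
Qed.

End real_lemmas.

(** * Parametrising the boundary of a planar body by area *)

Section radial.
Context {R : realType}.
Variable W : set (R * R).
Hypotheses (cW : compact W) (sW : segment_closed W) (nW : nbhs (0 : R * R) W).

(** The reciprocal of the polar radius of the boundary at angle [t]. *)
Definition radial (t : R) : R := gauge W (cos t, sin t).

Lemma radial_bounds : exists c C : R, [/\ 0 < c, 0 < C & forall t, c <= radial t <= C].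
Proof.
have [c [C [c0 C0 H]]] := gauge_bounds cW nW.
exists (c * (1 / 2)), C; split => //; first by rewrite mulr_gt0// divr_gt0.
move=> t; have /andP[h1 h2] := H (cos t, sin t); have /andP[n1 n2] := circle_norm t.
apply/andP; split; first by apply: le_trans h1; rewrite ler_wpM2l// ltW.
by apply: le_trans h2 _; rewrite -[leRHS]mulr1 ler_wpM2l// ltW.
Qed.

Lemma radial_gt0 t : 0 < radial t.
Proof. by have [c [C [c0 _ /(_ t)/andP[h _]]]] := radial_bounds; exact: lt_le_trans h. Qed.

Lemma radial_lipschitz : exists2 C, 0 < C & forall x y, `|radial x - radial y| <= C * `|x - y|.
Proof.
have [C C0 H] := gauge_lipschitz cW sW nW; exists C => // x y.
apply: le_trans (H _ _) _; rewrite ler_pM2l//.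
by rewrite [X in `|X|](_ : _ = (cos x - cos y, sin x - sin y))// pair_norm_le cos_lipschitz sin_lipschitz.
Qed.

Lemma radial_continuous : continuous radial.
Proof. by have [C C0 H] := radial_lipschitz; exact: lipschitz_continuous H. Qed.

Lemma radialD2pi t : radial (t + pi *+ 2) = radial t.
Proof. by rewrite /radial cosD2pi sinD2pi. Qed.

(** On the vertical lines through (1, 0) and (-1, 0) the gauge is a convex function of one variable,
    and homogeneity writes [radial] as [|cos t|] times one of these functions at [tan t]. *)
Lemma radial_derivable_countable : countable [set t : R | ~ derivable radial t 1].
Proof.
pose f1 s := gauge W ((1, 0) + s *: (0, 1)).
pose f2 s := gauge W ((-1, 0) + s *: (0, -1)).
have c1 : countable [set x : R | ~ derivable f1 x 1].
  by apply: convex_derivable_countable; exact: gauge_convex.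
have c2 : countable [set x : R | ~ derivable f2 x 1].
  by apply: convex_derivable_countable; exact: gauge_convex.
have cB : countable ([set x : R | ~ derivable f1 x 1] `|` [set x : R | ~ derivable f2 x 1]).
  exact: countable_setU.
apply: sub_countable (countable_tan_preimage cB); apply: subset_card_le => t /= nd.
apply: contrapT => /not_orP[/eqP ct0 /not_orP[/contrapT d1 /contrapT d2]]; apply: nd.
have tE s : cos s != 0 -> cos s * tan s = sin s by move=> s0; rewrite /tan mulrC divfK.
have near s : `|s - t| < `|cos t| -> cos t - `|cos t| < cos s < cos t + `|cos t|.
  move=> st; have := le_lt_trans (cos_lipschitz s t) st.
  by rewrite ltr_norml => /andP[]; lra.
have dtan : is_derive t 1 tan ((cos t)^-2) by exact: is_derive_tan.
have [ct|ct] : cos t < 0 \/ 0 < cos t by case: ltgtP ct0; [left|right|].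
- suff : is_derive t 1 radial (- (f2 (tan t) * - sin t + cos t * ('D_1 f2 (tan t) * (cos t)^-2))) by case.
  have df : is_derive (tan t) 1 f2 ('D_1 f2 (tan t)) := derivableP d2.
  have dc : is_derive t 1 (fun s => f2 (tan s)) ('D_1 f2 (tan t) * (cos t)^-2).
    exact: (is_derive1_comp df dtan).
  apply: (@is_derive_near_eq _ (fun s => - (cos s * f2 (tan s))) _ _ _ `|cos t|).
  + by rewrite normr_gt0.
  + move=> s /near; rewrite ltr0_norm// => /andP[_ s0]; rewrite subrr in s0.
    rewrite -mulNr /f2 -gauge_scale ?oppr_gt0// scalerDr scalerA /radial; congr (gauge W _).
    by congr pair; rewrite /= /GRing.scale /=; [ring|rewrite -tE ?lt_eqF//; ring].
  + by apply: is_derive_eq; rewrite /GRing.scale /=; ring.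
- suff : is_derive t 1 radial (f1 (tan t) * - sin t + cos t * ('D_1 f1 (tan t) * (cos t)^-2)) by case.
  have df : is_derive (tan t) 1 f1 ('D_1 f1 (tan t)) := derivableP d1.
  have dc : is_derive t 1 (fun s => f1 (tan s)) ('D_1 f1 (tan t) * (cos t)^-2).
    exact: (is_derive1_comp df dtan).
  apply: (@is_derive_near_eq _ (fun s => cos s * f1 (tan s)) _ _ _ `|cos t|).
  + by rewrite normr_gt0.
  + move=> s /near; rewrite gtr0_norm// => /andP[s0 _]; rewrite subrr in s0.
    rewrite /f1 -gauge_scale// scalerDr scalerA /radial; congr (gauge W _).
    by congr pair; rewrite /= /GRing.scale /=; [ring|rewrite -tE ?gt_eqF//; ring].
  + by apply: is_derive_eq; rewrite /GRing.scale /=; ring.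
Qed.

End radial.

Section flow.
Context {R : realType}.

(* A parametrisation [t |-> (ex t, ey t)] of the boundary of [W] by the
   area swept out from the origin. *)
Record boundary_flow (W : set (R * R)) (P : R) (ex ey th rho : R -> R) : Prop := {
  flow_period_gt0 : 0 < P ;
  flow_rho : forall t, 0 < rho t ;
  flow_x : forall t, ex t = rho t * cos (th t) ;
  flow_y : forall t, ey t = rho t * sin (th t) ;
  flow_th : forall s t, s < t -> th s < th t ;
  flow_thD : forall t, th (t + P) = th t + pi *+ 2 ;
  flow_th_surj : forall a, exists t, th t = a ;
  flow_rhoD : forall t, rho (t + P) = rho t ;
  flow_gauge : forall t, gauge W (ex t, ey t) = 1 ;
  flow_lip : exists2 C, 0 < C & forall s t,
    `|ex s - ex t| <= C * `|s - t| /\ `|ey s - ey t| <= C * `|s - t| ;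
  flow_derive : exists2 D : set R, countable D & forall t, ~ D t ->
    exists v : R * R, [/\ is_derive t 1 ex v.1, is_derive t 1 ey v.2 &
      det2 (ex t, ey t) v = 2] }.

(** [S] is the area swept out up to a polar angle and [th] its inverse. The bounds on [radial] make
    [S] expanding, hence [th] Lipschitz, and the curve is differentiable at each time whose angle is
    a point of differentiability of [radial]. *)
Lemma boundary_flow_exists (W : set (R * R)) : compact W -> segment_closed W ->
  nbhs (0 : R * R) W -> exists P ex ey th rho, boundary_flow W P ex ey th rho.
Proof.
move=> cW sW nW; pose q := radial W.
have q0 t : 0 < q t by exact: radial_gt0.
have qn t : q t != 0 by rewrite gt_eqF.
have [c [C [c0 C0 qb]]] := radial_bounds cW nW.
(* Area per unit of angle is half the square of the radius [(q t)^-1]. *)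
pose k t := (2 * q t ^+ 2)^-1.
have ck : continuous k.
  move=> t; apply: cvgV; first by rewrite mulf_neq0// expf_neq0.
  apply: cvgM; first exact: cvg_cst.
  by rewrite expr2; apply: cvgM; exact: radial_continuous.
have [S dS] := continuous_primitive ck.
pose k0 := (2 * C ^+ 2)^-1.
have k00 : 0 < k0 by rewrite invr_gt0 mulr_gt0// exprn_gt0.
have kk0 t : k0 <= k t.
  rewrite lef_pV2 ?posrE ?mulr_gt0 ?exprn_gt0// ler_pM2l// lerXn2r ?nnegrE ?(ltW (q0 t)) ?(ltW C0)//.
  by case/andP: (qb t).
have Sexp := derive_expanding dS kk0.
have Smon x y : x < y -> S x < S y.
  by move=> xy; rewrite -subr_gt0; apply: lt_le_trans (Sexp x y (ltW xy)); rewrite mulr_gt0// subr_gt0.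
have cS : continuous S.
  by move=> x; apply: differentiable_continuous; apply/derivable1_diffP; have [] := dS x.
have Ssurj v : exists x, S x = v.
  pose b := `|v - S 0| / k0; have b0 : 0 <= b by rewrite divr_ge0// ltW.
  have bk : k0 * b = `|v - S 0| by rewrite mulrC divfK// gt_eqF.
  have h1 := Sexp 0 b b0; have h2 := Sexp (- b) 0 ltac:(by rewrite oppr_le0).
  have [|x _ xv] := @IVT R S (- b) b v ltac:(by rewrite ge0_cp) (continuous_subspaceT cS).
    have := ler_norm (v - S 0); have := ler_norm (- (v - S 0)); rewrite normrN => n1 n2.
    by apply/andP; split; [rewrite ge_min; apply/orP; left|rewrite le_max; apply/orP; right]; lra.
  by exists x.
have [th Sth] := choice Ssurj.
have Sinj x y : S x = S y -> x = y.
  by move=> Sxy; case: (ltgtP x y) => // /Smon; rewrite Sxy ltxx.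
have thS x : th (S x) = x by apply: Sinj; rewrite Sth.
pose P := S (pi *+ 2) - S 0.
have SD x : S (x + pi *+ 2) = S x + P.
  have dd (y : R) : is_derive y 1 (fun y => S (y + pi *+ 2) - S y) 0.
    have d1 : is_derive y 1 (fun y => S (y + pi *+ 2)) (k (y + pi *+ 2) * 1).
      apply: (@is_derive1_comp _ S (fun y => y + pi *+ 2)).
      by apply: is_derive_eq; rewrite addr0.
    by apply: is_derive_eq; rewrite mulr1 /k /q radialD2pi subrr.
  have := @is_derive_0_is_cst _ _ x 0 dd; rewrite add0r /P; lra.
have p0 := @pi_gt0 R.
have P0 : 0 < P by rewrite subr_gt0; apply: Smon; lra.
have dth (t : R) : is_derive t 1 th (k (th t))^-1.
  rewrite -{1}(Sth t); apply: is_derive_inverse.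
  - by exists 1 => //= y _; exact: thS.
  - by exists 1 => //= y _; exact: cS.
  - by rewrite gt_eqF// (lt_le_trans k00).
have thmon s t : s < t -> th s < th t.
  move=> st; rewrite ltNge le_eqVlt; apply/negP => /predU1P[h|/Smon].
    by move: st; rewrite -(Sth s) -(Sth t) h ltxx.
  by rewrite !Sth => /lt_trans /(_ st); rewrite ltxx.
pose rho t := (q (th t))^-1.
pose ex t := rho t * cos (th t); pose ey t := rho t * sin (th t).
have gE t : gauge W (ex t, ey t) = 1.
  rewrite (_ : (ex t, ey t) = rho t *: (cos (th t), sin (th t)))//.
  by rewrite gauge_scale ?invr_gt0// mulVf.
exists P, ex, ey, th, rho; split => //.
- by move=> t; rewrite invr_gt0.
- by move=> t; apply: Sinj; rewrite SD !Sth.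
- by move=> a; exists (S a).
- move=> t; rewrite /rho; congr (_^-1).
  by rewrite (_ : th (t + P) = th t + pi *+ 2) ?/q ?radialD2pi//; apply: Sinj; rewrite SD !Sth.
- have [L L0 HL] := radial_lipschitz cW sW nW.
  have thlip s t : `|th s - th t| <= k0^-1 * `|s - t|.
    wlog st : s t / t <= s => [H|].
      by case: (leP t s) => [|/ltW] st; [|rewrite distrC (distrC s)]; exact: H.
    have tht : th t <= th s by move: st; rewrite le_eqVlt => /predU1P[->|/thmon/ltW].
    have := Sexp _ _ tht; rewrite !Sth mulrC -ler_pdivlMr// => h.
    by rewrite !ger0_norm ?subr_ge0// mulrC.
  have rholip s t : `|rho s - rho t| <= c^-1 ^+ 2 * L * k0^-1 * `|s - t|.
    have -> : rho s - rho t = rho s * rho t * (q (th t) - q (th s)).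
      by rewrite /rho; field; rewrite !qn.
    have rc u : `|rho u| <= c^-1.
      by rewrite gtr0_norm ?invr_gt0// lef_pV2 ?posrE//; case/andP: (qb (th u)).
    rewrite !normrM expr2 -!mulrA; apply: ler_pM => //.
    apply: ler_pM => //; apply: le_trans (HL _ _) _; rewrite ler_pM2l// distrC.
    exact: thlip.
  have rc u : `|rho u| <= c^-1.
    by rewrite gtr0_norm ?invr_gt0// lef_pV2 ?posrE//; case/andP: (qb (th u)).
  have prod (f : R -> R) s t : (forall x, `|f x| <= 1) -> (forall x y, `|f x - f y| <= `|x - y|) ->
      `|rho s * f (th s) - rho t * f (th t)| <= (c^-1 ^+ 2 * L * k0^-1 + c^-1 * k0^-1) * `|s - t|.
    move=> f1 flip; have -> : rho s * f (th s) - rho t * f (th t) =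
      (rho s - rho t) * f (th s) + rho t * (f (th s) - f (th t)) by ring.
    apply: le_trans (ler_normD _ _) _; rewrite [leRHS]mulrDl !normrM; apply: lerD.
      by rewrite -[leRHS]mulr1; apply: ler_pM.
    by rewrite -mulrA; apply: ler_pM => //; apply: le_trans (flip _ _) (thlip _ _).
  exists (c^-1 ^+ 2 * L * k0^-1 + c^-1 * k0^-1).
    by rewrite addr_gt0 // ?mulr_gt0 // ?exprn_gt0 // ?invr_gt0 // mulr_gt0 // exprn_gt0.
  move=> s t; split; first by apply: prod => [x|x y]; [exact: cos_max|exact: cos_lipschitz].
  by apply: prod => [x|x y]; [exact: sin_max|exact: sin_lipschitz].
exists (S @` [set t : R | ~ derivable q t 1]).
  apply: sub_countable; first exact: card_image_le.
  exact: radial_derivable_countable.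
move=> t nD.
have dq : is_derive (th t) 1 q ('D_1 q (th t)).
  apply: derivableP; apply: contrapT => nd; apply: nD.
  by exists (th t).
set dq0 := 'D_1 q (th t) in dq.
have dqt : is_derive t 1 (fun s => q (th s)) (dq0 * (k (th t))^-1).
  exact: (is_derive1_comp dq (dth t)).
have kE : (k (th t))^-1 = 2 * q (th t) ^+ 2 by rewrite /k invrK.
have drho : is_derive t 1 rho (- 2 * dq0).
  have := @is_deriveV _ (fun s => q (th s)) t _ 1 (qn _) dqt.
  rewrite /GRing.scale /= kE => H; apply: is_derive_eq H _.
  by field; exact: qn.
have dc : is_derive t 1 (fun s => cos (th s)) (- sin (th t) * (2 * q (th t) ^+ 2)).
  by rewrite -kE; exact: (is_derive1_comp (is_derive_cos (th t)) (dth t)).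
have ds : is_derive t 1 (fun s => sin (th s)) (cos (th t) * (2 * q (th t) ^+ 2)).
  by rewrite -kE; exact: (is_derive1_comp (is_derive_sin (th t)) (dth t)).
pose v : R * R := (rho t * (- sin (th t) * (2 * q (th t) ^+ 2)) + cos (th t) * (- 2 * dq0),
  rho t * (cos (th t) * (2 * q (th t) ^+ 2)) + sin (th t) * (- 2 * dq0)).
have dx : is_derive t 1 ex v.1 by apply: is_derive_eq.
have dy : is_derive t 1 ey v.2 by apply: is_derive_eq.
have v2 : det2 (ex t, ey t) v = 2.
  rewrite /det2 /v /ex /ey /=.
  have -> : rho t * cos (th t) * (rho t * (cos (th t) * (2 * q (th t) ^+ 2)) + sin (th t) * (- 2 * dq0)) -
     rho t * sin (th t) * (rho t * (- sin (th t) * (2 * q (th t) ^+ 2)) + cos (th t) * (- 2 * dq0)) =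
     2 * (rho t * q (th t)) ^+ 2 * (cos (th t) ^+ 2 + sin (th t) ^+ 2) by ring.
  by rewrite cos2Dsin2 mulVf// expr1n !mulr1.
by exists v.
Qed.

End flow.

(** * Supporting lines along the boundary flow *)

Section flow_theory.
Context {R : realType}.
Variables (W : set (R * R)) (P : R) (ex ey th rho : R -> R).
Hypotheses (cW : compact W) (sW : segment_closed W) (nW : nbhs (0 : R * R) W).
Hypothesis bf : boundary_flow W P ex ey th rho.
Let bd t : R * R := (ex t, ey t).

Lemma gauge_conic a b u v : 0 <= a -> 0 <= b ->
  gauge W (a *: u + b *: v) <= a * gauge W u + b * gauge W v.
Proof.
move=> a0 b0; have sc c w : 0 <= c -> gauge W (c *: w) <= c * gauge W w.
  rewrite le_eqVlt => /predU1P[<-|c0]; last by rewrite gauge_scale.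
  by rewrite scale0r mul0r gauge0.
by apply: le_trans (gaugeD sW nW _ _) _; rewrite lerD// sc.
Qed.

Lemma flow_det s t : det2 (bd s) (bd t) = rho s * rho t * sin (th t - th s).
Proof. by rewrite /det2 /bd /= !(flow_x bf) !(flow_y bf) sinB; ring. Qed.

Lemma flow_sin_gt0 s t : s < t -> th t < th s + pi -> 0 < sin (th t - th s).
Proof.
by move=> /(flow_th bf) st h; apply: sin_gt0_pi; rewrite subr_gt0 st ltrBlDl.
Qed.

Lemma flow_th_lt s t : (th s < th t) = (s < t).
Proof.
apply/idP/idP => [|/(flow_th bf)//]; rewrite ltNge le_eqVlt => h; rewrite ltNge.
apply: contra h => ts; apply/orP; move: ts; rewrite le_eqVlt => /predU1P[->|/(flow_th bf) ->].
  by left.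
by right.
Qed.

Lemma flow_dist_near (t a : R) (p : R * R) : 0 < a ->
  exists2 d, 0 < d & forall s, `|s - t| < d -> `|det2 (bd s) p - det2 (bd t) p| < a.
Proof.
move=> a0; have [C C0 HC] := flow_lip bf.
pose L := C * (`|p.1| + `|p.2| + 1); have L0 : 0 < L by rewrite mulr_gt0.
exists (a / L); first by rewrite divr_gt0.
move=> s; rewrite ltr_pdivlMr// mulrC => h; apply: le_lt_trans h.
have [h1 h2] := HC s t.
rewrite /det2 /bd /=.
have -> : ex s * p.2 - ey s * p.1 - (ex t * p.2 - ey t * p.1) =
  (ex s - ex t) * p.2 - (ey s - ey t) * p.1 by ring.
apply: le_trans (ler_normB _ _) _; rewrite !normrM.
have := ler_wpM2r (normr_ge0 p.2) h1; have := ler_wpM2r (normr_ge0 p.1) h2.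
have : 0 <= C * `|s - t| by rewrite mulr_ge0// ltW.
rewrite /L; lra.
Qed.

(** For [s] near [t] on the side of [p], [bd s] is a combination of [bd t] and [p] with nonnegative
    coefficients, given by Cramer's rule; they sum to at least 1 because [bd s] and [bd t] have
    gauge 1 and [p] at most 1. This compares [phi s] with [phi t] on one side of [t], so the
    derivative [2 - det2 p v] of [phi] at [t] is nonnegative. The case of [p] on the line of [bd t]
    is direct. *)
Lemma flow_tangent : exists2 D : set R, countable D & forall t, ~ D t ->
  exists v : R * R, [/\ is_derive t 1 ex v.1, is_derive t 1 ey v.2,
      det2 (bd t) v = 2 & forall p, W p -> det2 p v <= 2].
Proof.
have [D cD HD] := flow_derive bf; exists D => // t /HD[v [dx dy v2]].
exists v; split => // p Wp.
have gp : gauge W p <= 1 by apply/gauge_le1.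
have ge0p : 0 <= gauge W p by exact: gauge_ge0.
pose phi s := det2 (bd s) p + det2 (bd t) (bd s).
have dphi : is_derive t 1 phi (det2 v p + det2 (bd t) v).
  by rewrite /phi /det2 /bd /=; apply: is_derive_eq; rewrite /GRing.scale /=; ring.
have vp : det2 v p = - det2 p v by rewrite /det2; ring.
have phit : phi t = det2 (bd t) p by rewrite /phi /det2; ring.
have key s : 0 <= det2 (bd s) p / det2 (bd t) p -> 0 <= det2 (bd t) (bd s) / det2 (bd t) p ->
    det2 (bd t) p != 0 -> 1 <= det2 (bd s) p / det2 (bd t) p + det2 (bd t) (bd s) / det2 (bd t) p.
  set D0 := det2 (bd t) p => al be D0n.
  have := @gauge_conic _ _ (bd t) p al be; rewrite [gauge W (bd t)](flow_gauge bf).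
  have -> : (det2 (bd s) p / D0) *: bd t + (det2 (bd t) (bd s) / D0) *: p = bd s.
    rewrite [RHS]surjective_pairing /=; congr pair; rewrite /= /GRing.scale /=; move: D0n; rewrite /D0 /det2 /= => ?; by field.
  rewrite [gauge W (bd s)](flow_gauge bf) mulr1 => h; apply: le_trans h _.
  by rewrite lerD2l ler_piMr.
have [D0|D0|D0] := ltgtP (det2 (bd t) p) 0.
- have [d d0 Hd] := @flow_dist_near t (- det2 (bd t) p) p ltac:(by rewrite oppr_gt0).
  have [t1 Et1] := flow_th_surj bf (th t - pi).
  have t1t : t1 < t by rewrite -flow_th_lt Et1 gtrBl pi_gt0.
  suff : 0 <= det2 v p + det2 (bd t) v by rewrite v2 vp; lra.
  apply: (@left_derive_ge0 _ phi t _ (Num.min d (t - t1))) => //.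
    by rewrite lt_min d0 subr_gt0.
  move=> h h0; rewrite lt_min => /andP[hd ht].
  have := Hd (t - h); rewrite addrAC subrr add0r normrN gtr0_norm// => /(_ hd).
  rewrite ltr_norml => /andP[_ b1].
  have b2 : det2 (bd (t - h)) p < 0 by lra.
  have b3 : det2 (bd t) (bd (t - h)) < 0.
    rewrite flow_det -[X in sin X]opprB sinN mulrN oppr_lt0.
    rewrite mulr_gt0// ?mulr_gt0 ?(flow_rho bf)//; apply: flow_sin_gt0; first lra.
    by rewrite -ltrBlDr -Et1 flow_th_lt; lra.
  have nd x : x < 0 -> 0 <= x / det2 (bd t) p by move=> x0; rewrite ltW// nmulr_rgt0// invr_lt0.
  have := key (t - h) (nd _ b2) (nd _ b3) (ltr0_neq0 D0).
  by rewrite -mulrDl ler_ndivlMr// mul1r phit.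
- have [d d0 Hd] := @flow_dist_near t (det2 (bd t) p) p D0.
  have [t1 Et1] := flow_th_surj bf (th t + pi).
  have t1t : t < t1 by rewrite -flow_th_lt Et1 ltrDl pi_gt0.
  suff : 0 <= det2 v p + det2 (bd t) v by rewrite v2 vp; lra.
  apply: (@right_derive_ge0 _ phi t _ (Num.min d (t1 - t))) => //.
    by rewrite lt_min d0 subr_gt0.
  move=> h h0; rewrite lt_min => /andP[hd ht].
  have := Hd (t + h); rewrite addrAC subrr add0r gtr0_norm// => /(_ hd).
  rewrite ltr_norml => /andP[b1 _].
  have b2 : 0 < det2 (bd (t + h)) p by lra.
  have b3 : 0 < det2 (bd t) (bd (t + h)).
    rewrite flow_det.
    rewrite mulr_gt0// ?mulr_gt0 ?(flow_rho bf)//; apply: flow_sin_gt0; first lra.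
    by rewrite -Et1 flow_th_lt; lra.
  have := key (t + h) (ltW (divr_gt0 b2 D0)) (ltW (divr_gt0 b3 D0)) (lt0r_neq0 D0).
  by rewrite -mulrDl ler_pdivlMr// mul1r phit.
- pose m := ex t ^+ 2 + ey t ^+ 2; pose c := (ex t * p.1 + ey t * p.2) / m.
  have m0 : 0 < m.
    rewrite /m (flow_x bf) (flow_y bf) !exprMn -mulrDr cos2Dsin2 mulr1 exprn_gt0//.
    exact: (flow_rho bf).
  have pE : p = c *: bd t.
    have mn := lt0r_neq0 m0.
    rewrite [LHS]surjective_pairing; congr pair; rewrite /= /GRing.scale /= /c.
      rewrite mulrAC; apply: (mulIf mn); rewrite divfK//.
      move: D0; rewrite /det2 /bd /m /= => D0.
      have -> : p.1 * (ex t ^+ 2 + ey t ^+ 2) = (ex t * p.1 + ey t * p.2) * ex t - (ex t * p.2 - ey t * p.1) * ey t by ring.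
      by rewrite D0 mul0r subr0.
    rewrite mulrAC; apply: (mulIf mn); rewrite divfK//.
    move: D0; rewrite /det2 /bd /m /= => D0.
    have -> : p.2 * (ex t ^+ 2 + ey t ^+ 2) = (ex t * p.1 + ey t * p.2) * ey t + (ex t * p.2 - ey t * p.1) * ex t by ring.
    by rewrite D0 mul0r addr0.
  have pv : det2 p v = c * 2 by rewrite -v2 pE /det2 /= /GRing.scale /=; ring.
  rewrite pv; have [c0|c0] := leP c 0; first lra.
  have : c <= 1 by move: gp; rewrite pE gauge_scale// [gauge W (bd t)](flow_gauge bf) mulr1.
  lra.
Qed.

End flow_theory.

(** * Linear functionals along the boundary rise once and fall once *)

Section unimodal.
Context {R : realType}.
Variables (W : set (R * R)) (P : R) (ex ey th rho : R -> R).
Hypotheses (sW : segment_closed W) (nW : nbhs (0 : R * R) W).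
Hypothesis bf : boundary_flow W P ex ey th rho.
Let bd t : R * R := (ex t, ey t).

Definition flow_height (a : R * R) t := a.1 * ex t + a.2 * ey t.

Lemma heightN a t : flow_height (- a) t = - flow_height a t.
Proof. by rewrite /flow_height /=; ring. Qed.

Lemma flow_xP t : ex (t + P) = ex t.
Proof. by rewrite !(flow_x bf) (flow_rhoD bf) (flow_thD bf) cosD2pi. Qed.

Lemma flow_yP t : ey (t + P) = ey t.
Proof. by rewrite !(flow_y bf) (flow_rhoD bf) (flow_thD bf) sinD2pi. Qed.

Lemma heightP a t : flow_height a (t + P) = flow_height a t.
Proof. by rewrite /flow_height flow_xP flow_yP. Qed.

(** On an arc of angle less than pi, [bd m] lies in the cone of the two ends. All three points have
    gauge 1, so subadditivity makes the coefficients sum to at least 1: the arc bulges beyond its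
    chord. *)
Lemma flow_between s m t : s <= m -> m <= t -> s < t -> th t < th s + pi ->
  exists x y : R, [/\ 0 <= x, 0 <= y, 1 <= x + y &
    forall a, flow_height a m = x * flow_height a s + y * flow_height a t].
Proof.
move=> sm mt st tp.
have D0 : 0 < det2 (bd s) (bd t).
  by rewrite (flow_det bf) !mulr_gt0 ?(flow_rho bf)//; exact: flow_sin_gt0 bf _ _ st tp.
have det_ge0 u v : u <= v -> th v < th u + pi -> 0 <= det2 (bd u) (bd v).
  rewrite le_eqVlt => /predU1P[->|uv] h; first by rewrite /det2 mulrC subrr.
  by rewrite (flow_det bf) ltW// !mulr_gt0 ?(flow_rho bf)//; exact: flow_sin_gt0 bf _ _ uv h.
have thle u v : u <= v -> th u <= th v.
  by rewrite le_eqVlt => /predU1P[->//|/(flow_th bf)/ltW].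
have x0 : 0 <= det2 (bd m) (bd t) / det2 (bd s) (bd t).
  by rewrite divr_ge0 ?(ltW D0)// det_ge0//; apply: lt_le_trans tp _; rewrite lerD2r thle.
have y0 : 0 <= det2 (bd s) (bd m) / det2 (bd s) (bd t).
  by rewrite divr_ge0 ?(ltW D0)// det_ge0//; apply: le_lt_trans tp; rewrite thle.
move: x0 y0; set x := _ / _; set y := _ / _ => x0 y0.
have mE : bd m = x *: bd s + y *: bd t.
  have Dn := lt0r_neq0 D0.
  rewrite [RHS]surjective_pairing /=; congr pair; rewrite /= /GRing.scale /= /x /y;
    move: Dn; rewrite /det2 /= => ?; by field.
exists x, y; split => //.
  have := @gauge_conic _ W sW nW x y (bd s) (bd t) x0 y0.
  by rewrite -mE !(flow_gauge bf) !mulr1.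
by move=> a; case: mE => mx my; rewrite /flow_height mx my /GRing.scale /=; ring.
Qed.

Lemma flow_opposite s t : th t = th s + pi -> exists2 c, 0 < c &
  forall a, flow_height a t = - c * flow_height a s.
Proof.
move=> h; exists (rho t / rho s); first by rewrite divr_gt0 ?(flow_rho bf).
move=> a; have r0 := lt0r_neq0 (flow_rho bf s).
by rewrite /flow_height !(flow_x bf) !(flow_y bf) h cosDpi sinDpi; field.
Qed.

(** Otherwise the complementary arc from [t] to [s + P], which contains [x], has angle at most pi.
    If it is less, the height at [x] is a positive combination of positive heights; if it is pi, the
    heights at [s] and [t] have opposite signs. *)
Lemma flow_short_arc a s t x : s < t -> t <= x -> x <= s + P ->
  0 < flow_height a s -> 0 < flow_height a t -> flow_height a x <= 0 -> th t < th s + pi.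
Proof.
move=> st tx xs hs ht hx; rewrite ltNge; apply/negP => tp.
have tltx : t < x.
  by rewrite lt_neqAle tx andbT; apply/eqP => E; move: hx; rewrite -E leNgt ht.
have : th (s + P) <= th t + pi by rewrite (flow_thD bf); lra.
rewrite le_eqVlt => /predU1P[/flow_opposite[c c0 /(_ a)]|tP].
  by rewrite heightP => h; have : 0 < c * flow_height a t; [rewrite mulr_gt0//|lra].
have [u [v [u0 v0 uv /(_ a)]]] := flow_between tx xs (lt_le_trans tltx xs) tP.
rewrite heightP => h; have := mulr_ge0 u0 (ltW ht); have := mulr_ge0 v0 (ltW hs).
have [u1|u1] := ltP 0 u; first by have := mulr_gt0 u1 ht; lra.
by have : 0 < v * flow_height a s; [rewrite mulr_gt0//; lra|lra].
Qed.

Lemma height_arc_pos a s m t x : s <= m -> m <= t -> t <= x -> x <= s + P ->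
  0 < flow_height a s -> 0 < flow_height a t -> flow_height a x <= 0 ->
  Num.min (flow_height a s) (flow_height a t) <= flow_height a m.
Proof.
move=> sm mt tx xs hs ht hx.
have [st|ts] := ltP s t; last first.
  have -> : m = s by apply/le_anti; rewrite sm (le_trans mt ts).
  by rewrite ge_min lexx.
have tp := flow_short_arc st tx xs hs ht hx.
have [u [v [u0 v0 uv ->]]] := flow_between sm mt st tp.
set k := Num.min _ _.
have k0 : 0 <= k by rewrite /k le_min !ltW.
have h1 : u * k <= u * flow_height a s by rewrite ler_wpM2l// /k ge_min lexx.
have h2 : v * k <= v * flow_height a t by rewrite ler_wpM2l// /k ge_min lexx orbT.
by have h3 : 0 <= (u + v - 1) * k; [rewrite mulr_ge0//; lra|lra].
Qed.

Lemma height_arc_neg a s m t x : s <= m -> m <= t -> t <= x -> x <= s + P ->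
  flow_height a s < 0 -> flow_height a t < 0 -> 0 <= flow_height a x ->
  flow_height a m <= Num.max (flow_height a s) (flow_height a t).
Proof.
move=> sm mt tx xs hs ht hx.
have := @height_arc_pos (- a) s m t x sm mt tx xs.
by rewrite !heightN !oppr_gt0 oppr_le0 -oppr_max lerN2; apply.
Qed.

Lemma height_lipschitz a : exists2 C, 0 < C &
  forall s t, `|flow_height a s - flow_height a t| <= C * `|s - t|.
Proof.
have [C C0 HC] := flow_lip bf; exists (C * (`|a.1| + `|a.2| + 1)).
  by rewrite mulr_gt0.
move=> s t; have [h1 h2] := HC s t.
have -> : flow_height a s - flow_height a t = a.1 * (ex s - ex t) + a.2 * (ey s - ey t).
  by rewrite /flow_height; ring.
apply: le_trans (ler_normD _ _) _; rewrite !normrM.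
have := ler_wpM2l (normr_ge0 a.1) h1; have := ler_wpM2l (normr_ge0 a.2) h2.
by have : 0 <= C * `|s - t|; [rewrite mulr_ge0// ltW|lra].
Qed.

Lemma height_continuous a : continuous (flow_height a).
Proof. by have [C C0 H] := height_lipschitz a; exact: lipschitz_continuous C0 H. Qed.

(** Opposite boundary points have heights of opposite signs. If none were positive, all would
    vanish, also at two boundary points at a right angle, which forces [a = 0]. *)
Lemma height_gt0 a : a != 0 -> exists t, 0 < flow_height a t.
Proof.
move=> a0; apply: contrapT => /forallNP H.
have H' t : flow_height a t <= 0 by rewrite leNgt; apply/negP; exact: H.
have zero t : flow_height a t = 0.
  have [t' /flow_opposite[c c0 /(_ a)]] := flow_th_surj bf (th t + pi).
  have := H' t; have := H' t'; have [|t0] := ltP (flow_height a t) 0; last by move=> *; lra.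
  by move=> t0 + _ h; rewrite h; have : c * flow_height a t < 0; [rewrite pmulr_rlt0|lra].
have [t1 Et1] := flow_th_surj bf (th 0 + pi / 2).
have D0 : det2 (bd 0) (bd t1) != 0.
  by rewrite (flow_det bf) Et1 addrAC subrr add0r sin_pihalf mulr1 mulf_neq0// lt0r_neq0// (flow_rho bf).
have := zero 0; have := zero t1; rewrite /flow_height => h1 h0.
have a10 : a.1 = 0.
  apply: (mulIf D0); rewrite mul0r /det2 /=.
  have -> : a.1 * (ex 0 * ey t1 - ey 0 * ex t1) =
    (a.1 * ex 0 + a.2 * ey 0) * ey t1 - (a.1 * ex t1 + a.2 * ey t1) * ey 0 by ring.
  by rewrite h0 h1; ring.
have a20 : a.2 = 0.
  apply: (mulIf D0); rewrite mul0r /det2 /=.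
  have -> : a.2 * (ex 0 * ey t1 - ey 0 * ex t1) =
    (a.1 * ex t1 + a.2 * ey t1) * ex 0 - (a.1 * ex 0 + a.2 * ey 0) * ex t1 by ring.
  by rewrite h0 h1; ring.
by move/eqP: a0; apply; rewrite [a]surjective_pairing a10 a20.
Qed.

Record height_extrema (a : R * R) (tl tr : R) : Prop := {
  extrema_lt : tl < tr < tl + P ;
  extrema_neg : flow_height a tl < 0 ;
  extrema_pos : 0 < flow_height a tr ;
  extrema_min : forall t, flow_height a tl <= flow_height a t ;
  extrema_max : forall t, flow_height a t <= flow_height a tr ;
  extrema_incr : forall s t, tl <= s -> s <= t -> t <= tr -> flow_height a s <= flow_height a t ;
  extrema_decr : forall s t, tr <= s -> s <= t -> t <= tl + P -> flow_height a t <= flow_height a s }.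

(** The height is quasiconcave along arcs with positive ends and quasiconvex along arcs with
    negative ends. A failure of monotonicity between a minimum and a maximum contradicts one of the
    two, depending on the sign of the height at the failure. *)
Lemma height_extrema_exist a : a != 0 -> exists tl tr, height_extrema a tl tr.
Proof.
move=> a0; have P0 := flow_period_gt0 bf.
have cH : continuous (flow_height a) := @height_continuous a.
have [tr _ Mr0] := @EVT_max R (flow_height a) 0 P (ltW P0) (continuous_subspaceT cH).
have Mr t : flow_height a t <= flow_height a tr.
  have [y /andP[y1 y2] <-] := @periodic_repr R R P t 0 P0; last exact: heightP.
  by apply: Mr0; rewrite in_itv /= y1 ltW//; lra.
have [tl] := @EVT_min R (flow_height a) (tr - P) tr ltac:(lra) (continuous_subspaceT cH).
rewrite in_itv /= => /andP[l1 l2] Ml0.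
have Ml t : flow_height a tl <= flow_height a t.
  have [y /andP[y1 y2] <-] := @periodic_repr R R P t (tr - P) P0; last exact: heightP.
  by apply: Ml0; rewrite in_itv /= y1 ltW//; lra.
have pos : 0 < flow_height a tr.
  by have [t /lt_le_trans] := height_gt0 a0; apply; exact: Mr.
have neg : flow_height a tl < 0.
  have [t] : exists t, 0 < flow_height (- a) t by apply: height_gt0; rewrite oppr_eq0.
  by rewrite heightN oppr_gt0; apply: le_lt_trans; exact: Ml.
have ltr : tl < tr.
  by rewrite lt_neqAle l2 andbT; apply/eqP => E; move: neg; rewrite E => /(lt_trans pos); rewrite ltxx.
have rtl : tr < tl + P.
  rewrite lt_neqAle -lerBlDr l1 andbT; apply/eqP => E.
  by move: neg; rewrite -heightP -E => /(lt_trans pos); rewrite ltxx.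
have [incr decr] : (forall s t, tl <= s -> s <= t -> t <= tr -> flow_height a s <= flow_height a t) /\
  (forall s t, tr <= s -> s <= t -> t <= tl + P -> flow_height a t <= flow_height a s).
  split=> s t h1 h2 h3; rewrite leNgt; apply/negP => st.
  - have [t0|t0] := leP 0 (flow_height a t).
      have := @height_arc_pos a s t tr (tl + P) h2 h3 (ltW rtl) ltac:(lra) (le_lt_trans t0 st) pos.
      by rewrite heightP => /(_ (ltW neg)); rewrite min_l ?Mr// leNgt st.
    have := @height_arc_neg a tl s t tr h1 h2 h3 (ltW rtl) neg t0 (ltW pos).
    by rewrite max_r ?Ml// leNgt st.
  - have [s0|s0] := leP 0 (flow_height a s).
      have := @height_arc_pos a tr s t (tl + P) h1 h2 h3 ltac:(lra) pos (le_lt_trans s0 st).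
      by rewrite heightP => /(_ (ltW neg)); rewrite min_r ?Mr// leNgt st.
    have := @height_arc_neg a s t (tl + P) (tr + P) h2 h3 ltac:(lra) ltac:(lra) s0.
    by rewrite !heightP => /(_ neg (ltW pos)); rewrite max_l ?Ml// leNgt st.
by exists tl, tr; split => //; rewrite ltr.
Qed.

End unimodal.

(** * Parallel chords *)

Section chord.
Context {R : realType}.
Variables (W : set (R * R)) (P : R) (ex ey th rho : R -> R).
Hypotheses (sW : segment_closed W) (nW : nbhs (0 : R * R) W).
Hypothesis bf : boundary_flow W P ex ey th rho.
Let bd t : R * R := (ex t, ey t).
Notation height := (flow_height ex ey).

(** The arc starts at [u x], has duration [x] and straddles the maximum [tr]. By [chord_mono] longer
    arcs contain shorter ones, which makes both ends 1-Lipschitz in the duration. *)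
Record chord_family (a : R * R) (tl tr : R) (u : R -> R) : Prop := {
  chord_extrema : height_extrema P ex ey a tl tr ;
  chord_left : forall x, 0 < x < P -> tl <= u x <= tr ;
  chord_right : forall x, 0 < x < P -> tr <= u x + x <= tl + P ;
  chord_height : forall x, 0 < x < P -> height a (u x + x) = height a (u x) ;
  chord_mono : forall x y, 0 < x -> x <= y -> y < P -> u y <= u x <= u y + (y - x) }.

Lemma chord_family_exists a : a != 0 -> exists tl tr u, chord_family a tl tr u.
Proof.
move=> a0; have [tl [tr E]] := height_extrema_exist sW nW bf a0.
have P0 := flow_period_gt0 bf.
have /andP[lr rl] := extrema_lt E.
have [C C0 HC] := height_lipschitz bf a.
pose S x := [set s | [/\ tl <= s, s <= tr, s + x <= tl + P & height a s <= height a (s + x)]].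
(* The latest start on the ascending side for which the arc of duration [x] does
   not end lower: taking the supremum makes [u] and [u x + x] monotone in [x],
   even when the boundary has edges at extremal height. *)
pose u x := sup (S x).
have Sl x : 0 < x < P -> S x tl.
  by move=> /andP[x0 xP]; split; rewrite ?(extrema_min E)//; lra.
have hS x : 0 < x < P -> has_sup (S x).
  by move=> xP; split; [exists tl; exact: Sl|exists tr => s [_ h _ _]].
have nS x d : 0 < x < P -> 0 < d -> ~ S x (u x + d).
  move=> xP d0 Sd; have := ub_le_sup (hS x xP).2 Sd; rewrite -/(u x); lra.
have uS x : 0 < x < P -> S x (u x).
  move=> xP; have ul : tl <= u x by apply: (ub_le_sup (hS x xP).2); exact: Sl.
  have ur : u x <= tr by apply: ge_sup; [exact: (hS x xP).1|move=> s []].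
  have uP : u x <= tl + P - x.
    by apply: ge_sup; [exact: (hS x xP).1|move=> s [_ _ h _]; lra].
  split => //; first lra.
  apply/ler_addgt0Pr => e e0.
  have d0 : 0 < e / (2 * C) by rewrite divr_gt0// mulr_gt0.
  have [s Ss us] := sup_adherent d0 (hS x xP); rewrite -/(u x) in us.
  have su : s <= u x by exact: (ub_le_sup (hS x xP).2).
  have [_ _ _ hs] := Ss.
  have h1 := HC (u x) s; have h2 := HC (s + x) (u x + x).
  have e1 : `|u x - s| <= e / (2 * C) by rewrite ger0_norm; lra.
  have e2 : `|s + x - (u x + x)| <= e / (2 * C).
    by rewrite (_ : s + x - (u x + x) = - (u x - s)) ?normrN//; ring.
  have k : C * (e / (2 * C)) = e / 2 by field; rewrite gt_eqF.
  have := ler_wpM2l (ltW C0) e1; have := ler_wpM2l (ltW C0) e2; rewrite k.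
  have := ler_norm (height a (u x) - height a s).
  have := ler_norm (height a (s + x) - height a (u x + x)).
  lra.
have uub x s : 0 < x < P -> S x s -> s <= u x.
  by move=> xP; exact: (ub_le_sup (hS x xP).2).
clearbody u.
(* If the arc ended strictly higher than it starts, a slightly later start would still be
   admissible. *)
have ueq x : 0 < x < P -> height a (u x + x) = height a (u x).
  move=> xP; have [ul ur uP uh] := uS x xP.
  apply/le_anti; rewrite uh andbT leNgt; apply/negP => lt.
  have utr : u x < tr.
    rewrite lt_neqAle ur andbT; apply/eqP => Eu.
    by move: lt; rewrite ltNge Eu (extrema_max E).
  have uPlt : u x + x < tl + P.
    rewrite lt_neqAle uP andbT; apply/eqP => Eu.
    by move: lt; rewrite ltNge Eu (heightP bf) (extrema_min E).
  pose d := Num.min (Num.min (tr - u x) (tl + P - (u x + x)))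
    ((height a (u x + x) - height a (u x)) / (2 * C)).
  have d0 : 0 < d by rewrite !lt_min !subr_gt0 utr uPlt divr_gt0// ?subr_gt0// mulr_gt0.
  have /and3P[d1 d2 d3] : [&& d <= tr - u x, d <= tl + P - (u x + x) &
      d <= (height a (u x + x) - height a (u x)) / (2 * C)].
    by rewrite !ge_min !lexx !orbT.
  apply: (nS x d xP d0); split; [lra..|].
  have h1 := HC (u x + d) (u x); have h2 := HC (u x + x) (u x + d + x).
  have e1 : `|u x + d - u x| = d by rewrite addrAC subrr add0r gtr0_norm.
  have e2 : `|u x + x - (u x + d + x)| = d.
    by rewrite (_ : u x + x - (u x + d + x) = - d) ?normrN ?gtr0_norm//; ring.
  rewrite e1 in h1; rewrite e2 in h2.
  move: d3; rewrite ler_pdivlMr ?mulr_gt0//.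
  have := ler_norm (height a (u x + d) - height a (u x)).
  have := ler_norm (height a (u x + x) - height a (u x + d + x)).
  lra.
(* An arc ending before [tr] could be moved forward, still on the ascending side. *)
have ur x : 0 < x < P -> tr <= u x + x.
  move=> xP; have [ul ur' uP _] := uS x xP; have /andP[x0 _] := xP.
  rewrite leNgt; apply/negP => lt.
  pose d := Num.min (tr - (u x + x)) x.
  have d0 : 0 < d by rewrite lt_min subr_gt0 lt.
  have /andP[d1 d2] : (d <= tr - (u x + x)) && (d <= x) by rewrite !ge_min !lexx orbT.
  apply: (nS x d xP d0); split; [lra..|].
  apply: (@le_trans _ _ (height a (u x + x))).
    by apply: (extrema_incr E); lra.
  by apply: (extrema_incr E); lra.
exists tl, tr, u; split => //.
- by move=> x xP; have [h1 h2 _ _] := uS x xP; rewrite h1.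
- by move=> x xP; have [_ _ h _] := uS x xP; rewrite ur.
move=> x y x0 xy yP; have xP : 0 < x < P by rewrite x0 (le_lt_trans xy).
have yP' : 0 < y < P by rewrite yP (lt_le_trans x0).
have [x1 x2 x3 x4] := uS x xP; have [y1 y2 y3 y4] := uS y yP'.
have rx := ur x xP; have ry := ur y yP'.
apply/andP; split.
  apply: uub => //; split => //; first lra.
  have [h|h] := leP (u y + x) tr; first by apply: (extrema_incr E); lra.
  by apply: le_trans y4 _; apply: (extrema_decr E); lra.
rewrite -lerBlDr; have [h|h] := leP tl (u x - (y - x)); last lra.
apply: uub => //; split => //; [lra|lra|].
rewrite (_ : u x - (y - x) + y = u x + x); last ring.
apply: le_trans x4; apply: (extrema_incr E); lra.
Qed.

Section family.
Variables (a : R * R) (tl tr : R) (u : R -> R).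
Hypothesis cf : chord_family a tl tr u.
Let E : height_extrema P ex ey a tl tr := chord_extrema cf.

(** The signed coefficient of the chord along i a, which is the vector [(- a.2, a.1)]. *)
Definition chord_length x :=
  (a.1 * (ey (u x + x) - ey (u x)) - a.2 * (ex (u x + x) - ex (u x))) / (a.1 ^+ 2 + a.2 ^+ 2).

Lemma chord_above x t : 0 < x < P -> u x <= t <= u x + x -> height a (u x) <= height a t.
Proof.
move=> xP /andP[t1 t2]; have /andP[h1 h2] := chord_left cf xP.
have /andP[h3 h4] := chord_right cf xP.
have [h|h] := leP t tr; first by apply: (extrema_incr E); lra.
by rewrite -(chord_height cf xP); apply: (extrema_decr E); lra.
Qed.

Lemma chord_below x t : 0 < x < P -> u x + x <= t <= u x + P -> height a t <= height a (u x).
Proof.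
move=> xP /andP[t1 t2]; have /andP[h1 h2] := chord_left cf xP.
have /andP[h3 h4] := chord_right cf xP.
have [h|h] := leP t (tl + P).
  by rewrite -(chord_height cf xP); apply: (extrema_decr E); lra.
rewrite -(heightP bf) -(subrK P t) !(heightP bf).
by apply: (extrema_incr E); lra.
Qed.

Lemma chord_normal_gt0 : 0 < a.1 ^+ 2 + a.2 ^+ 2.
Proof.
have := extrema_pos E; rewrite /flow_height => h.
rewrite lt_neqAle addr_ge0 ?sqr_ge0// andbT eq_sym paddr_eq0 ?sqr_ge0// !sqrf_eq0.
by apply: contraTN h => /andP[/eqP -> /eqP ->]; rewrite !mul0r addr0 ltxx.
Qed.

Lemma chord_x x : 0 < x < P -> ex (u x + x) - ex (u x) = - chord_length x * a.2.
Proof.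
move=> xP; have := chord_height cf xP; rewrite /flow_height /chord_length => h.
have N := chord_normal_gt0; apply: (mulIf (lt0r_neq0 N)).
rewrite -mulNr mulrAC divfK ?lt0r_neq0//.
have -> : (ex (u x + x) - ex (u x)) * (a.1 ^+ 2 + a.2 ^+ 2) =
  a.1 * ((a.1 * ex (u x + x) + a.2 * ey (u x + x)) - (a.1 * ex (u x) + a.2 * ey (u x))) +
  - (a.1 * (ey (u x + x) - ey (u x)) - a.2 * (ex (u x + x) - ex (u x))) * a.2 by ring.
by rewrite h; ring.
Qed.

Lemma chord_y x : 0 < x < P -> ey (u x + x) - ey (u x) = chord_length x * a.1.
Proof.
move=> xP; have := chord_height cf xP; rewrite /flow_height /chord_length => h.
have N := chord_normal_gt0; apply: (mulIf (lt0r_neq0 N)).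
rewrite mulrAC divfK ?lt0r_neq0//.
have -> : (ey (u x + x) - ey (u x)) * (a.1 ^+ 2 + a.2 ^+ 2) =
  a.2 * ((a.1 * ex (u x + x) + a.2 * ey (u x + x)) - (a.1 * ex (u x) + a.2 * ey (u x))) +
  (a.1 * (ey (u x + x) - ey (u x)) - a.2 * (ex (u x + x) - ex (u x))) * a.1 by ring.
by rewrite h; ring.
Qed.

Lemma chord_det x : 0 < x < P ->
  det2 (bd (u x)) (bd (u x + x)) = height a (u x) * chord_length x.
Proof.
move=> xP; have := chord_x xP; have := chord_y xP; rewrite /det2 /flow_height /= => hy hx.
have -> : ex (u x) * ey (u x + x) - ey (u x) * ex (u x + x) =
  ex (u x) * (ey (u x + x) - ey (u x)) - ey (u x) * (ex (u x + x) - ex (u x)) by ring.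
by rewrite hx hy; ring.
Qed.

(** By [chord_det] the sign follows from the height and the determinant of the endpoints. At
    positive height the arc has angle less than pi, at negative height its complement has. At height
    zero the endpoints are opposite, and the point [tr] between them decides the direction. *)
Lemma chord_length_gt0 x : 0 < x < P -> 0 < chord_length x.
Proof.
move=> xP; have /andP[x0 xP'] := xP.
have /andP[h1 h2] := chord_left cf xP; have /andP[h3 h4] := chord_right cf xP.
have /andP[lr rl] := extrema_lt E.
have hE := chord_height cf xP; have D := chord_det xP.
have pos := extrema_pos E; have neg := extrema_neg E.
have thu : th (u x) < th (u x + x) by apply: (flow_th bf); lra.
have thP : th (u x + x) < th (u x) + pi *+ 2 by rewrite -(flow_thD bf); apply: (flow_th bf); lra.
rewrite (flow_det bf) in D.
have [h|h|h] := ltgtP (height a (u x)) 0.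
- have := @flow_short_arc _ _ _ _ _ _ _ sW nW bf (- a) (u x + x) (u x + P) (tr + P).
  rewrite !heightN !(heightP bf) !oppr_gt0 oppr_le0 hE => /(_ ltac:(lra) ltac:(lra) ltac:(lra) h h (ltW pos)).
  rewrite (flow_thD bf) => tp.
  have : 0 < sin (th (u x + x) - th (u x) - pi) by apply: sin_gt0_pi; apply/andP; split; lra.
  rewrite sinB sinpi cospi mulr0 subr0 mulrN1 oppr_gt0 => s0.
  rewrite -(nmulr_rlt0 _ h) -D nmulr_llt0// mulr_gt0 ?(flow_rho bf)//.
- have := @flow_short_arc _ _ _ _ _ _ _ sW nW bf a (u x) (u x + x) (tl + P).
  rewrite !(heightP bf) hE => /(_ ltac:(lra) ltac:(lra) ltac:(lra) h h (ltW neg)) tp.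
  rewrite -(pmulr_rgt0 _ h) -D !mulr_gt0 ?(flow_rho bf)//; apply: sin_gt0_pi; apply/andP; split; lra.
- have utr : u x < tr.
    by rewrite lt_neqAle h2 andbT; apply/eqP => Eu; move: pos; rewrite -Eu h ltxx.
  have rxu : tr < u x + x.
    by rewrite lt_neqAle h3 andbT; apply/eqP => Eu; move: pos; rewrite Eu hE h ltxx.
  have Nd := chord_normal_gt0.
  have opp : th (u x + x) = th (u x) + pi.
    move: D; rewrite h mul0r => /eqP; rewrite !mulf_eq0 !(gt_eqF (flow_rho bf _))/= => /eqP s0.
    have [tp|tp|//] := ltgtP (th (u x + x)) (th (u x) + pi).
    + have : 0 < sin (th (u x + x) - th (u x)) by apply: sin_gt0_pi; rewrite subr_gt0 thu ltrBlDl.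
      by rewrite s0 ltxx.
    + have : 0 < sin (th (u x + x) - th (u x) - pi) by apply: sin_gt0_pi; apply/andP; split; lra.
      by rewrite sinB s0 sinpi mulr0 mul0r subrr ltxx.
  have thr : th tr < th (u x) + pi by rewrite -opp; apply: (flow_th bf).
  have dr : 0 < det2 (bd (u x)) (bd tr).
    rewrite (flow_det bf) !mulr_gt0 ?(flow_rho bf)//; apply: sin_gt0_pi.
    by rewrite subr_gt0 (flow_th bf utr) ltrBlDl.
  have := chord_x xP; have := chord_y xP.
  have [c c0 cE] : exists2 c, 0 < c & forall b, height b (u x + x) = - c * height b (u x).
    exact: (flow_opposite bf).
  have cx := cE (1, 0); have cy := cE (0, 1); rewrite /flow_height /= !mul1r !mul0r !addr0 !add0r in cx cy.
  move=> hy hx; move: h pos; rewrite /flow_height => h pos.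
  rewrite /chord_length divr_gt0// cx cy.
  have k : (a.1 ^+ 2 + a.2 ^+ 2) * det2 (bd (u x)) (bd tr) =
    (a.1 * ex (u x) + a.2 * ey (u x)) * (a.1 * ey tr - a.2 * ex tr) -
    (a.1 * ey (u x) - a.2 * ex (u x)) * (a.1 * ex tr + a.2 * ey tr) by rewrite /det2 /=; ring.
  have : 0 < - (a.1 * ey (u x) - a.2 * ex (u x)).
    rewrite -(pmulr_lgt0 _ pos) mulNr.
    by have := mulr_gt0 Nd dr; rewrite k h mul0r sub0r.
  have -> : a.1 * (- c * ey (u x) - ey (u x)) - a.2 * (- c * ex (u x) - ex (u x)) =
    (1 + c) * - (a.1 * ey (u x) - a.2 * ex (u x)) by ring.
  by move=> ?; rewrite mulr_gt0//; lra.
Qed.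

End family.
End chord.

(** * Lipschitz functions with a derivative off a countable set *)

Section lip_itv.
Context {R : realType}.
Implicit Types (f g : R -> R) (a b : R).
Notation mu := (@lebesgue_measure R).

Definition lip_itv a b f := exists2 C, 0 < C &
  forall x y, a <= x -> x <= y -> y <= b -> `|f y - f x| <= C * (y - x).

Lemma lip_itv_global a b f C : 0 < C -> (forall x y, `|f x - f y| <= C * `|x - y|) -> lip_itv a b f.
Proof.
move=> C0 H; exists C => // x y _ xy _; apply: le_trans (H _ _) _.
by rewrite ger0_norm ?subr_ge0.
Qed.

Lemma lip_itvD a b f g : lip_itv a b f -> lip_itv a b g -> lip_itv a b (fun x => f x + g x).
Proof.
move=> [C C0 HC] [D D0 HD]; exists (C + D); first exact: addr_gt0.
move=> x y ax xy yb; rewrite opprD addrACA mulrDl.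
by apply: le_trans (ler_normD _ _) _; rewrite lerD ?HC ?HD.
Qed.

Lemma lip_itvN a b f : lip_itv a b f -> lip_itv a b (fun x => - f x).
Proof.
move=> [C C0 HC]; exists C => // x y ax xy yb.
by rewrite -opprD normrN HC.
Qed.

Lemma lip_itv_bounded a b f : lip_itv a b f -> exists2 M, 0 < M & forall x, a <= x <= b -> `|f x| <= M.
Proof.
move=> [C C0 HC]; exists (`|f a| + C * `|b - a| + 1).
  by rewrite ltr_wpDl// addr_ge0// mulr_ge0// ltW.
move=> x /andP[ax xb]; have := HC a x (lexx _) ax xb.
have := ler_norm (b - a); have := ler_wpM2l (ltW C0) (_ : x - a <= b - a).
rewrite lerD2r => /(_ xb) h1 h2 h3.
have := ler_wpM2l (ltW C0) h2; have := ler_normD (f x - f a) (f a); rewrite subrK; lra.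
Qed.

Lemma lip_itvM a b f g : lip_itv a b f -> lip_itv a b g -> lip_itv a b (fun x => f x * g x).
Proof.
move=> lf lg; have [M M0 HM] := lip_itv_bounded lf; have [N N0 HN] := lip_itv_bounded lg.
case: lf lg => [C C0 HC] [D D0 HD]; exists (C * N + M * D); first by rewrite addr_gt0// mulr_gt0.
move=> x y ax xy yb.
have -> : f y * g y - f x * g x = (f y - f x) * g y + f x * (g y - g x) by ring.
apply: le_trans (ler_normD _ _) _; rewrite !normrM mulrDl; apply: lerD.
  by rewrite mulrAC; apply: ler_pM; rewrite ?HC ?HN// yb (le_trans ax).
by rewrite -mulrA; apply: ler_pM; rewrite ?HD ?HM// ax (le_trans xy).
Qed.

Lemma lip_itv_cst a b c : lip_itv a b (fun=> c).
Proof. by exists 1 => // x y _ xy _; rewrite subrr normr0 mul1r subr_ge0. Qed.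

Lemma lip_itv_id a b : lip_itv a b id.
Proof. by exists 1 => // x y _ xy _; rewrite ger0_norm ?subr_ge0// mul1r. Qed.

Lemma countable_negligible (D : set R) : countable D -> mu.-negligible D.
Proof.
move=> cD; apply/negligibleP; first exact: countable_measurable.
exact: countable_lebesgue_measure0.
Qed.

Lemma lip_itv_derive_le0 a b f (D : set R) : a <= b -> lip_itv a b f -> countable D ->
  (forall x, a < x < b -> ~ D x -> exists2 l, is_derive x 1 f l & l <= 0) -> f b <= f a.
Proof.
move=> ab [C _ HC] cD; apply: ac_derive_le0 => //; last exact: countable_negligible.
exact: (lipschitz_abs_continuous HC).
Qed.

Lemma lip_itv_derive0 a b f (D : set R) : a <= b -> lip_itv a b f -> countable D ->
  (forall x, a < x < b -> ~ D x -> is_derive x 1 f 0) -> f b = f a.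
Proof.
move=> ab lf cD H; apply/le_anti/andP; split.
  by apply: (lip_itv_derive_le0 ab lf cD) => x xab Dx; exists 0; [exact: H|].
rewrite -lerN2; apply: (lip_itv_derive_le0 ab (lip_itvN lf) cD) => x xab Dx.
exists 0 => //; have := H x xab Dx => d; rewrite -oppr0; exact: is_deriveN.
Qed.

End lip_itv.

Lemma polar_coordinates {R : realType} (x y : R) : x ^+ 2 + y ^+ 2 = 1 ->
  exists t, x = cos t /\ y = sin t.
Proof.
move=> xy; have x1 : -1 <= x <= 1.
  rewrite -ler_norml -(@expr_le1 _ 2)// real_normK ?num_real//; have := sqr_ge0 y; lra.
have sy : Num.sqrt (1 - x ^+ 2) = `|y| by rewrite -xy addrAC subrr add0r sqrtr_sqr.
have [y0|y0] := leP 0 y.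
  by exists (acos x); rewrite acosK// sin_acos// sy ger0_norm.
by exists (- acos x); rewrite cosN sinN acosK// sin_acos// sy ltr0_norm// opprK.
Qed.

Lemma cross_bound {R : realType} (r x y : R) : 0 < r ->
  - (r / 2) * y - 0 * x <= 2 -> 0 * y - - (r / 2) * x <= 2 ->
  r / 2 * y - 0 * x <= 2 -> 0 * y - r / 2 * x <= 2 -> `|x| <= 4 / r /\ `|y| <= 4 / r.
Proof.
move=> r0; rewrite !mul0r !subr0 !sub0r => k1 k2 k3 k4.
split; rewrite ler_norml lerNl !ler_pdivlMr//; apply/andP; split; lra.
Qed.

(** * The period of the flow, and determinants of nearby points *)

Section flow_area.
Context {R : realType}.
Variables (W : set (R * R)) (P : R) (ex ey th rho : R -> R).
Hypotheses (cW : compact W) (sW : segment_closed W) (nW : nbhs (0 : R * R) W).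
Hypothesis bf : boundary_flow W P ex ey th rho.
Let bd t : R * R := (ex t, ey t).

Lemma flow_in t : W (bd t).
Proof. by apply/(gauge_le1 cW sW nW); rewrite (flow_gauge bf). Qed.

Lemma flow_polar (p : R * R) : exists t, p = gauge W p *: bd t.
Proof.
have [->|p0] := eqVneq p 0; first by exists 0; rewrite (gauge0 nW) scale0r.
pose m := Num.sqrt (p.1 ^+ 2 + p.2 ^+ 2).
have s0 : 0 < p.1 ^+ 2 + p.2 ^+ 2.
  rewrite lt_neqAle addr_ge0 ?sqr_ge0// andbT eq_sym paddr_eq0 ?sqr_ge0// !sqrf_eq0.
  by apply: contra p0 => /andP[/eqP p1 /eqP p2]; rewrite [p]surjective_pairing p1 p2.
have m0 : 0 < m by rewrite sqrtr_gt0.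
have [|f [f1 f2]] := @polar_coordinates R (p.1 / m) (p.2 / m).
  by rewrite !expr_div_n -mulrDl sqr_sqrtr ?ltW// mulfV// gt_eqF.
have [t Et] := flow_th_surj bf f; exists t.
have r0 := flow_rho bf t.
have pE : p = (m / rho t) *: bd t.
  rewrite [LHS]surjective_pairing; congr pair; rewrite /= /GRing.scale /=.
    by rewrite (flow_x bf) Et -f1; field; rewrite !gt_eqF.
  by rewrite (flow_y bf) Et -f2; field; rewrite !gt_eqF.
rewrite [in gauge W p]pE (gauge_scale sW nW) ?divr_gt0// [gauge W (bd t)](flow_gauge bf) mulr1.
exact: pE.
Qed.

Lemma flow_x_lip a b : lip_itv a b ex.
Proof. by have [C C0 H] := flow_lip bf; apply: (lip_itv_global _ _ C0) => x y; have [] := H x y. Qed.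

Lemma flow_y_lip a b : lip_itv a b ey.
Proof. by have [C C0 H] := flow_lip bf; apply: (lip_itv_global _ _ C0) => x y; have [] := H x y. Qed.

Lemma derive_monotone (f : R -> R) (t l a b : R) : a < t < b -> is_derive t 1 f l ->
  (forall s u, a <= s -> s <= u -> u <= b -> f s <= f u) -> 0 <= l.
Proof.
move=> /andP[at_ tb] d H; apply: (right_derive_ge0 d (_ : 0 < b - t)); first by rewrite subr_gt0.
by move=> h h0 hb; apply: H; lra.
Qed.

Lemma primitive_lip (F f : R -> R) (M a b : R) : 0 < M ->
  (forall x : R, is_derive x 1 F (f x)) -> (forall x, a <= x <= b -> `|f x| <= M) ->
  forall x y, a <= x <= b -> a <= y <= b -> `|F x - F y| <= M * `|x - y|.
Proof.
move=> M0 dF Hf x y; wlog xy : x y / y <= x => [H|] xab yab.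
  by case: (leP y x) => [|/ltW] h; [|rewrite distrC (distrC x)]; exact: H.
have [|c] := @MVT_segment R F f y x xy (fun x _ => dF x).
  by apply: continuous_subspaceT => z; apply: differentiable_continuous; apply/derivable1_diffP; have [] := dF z.
rewrite in_itv /= => /andP[c1 c2] ->; rewrite normrM ler_wpM2r// Hf//.
by case/andP: xab => _ xb; case/andP: yab => ya _; rewrite (le_trans ya c1) (le_trans c2 xb).
Qed.

(** The function x y / 2 - F(x) - t is constant along the boundary, with F = [Lo] where the abscissa
    increases and F = [Hi] where it decreases. Indeed the supporting line at the boundary point,
    tested on the graph point with the same abscissa, shows that either the two points agree or the
    abscissa is stationary. *)
Lemma flow_period_area xl xr lo hi Lo Hi : planar_profile W xl xr lo hi Lo Hi ->
  P = (Hi xr - Hi xl) - (Lo xr - Lo xl).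
Proof.
move=> pr; have P0 := flow_period_gt0 bf.
have a0 : (1, 0) != 0 :> R * R by rewrite xpair_eqE /= oner_eq0.
have [tl [tr E]] := height_extrema_exist sW nW bf a0.
have hE t : flow_height ex ey (1, 0) t = ex t by rewrite /flow_height /= mul1r mul0r addr0.
have /andP[lr rl] := extrema_lt E.
have xpos : 0 < ex tr by rewrite -hE (extrema_pos E).
have xneg : ex tl < 0 by rewrite -hE (extrema_neg E).
have xmin t : ex tl <= ex t by rewrite -!hE (extrema_min E).
have xmax t : ex t <= ex tr by rewrite -!hE (extrema_max E).
have xlr := profile_lt pr.
have Wx p : W p -> ex tl <= p.1 <= ex tr.
  move=> /(gauge_le1 cW sW nW) p1; have g0 := gauge_ge0 nW p; have [t pE] := flow_polar p.
  have -> : p.1 = gauge W p * ex t by rewrite {1}pE.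
  have := ler_wpM2l g0 (xmin t); have := ler_wpM2l g0 (xmax t).
  have : 0 <= (1 - gauge W p) * ex tr by rewrite mulr_ge0 ?subr_ge0// ltW.
  have : 0 <= (1 - gauge W p) * - ex tl by rewrite mulr_ge0 ?subr_ge0// ?oppr_ge0 ltW.
  by move=> k1 k2 k3 k4; apply/andP; split; lra.
have exl : ex tl = xl.
  have [/andP[h _] _] := profile_sub pr (flow_in tl).
  have [/Wx/= /andP[h2 _] _] := profile_in pr (ltac:(by rewrite lexx ltW) : xl <= xl <= xr).
  by apply/le_anti; rewrite h h2.
have exr : ex tr = xr.
  have [/andP[_ h] _] := profile_sub pr (flow_in tr).
  have [/Wx/= /andP[_ h2] _] := profile_in pr (ltac:(by rewrite lexx ltW) : xl <= xr <= xr).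
  by apply/le_anti; rewrite h h2.
have [M M0 HM] := body_bounded cW nW.
have lohi x : xl <= x <= xr -> `|lo x| <= M /\ `|hi x| <= M.
  by move=> /(profile_in pr)[/HM + /HM]; rewrite !pair_norm_le => /andP[_ ->] /andP[_ ->].
have xin t : xl <= ex t <= xr by rewrite -exl -exr xmin xmax.
have comp_lip (F f : R -> R) s t : (forall x : R, is_derive x 1 F (f x)) ->
    (forall x, xl <= x <= xr -> `|f x| <= M) -> lip_itv s t (fun x => F (ex x)).
  move=> dF HF; have [C C0 HC] := flow_lip bf.
  apply: (@lip_itv_global _ _ _ _ (M * C)); first exact: mulr_gt0.
  move=> x y; apply: le_trans (primitive_lip M0 dF HF (xin x) (xin y)) _.
  by rewrite -mulrA ler_pM2l//; have [] := HC x y.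
have G_lip (F f : R -> R) s t : (forall x : R, is_derive x 1 F (f x)) ->
    (forall x, xl <= x <= xr -> `|f x| <= M) ->
    lip_itv s t (fun x => 2^-1 * (ex x * ey x) - F (ex x) - x).
  move=> dF HF; apply: lip_itvD; last by apply: lip_itvN; exact: lip_itv_id.
  apply: lip_itvD; last by apply: lip_itvN; exact: comp_lip HF.
  by apply: lip_itvM; [exact: lip_itv_cst|apply: lip_itvM; [exact: flow_x_lip|exact: flow_y_lip]].
have [D cD HD] := flow_tangent cW sW nW bf.
have G_derive (F f : R -> R) (t : R) (v : R * R) : (forall x : R, is_derive x 1 F (f x)) ->
    is_derive t 1 ex v.1 -> is_derive t 1 ey v.2 -> det2 (bd t) v = 2 ->
    (ey t - f (ex t)) * v.1 = 0 ->
    is_derive t 1 (fun x => 2^-1 * (ex x * ey x) - F (ex x) - x) 0.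
  move=> dF dx dy v2 k.
  have dFx : is_derive t 1 (fun x => F (ex x)) (f (ex t) * v.1) by exact: is_derive1_comp.
  apply: is_derive_eq; move: v2; rewrite /det2 /= /GRing.scale /= => v2.
  have e2 : ex t * v.2 = 2 + ey t * v.1 by rewrite -v2; ring.
  by rewrite e2; move: k; rewrite mulrBl => k; lra.
pose G F x := 2^-1 * (ex x * ey x) - F (ex x) - x.
have GL : G Lo tr = G Lo tl.
  have lG : lip_itv tl tr (G Lo) by apply: (G_lip _ _ _ _ (profile_lo pr)) => x /lohi[].
  apply: (lip_itv_derive0 (ltW lr) lG cD).
  move=> t t01 /HD[v [dx dy v2 sup]]; apply: (G_derive _ _ _ v (profile_lo pr)) => //.
  have v10 : 0 <= v.1.
    apply: (derive_monotone t01 dx) => s u h1 h2 h3.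
    by rewrite -!hE; exact: (extrema_incr E).
  have [_ /andP[l1 _]] := profile_sub pr (flow_in t).
  have [/sup + _] := profile_in pr (xin t).
  rewrite -v2 /det2 /= => s1; apply/le_anti/andP; split; first lra.
  by rewrite mulr_ge0// subr_ge0.
have GH : G Hi (tl + P) = G Hi tr.
  have lG : lip_itv tr (tl + P) (G Hi) by apply: (G_lip _ _ _ _ (profile_hi pr)) => x /lohi[].
  apply: (lip_itv_derive0 (ltW rl) lG cD).
  move=> t t01 /HD[v [dx dy v2 sup]]; apply: (G_derive _ _ _ v (profile_hi pr)) => //.
  have v10 : 0 <= - v.1.
    apply: (derive_monotone t01 (_ : is_derive t 1 (fun x => - ex x) _)) => s u h1 h2 h3.
    by rewrite lerN2 -!hE; exact: (extrema_decr E).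
  have [_ /andP[_ l1]] := profile_sub pr (flow_in t).
  have [_ /sup +] := profile_in pr (xin t).
  rewrite -v2 /det2 /= => s1; apply/le_anti/andP; split; first lra.
  by rewrite -mulrNN mulr_ge0// opprB subr_ge0.
move: GL GH; rewrite /G (flow_xP bf) (flow_yP bf) exl exr; lra.
Qed.

(** As a function of [t] the determinant has derivative at most 2 by the tangent inequality, and at
    least 2 minus a multiple of [t - s], because the curve is Lipschitz and its velocity is
    bounded. *)
Lemma flow_det_bounds : exists2 C, 0 < C & forall s t, s <= t ->
  2 * (t - s) - C * (t - s) ^+ 2 <= det2 (bd s) (bd t) <= 2 * (t - s).
Proof.
have [r r0 Hr] := body_ball nW; have [C C0 HC] := flow_lip bf.
have [D cD HD] := flow_tangent cW sW nW bf.
have det_lip s a b : lip_itv a b (fun t => det2 (bd s) (bd t)).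
  apply: lip_itvD; first by apply: lip_itvM; [exact: lip_itv_cst|exact: flow_y_lip].
  by apply: lip_itvN; apply: lip_itvM; [exact: lip_itv_cst|exact: flow_x_lip].
have der (s t : R) (v : R * R) : is_derive t 1 ex v.1 -> is_derive t 1 ey v.2 ->
    is_derive t 1 (fun t => det2 (bd s) (bd t)) (det2 (bd s) v).
  by move=> dx dy; rewrite /det2 /=; apply: is_derive_eq; rewrite /GRing.scale /=; ring.
exists (8 * C / r); first by rewrite divr_gt0// mulr_gt0.
move=> s t st; have det0 : det2 (bd s) (bd s) = 0 by rewrite /det2 mulrC subrr.
apply/andP; split; last first.
  suff : det2 (bd s) (bd t) - 2 * t <= det2 (bd s) (bd s) - 2 * s by rewrite det0; lra.
  apply: (@lip_itv_derive_le0 _ _ _ (fun x => det2 (bd s) (bd x) - 2 * x) D) => //.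
    by apply: lip_itvD => //; apply: lip_itvN; apply: lip_itvM; [exact: lip_itv_cst|exact: lip_itv_id].
  move=> x _ /HD[v [dx dy v2 sup]]; exists (det2 (bd s) v - 2); last by rewrite subr_le0 sup//; exact: flow_in.
  by have d1 := der s x v dx dy; apply: is_derive_eq; rewrite /GRing.scale /=; ring.
suff : 2 * t - (8 * C / r) * (t - s) ^+ 2 - det2 (bd s) (bd t) <=
    2 * s - (8 * C / r) * (s - s) ^+ 2 - det2 (bd s) (bd s).
  by rewrite subrr expr0n mulr0 subr0 det0; lra.
apply: (@lip_itv_derive_le0 _ _ _ (fun x => 2 * x - (8 * C / r) * (x - s) ^+ 2 - det2 (bd s) (bd x)) D) => //.
  apply: lip_itvD; last exact: lip_itvN.
  apply: lip_itvD; first by apply: lip_itvM; [exact: lip_itv_cst|exact: lip_itv_id].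
  apply: lip_itvN; apply: lip_itvM; first exact: lip_itv_cst.
  have l1 a b : lip_itv a b (fun x => x - s).
    by apply: lip_itvD; [exact: lip_itv_id|exact: lip_itv_cst].
  by rewrite (_ : (fun x => _) = (fun x => (x - s) * (x - s))); [exact: lip_itvM|apply/funext => x; rewrite expr2].
move=> x /andP[sx xt] /HD[v [dx dy v2 sup]].
exists (2 - (8 * C / r) * (2 * (x - s)) - det2 (bd s) v).
  by have d1 := der s x v dx dy; apply: is_derive_eq; rewrite /GRing.scale /=; ring.
(* The tangent inequality at the four points of [W] on the axes at distance [r / 2] bounds the
   velocity. *)
have vb : `|v.1| <= 4 / r /\ `|v.2| <= 4 / r.
  have W1 (y z : R) : `|y| = r / 2 -> `|z| <= r / 2 -> W (y, z) /\ W (z, y).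
    by move=> Y Z; split; apply: Hr; apply: (@le_lt_trans _ _ (r / 2)); rewrite ?pair_norm_le ?Y ?Z ?lexx//; lra.
  have nr : `|r / 2| = r / 2 by rewrite gtr0_norm// divr_gt0.
  have nr' : `|- (r / 2)| = r / 2 by rewrite normrN nr.
  have n0 : `|0 : R| <= r / 2 by rewrite normr0 divr_ge0// ltW.
  have [/sup + /sup +] := W1 _ _ nr n0; have [/sup + /sup +] := W1 _ _ nr' n0.
  rewrite /det2 /= => k1 k2 k3 k4; exact: cross_bound.
have [v1 v2'] := vb; have [c1 c2] := HC s x.
have E : det2 (bd s) v = 2 + ((ex s - ex x) * v.2 - (ey s - ey x) * v.1).
  by rewrite -v2 /det2 /=; ring.
have n1 : `|(ex s - ex x) * v.2| <= C * `|s - x| * (4 / r) by rewrite normrM ler_pM.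
have n2 : `|(ey s - ey x) * v.1| <= C * `|s - x| * (4 / r) by rewrite normrM ler_pM.
have sxE : `|s - x| = x - s by rewrite distrC gtr0_norm// subr_gt0.
have k : 8 * C / r * (2 * (x - s)) = 4 * (C * `|s - x| * (4 / r)) by rewrite sxE; field; rewrite gt_eqF.
have k0 : 0 <= C * `|s - x| * (4 / r) by rewrite !mulr_ge0// ?invr_ge0 ltW.
rewrite E k; move: n1 n2; rewrite !ler_norml => /andP[n1 _] /andP[_ n2]; lra.
Qed.

End flow_area.

(** * Chords of one plane and their asymptotics for short and long arcs *)

Section plane_chords.
Context {R : realType}.
Variables (W : set (R * R)) (P : R) (ex ey th rho : R -> R).
Hypotheses (cW : compact W) (sW : segment_closed W) (nW : nbhs (0 : R * R) W).
Hypothesis bf : boundary_flow W P ex ey th rho.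
Let bd t : R * R := (ex t, ey t).
Notation height := (flow_height ex ey).

(* [g x] is the inverse of the length of the chord from [u x] to [u x + x],
   measured in multiples of [i a]; the degenerate case [a = 0] has [g = 0]. *)
Record plane_chords (a : R * R) (top bot : R) (u g : R -> R) : Prop := {
  chords_ge0 : forall x, 0 <= g x ;
  chords_gt0 : a != 0 -> forall x, 0 < x < P -> 0 < g x ;
  chords_x : forall x, 0 < x < P -> g x * (ex (u x + x) - ex (u x)) = - a.2 ;
  chords_y : forall x, 0 < x < P -> g x * (ey (u x + x) - ey (u x)) = a.1 ;
  chords_above : forall x t, 0 < x < P -> u x <= t <= u x + x -> height a (u x) <= height a t ;
  chords_below : forall x t, 0 < x < P -> u x + x <= t <= u x + P -> height a t <= height a (u x) ;
  chords_continuous : forall x, 0 < x < P ->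
    {for x, continuous g} /\ {for x, continuous (fun x => height a (u x))} ;
  chords_bounds : [/\ 0 <= top, 0 <= bot &
    forall p, W p -> - bot <= a.1 * p.1 + a.2 * p.2 <= top] ;
  chords_top : forall c, 0 < c -> c < 1 -> exists2 d, 0 < d & forall x, 0 < x < P -> x < d ->
    c * (2 * x * g x) <= height a (u x) /\ c * top <= 2 * x * g x ;
  chords_bot : forall c, 0 < c -> c < 1 -> exists2 d, 0 < d & forall x, 0 < x < P -> P - x < d ->
    c * (2 * (P - x) * g x) <= - height a (u x) /\ c * bot <= 2 * (P - x) * g x }.

Lemma lipschitz_continuous_at (f : R -> R) C x : 0 < C -> 0 < x < P ->
  (forall y z, 0 < y < P -> 0 < z < P -> `|f y - f z| <= C * `|y - z|) ->
  {for x, continuous f}.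
Proof.
move=> C0 xP H; apply/cvgrPdist_lt => e e0; near=> y.
apply: (@le_lt_trans _ _ (C * `|x - y|)).
  apply: H => //; have : y \in `]0, P[ by near: y; apply: near_in_itvoo; rewrite in_itv.
  by rewrite in_itv.
rewrite -ltr_pdivlMl// mulrC.
by near: y; apply: cvgr_dist_lt; [exact: cvg_id|rewrite divr_gt0].
Unshelve. all: by end_near. Qed.

Lemma plane_chords0 : plane_chords 0 0 0 (fun=> 0) (fun=> 0).
Proof.
split => //=.
- by rewrite eqxx.
- by move=> x _; rewrite mul0r oppr0.
- by move=> x _; rewrite mul0r.
- by move=> x t _ _; rewrite /flow_height /= !mul0r.
- by move=> x t _ _; rewrite /flow_height /= !mul0r.
- by move=> x _; split; exact: cvg_cst.
- by split => // p _; rewrite !mul0r addr0 oppr0 lexx.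
- by move=> c _ _; exists 1 => // x _ _; rewrite /flow_height /= !mulr0 !mul0r addr0.
- by move=> c _ _; exists 1 => // x _ _; rewrite /flow_height /= !mulr0 !mul0r addr0 oppr0.
Qed.

(** For small [x] the height times the chord length is a determinant between [c * (2 * x)] and
    [2 * x], and the height is at least [c] times its maximum [top]; the two estimates of
    [chords_top] follow by dividing by the length. Those of [chords_bot] come from the complementary
    arc in the same way. *)
Lemma plane_chords_exist a : exists top bot u g, plane_chords a top bot u g.
Proof.
have [->|a0] := eqVneq a 0; first by exists 0, 0, (fun=> 0), (fun=> 0); exact: plane_chords0.
have [tl [tr [u cf]]] := chord_family_exists sW nW bf a0.
have E := chord_extrema cf; have pos := extrema_pos E; have neg := extrema_neg E.
pose l := chord_length ex ey a u.
(* The value 0 outside [0 < x < P] makes [g] nonnegative without a condition on [x]. *)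
pose g x := if 0 < x < P then (l x)^-1 else 0.
have gE x : 0 < x < P -> g x = (l x)^-1 by rewrite /g => ->.
have l0 x : 0 < x < P -> 0 < l x by exact: (chord_length_gt0 sW nW bf cf).
have ln x : 0 < x < P -> l x != 0 by move=> /l0 /lt0r_neq0.
have [C C0 HC] := height_lipschitz bf a.
have [K K0 HK] := flow_det_bounds cW sW nW bf.
have P0 := flow_period_gt0 bf.
have ulip y z : 0 < y < P -> 0 < z < P -> `|u y - u z| <= `|y - z| /\
    `|u y + y - (u z + z)| <= `|y - z|.
  wlog yz : y z / y <= z => [H|] yP zP.
    by case: (leP y z) => [|/ltW] h; [|rewrite distrC (distrC y) (distrC (u y + y))]; exact: H.
  have := chord_mono cf (_ : 0 < y) yz (_ : z < P).
  case/andP: yP => -> _; case/andP: zP => _ -> => /(_ isT isT)/andP[h1 h2].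
  by rewrite (distrC y) (ger0_norm (_ : 0 <= z - y)) ?subr_ge0// !ler_norml; split; apply/andP; split; lra.
have pE p : W p -> height a tl <= a.1 * p.1 + a.2 * p.2 <= height a tr.
  move=> /(gauge_le1 cW sW nW) p1; have g0 := gauge_ge0 nW p.
  have [t tE] := flow_polar sW nW bf p.
  have -> : a.1 * p.1 + a.2 * p.2 = gauge W p * height a t.
    by rewrite {1 2}tE /flow_height /= /GRing.scale /=; ring.
  have := ler_wpM2l g0 (extrema_min E t); have := ler_wpM2l g0 (extrema_max E t).
  have : 0 <= (1 - gauge W p) * height a tr by rewrite mulr_ge0 ?subr_ge0// ltW.
  have : 0 <= (1 - gauge W p) * - height a tl by rewrite mulr_ge0 ?subr_ge0// ?oppr_ge0 ltW.
  by move=> k1 k2 k3 k4; apply/andP; split; lra.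
exists (height a tr), (- height a tl), u, g; split.
- by move=> x; rewrite /g; case: ifP => // /l0 /ltW; rewrite invr_ge0.
- by move=> _ x xP; rewrite gE// invr_gt0 l0.
- move=> x xP; rewrite (chord_x cf xP) gE// -/l.
  by rewrite mulNr mulrN mulKf// ln.
- by move=> x xP; rewrite (chord_y cf xP) gE// -/l mulKf// ln.
- by move=> x t xP; exact: (chord_above cf).
- by move=> x t xP; exact: (chord_below bf cf).
- move=> x xP; split; last first.
    apply: (lipschitz_continuous_at C0 xP) => y z yP zP.
    by apply: le_trans (HC _ _) _; rewrite ler_pM2l//; have [] := ulip y z yP zP.
  have cl : {for x, continuous l}.
    have [B B0 HB] := height_lipschitz bf (- a.2, a.1).
    have N := chord_normal_gt0 cf.
    have lE y : l y = (height (- a.2, a.1) (u y + y) - height (- a.2, a.1) (u y)) / (a.1 ^+ 2 + a.2 ^+ 2).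
      by rewrite /l /chord_length /flow_height /=; congr (_ / _); ring.
    apply: (@lipschitz_continuous_at l (2 * B / (a.1 ^+ 2 + a.2 ^+ 2)) x) => //.
      by rewrite divr_gt0// mulr_gt0.
    move=> y z yP zP; rewrite !lE -mulrBl normrM [X in _ * X]gtr0_norm ?invr_gt0//.
    rewrite mulrAC ler_pM2r ?invr_gt0//.
    have [u1 u2] := ulip y z yP zP.
    have h1 := HB (u y + y) (u z + z); have h2 := HB (u y) (u z).
    have k1 := ler_wpM2l (ltW B0) u1; have k2 := ler_wpM2l (ltW B0) u2.
    have abcd (p q r s : R) : p - q - (r - s) = (p - r) - (q - s) by ring.
    rewrite abcd; apply: le_trans (ler_normB _ _) _; lra.
  have nl := ln x xP.
  apply: (@cvg_trans _ ((fun y => (l y)^-1) @ x)); last first.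
    by rewrite gE//; exact: (cvgV nl cl).
  apply: near_eq_cvg; near=> y; rewrite gE//.
  have : y \in `]0, P[ by near: y; apply: near_in_itvoo; rewrite in_itv.
  by rewrite in_itv.
- by split; [exact: ltW|rewrite oppr_ge0 ltW|move=> p /pE; rewrite opprK].
- move=> c c0 c1; pose d := Num.min ((1 - c) * 2 / K) ((1 - c) * height a tr / C).
  exists d; first by rewrite lt_min !divr_gt0// ?mulr_gt0// subr_gt0.
  move=> x xP; rewrite lt_min !ltr_pdivlMr// => /andP[xK xC]; rewrite gE//.
  have lx := l0 x xP; have /andP[x0 xP'] := xP.
  have D := chord_det cf xP; rewrite -/l in D.
  have /andP[] := HK (u x) (u x + x) ltac:(lra); rewrite D addrAC subrr add0r => b1 b2.
  have [h1 h2] : c * (2 * x) <= height a (u x) * l x /\ height a (u x) * l x <= 2 * x.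
    split => //; apply: le_trans b1.
    have : 0 <= (2 * (1 - c) - x * K) * x by rewrite mulr_ge0 ?(ltW x0)//; lra.
    lra.
  rewrite mulrA !ler_pdivrMr// ler_pdivlMr//; split=> //.
  apply: le_trans h2; rewrite ler_pM2r//.
  have := HC (u x) tr; have := ler_norm (height a tr - height a (u x)); rewrite distrC.
  have /andP[r1 r2] := chord_left cf xP; have /andP[r3 r4] := chord_right cf xP.
  have : `|u x - tr| <= x by rewrite ler_norml; apply/andP; split; lra.
  move=> /(ler_wpM2l (ltW C0)); lra.
- move=> c c0 c1; pose d := Num.min ((1 - c) * 2 / K) ((1 - c) * - height a tl / C).
  exists d; first by rewrite lt_min !divr_gt0// ?mulr_gt0// ?subr_gt0// oppr_gt0.
  move=> x xP; rewrite lt_min !ltr_pdivlMr// => /andP[xK xC]; rewrite gE//.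
  have lx := l0 x xP; have /andP[x0 xP'] := xP.
  have D := chord_det cf xP; rewrite -/l in D.
  have D' : det2 (bd (u x + x)) (bd (u x + P)) = - (height a (u x) * l x).
    by rewrite -D /det2 /bd /= (flow_xP bf) (flow_yP bf); ring.
  have /andP[] := HK (u x + x) (u x + P) ltac:(lra).
  rewrite D' (_ : u x + P - (u x + x) = P - x); last ring.
  move=> b1 b2; have s0 : 0 < P - x by rewrite subr_gt0.
  have [h1 h2] : c * (2 * (P - x)) <= - height a (u x) * l x /\ - height a (u x) * l x <= 2 * (P - x).
    rewrite mulNr; split => //; apply: le_trans b1.
    have : 0 <= (2 * (1 - c) - (P - x) * K) * (P - x) by rewrite mulr_ge0 ?(ltW s0)//; lra.
    lra.
  rewrite mulrA !ler_pdivrMr// ler_pdivlMr//; split=> //.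
  apply: le_trans h2; rewrite ler_pM2r//.
  have := HC (u x + P) (tl + P); have := ler_norm (height a (u x + P) - height a (tl + P)).
  rewrite !(heightP bf).
  have /andP[r1 r2] := chord_left cf xP; have /andP[r3 r4] := chord_right cf xP.
  have : `|u x + P - (tl + P)| <= P - x by rewrite ler_norml; apply/andP; split; lra.
  move=> /(ler_wpM2l (ltW C0)); lra.
Unshelve. all: by end_near. Qed.

End plane_chords.

Section sums.
Context {R : realType} {n : nat}.
Implicit Types f g h r : 'I_n -> R.

Lemma sum_le_sqrt f r : \sum_i r i ^+ 2 = 1 -> \sum_i r i * f i <= Num.sqrt (\sum_i f i ^+ 2).
Proof.
move=> r1; have expand x : \sum_i (f i - x * r i) ^+ 2 =
    \sum_i f i ^+ 2 - 2 * x * (\sum_i r i * f i) + x ^+ 2 * \sum_i r i ^+ 2.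
  rewrite !mulr_sumr -sumrB -big_split /=.
  by apply: eq_bigr => i _; ring.
pose S := \sum_i r i * f i; apply: le_trans (ler_norm _) _.
rewrite -sqrtr_sqr ler_wsqrtr//.
have : 0 <= \sum_i (f i - S * r i) ^+ 2 by apply: sumr_ge0 => i _; exact: sqr_ge0.
by rewrite expand r1 mulr1 -/S; have := expr2 S; lra.
Qed.

(** The first hypothesis on [g] bounds the quotient below by c y |g|, the second bounds y |g| below
    by c |f|. For [c] near 1 the weights [g i] divided by |g| thus almost realise the maximum |f| of
    the level. *)
Lemma ratio_ge f g h c y : 0 < c -> 0 < y -> (forall i, 0 <= g i) -> (forall i, 0 <= f i) ->
  (forall i, c * (y * g i) <= h i) -> (forall i, c * f i <= y * g i) ->
  0 < \sum_i g i ^+ 2 ->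
  c ^+ 2 * Num.sqrt (\sum_i f i ^+ 2) <= (\sum_i g i * h i) / Num.sqrt (\sum_i g i ^+ 2).
Proof.
move=> c0 y0 g0 f0 hg gf G0; set G := \sum_i g i ^+ 2 in G0 *.
have N0 : 0 < Num.sqrt G by rewrite sqrtr_gt0.
have yN : c * Num.sqrt (\sum_i f i ^+ 2) <= y * Num.sqrt G.
  have sE k s : 0 < k -> k * Num.sqrt s = Num.sqrt (k ^+ 2 * s).
    by move=> k0; rewrite sqrtrM ?sqr_ge0// sqrtr_sqr gtr0_norm.
  rewrite !sE// ler_wsqrtr// /G !mulr_sumr; apply: ler_sum => i _.
  rewrite -!exprMn lerXn2r ?nnegrE ?gf// mulr_ge0 ?g0 ?f0 ?(ltW c0) ?(ltW y0)//.
rewrite expr2 -mulrA; apply: le_trans (ler_wpM2l (ltW c0) yN) _.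
rewrite ler_pdivlMr// -!mulrA -expr2 sqr_sqrtr ?(ltW G0)// /G !mulr_sumr.
apply: ler_sum => i _; rewrite (_ : c * (y * g i ^+ 2) = g i * (c * (y * g i))); last by ring.
by rewrite ler_wpM2l.
Qed.

Lemma finite_threshold (Q : 'I_n -> R -> Prop) :
  (forall i, exists2 d, 0 < d & forall x, x < d -> Q i x) ->
  exists2 d, 0 < d & forall i x, x < d -> Q i x.
Proof.
move=> H; have /choice[d Hd] : forall i, exists d, 0 < d /\ forall x, x < d -> Q i x.
  by move=> i; have [e] := H i; exists e.
have S0 : 0 <= \sum_i (d i)^-1 by apply: sumr_ge0 => i _; rewrite invr_ge0 ltW//; have [] := Hd i.
(* A positive number below every [d i], defined also for an empty index set. *)
exists (1 + \sum_i (d i)^-1)^-1; first by rewrite invr_gt0; lra.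
move=> i x xd; have [d0] := Hd i; apply; apply: lt_le_trans xd _.
rewrite -[leRHS]invrK lef_pV2 ?posrE ?invr_gt0//; last lra.
rewrite (bigD1 i)//= addrCA lerDl addr_ge0//.
by apply: sumr_ge0 => j _; rewrite invr_ge0 ltW//; have [] := Hd j.
Qed.

Lemma square_factor (b M : R) : 0 <= M -> b < M -> exists c, [/\ 0 < c, c < 1 & b < c ^+ 2 * M].
Proof.
move=> M0 bM; have [b0|b0] := ltP b 0.
  by exists (1 / 2); split; [lra|lra|apply: lt_le_trans b0 _; rewrite mulr_ge0// sqr_ge0].
have M1 : 0 < M by lra.
pose e := (M - b) / (2 * M).
have e0 : 0 < e by rewrite divr_gt0 ?mulr_gt0// subr_gt0.
have e1 : e <= 1 / 2 by rewrite /e ler_pdivrMr ?mulr_gt0//; lra.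
have eM : 2 * e * M = M - b by rewrite /e; field; rewrite gt_eqF.
exists (1 - e); split; [lra|lra|].
have -> : (1 - e) ^+ 2 * M = M - 2 * e * M + e ^+ 2 * M by ring.
have : 0 < e ^+ 2 * M by rewrite mulr_gt0// exprn_gt0.
rewrite eM; lra.
Qed.

End sums.

(** * Chords in all planes with endpoints on a given hyperplane *)

Section configuration.
Context {R : realType} {n : nat}.
Local Notation M := 'M[R]_(n, 2).
Variables (W : 'I_n -> set (R * R)) (P : R) (ex ey th rho : 'I_n -> R -> R).
Hypotheses (cW : forall i, compact (W i)) (sW : forall i, segment_closed (W i)).
Hypothesis nW : forall i, nbhs (0 : R * R) (W i).
Hypothesis bf : forall i, boundary_flow (W i) P (ex i) (ey i) (th i) (rho i).
Local Notation K := (symplectic_2product W).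
Local Notation height i a := (flow_height (ex i) (ey i) (plane i a)).

(** One duration [tau] serves all planes: [config_x] and [config_y] say that the endpoints of the
    product arc differ by [m] times i a, and [config_level] puts them on the hyperplane. *)
Record chord_configuration (a : M) (b tau m : R) (r u : 'I_n -> R) : Prop := {
  config_tau : 0 < tau < P ;
  config_m : 0 < m ;
  config_r0 : forall i, 0 <= r i ;
  config_r1 : \sum_i r i ^+ 2 = 1 ;
  config_x : forall i, r i * (ex i (u i + tau) - ex i (u i)) = - m * a i 1 ;
  config_y : forall i, r i * (ey i (u i + tau) - ey i (u i)) = m * a i 0 ;
  config_level : \sum_i r i * height i a (u i) = b ;
  config_above : forall i t, u i <= t <= u i + tau -> height i a (u i) <= height i a t ;
  config_below : forall i t, u i + tau <= t <= u i + P -> height i a t <= height i a (u i) }.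

(** [F x] is the level of the endpoints for duration [x] when the weights are the normalised
    [g i x]. It exceeds [b] for some small [x] and is below [b] for some [x] near [P], so continuity
    yields a duration with level exactly [b]. *)
Lemma chord_configuration_exists (a : M) (b : R) : a != 0 ->
  (exists2 x, K x & dot a x < b) -> (exists2 x, K x & b < dot a x) ->
  exists tau m r u, chord_configuration a b tau m r u.
Proof.
move=> a0 [z1 Kz1 z1b] [z2 Kz2 z2b].
have P0 : 0 < P.
  have [i _] : exists i, plane i a != 0.
    by apply: contrapT => /forallNP H; move/eqP: a0; apply; apply: matrix2P => i;
      have /negP := H i; rewrite negbK => /eqP ->; rewrite /plane !mxE.
  exact: (flow_period_gt0 (bf i)).
have /choice[q Hq] : forall i, exists q : R * R * (R -> R) * (R -> R),
    plane_chords (W i) P (ex i) (ey i) (plane i a) q.1.1.1 q.1.1.2 q.1.2 q.2.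
  move=> i; have [top [bot [u [g H]]]] := plane_chords_exist (@cW i) (@sW i) (@nW i) (bf i) (plane i a).
  by exists (top, bot, u, g).
pose top i := (q i).1.1.1; pose bot i := (q i).1.1.2; pose u i := (q i).1.2; pose g i := (q i).2.
have {}Hq i : plane_chords (W i) P (ex i) (ey i) (plane i a) (top i) (bot i) (u i) (g i) by exact: Hq.
have g0 i x : 0 <= g i x by exact: (chords_ge0 (Hq i)).
pose G x := \sum_i g i x ^+ 2.
have G0 x : 0 < x < P -> 0 < G x.
  move=> xP; have [i ai] : exists i, plane i a != 0.
    by apply: contrapT => /forallNP H; move/eqP: a0; apply; apply: matrix2P => i;
      have /negP := H i; rewrite negbK => /eqP ->; rewrite /plane !mxE.
  rewrite /G (bigD1 i)//= ltr_pwDl//; last by apply: sumr_ge0 => j _; exact: sqr_ge0.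
  by rewrite exprn_gt0// (chords_gt0 (Hq i)).
pose F x := (\sum_i g i x * height i a (u i x)) / Num.sqrt (G x).
have dotE (z : M) (s : 'I_n -> R) (w : 'I_n -> R * R) : (forall i, plane i z = s i *: w i) ->
    dot a z = \sum_i s i * ((plane i a).1 * (w i).1 + (plane i a).2 * (w i).2).
  move=> zE; apply: eq_bigr => i _; have := zE i; rewrite /plane => -[-> ->] /=.
  by rewrite /GRing.scale /=; ring.
have Kw z : K z -> exists s w, [/\ forall i, 0 <= s i, \sum_i s i ^+ 2 = 1,
    forall i, W i (w i) & forall i, plane i z = s i *: w i].
  move=> /symplectic_2productP[s [s0 s1 H]].
  have /choice[w Hw] : forall i, exists w, W i w /\ plane i z = s i *: w.
    by move=> i; have [w] := H i; exists w.
  by exists s, w; split => // i; have [] := Hw i.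
have bnd i := chords_bounds (Hq i).
(* Cauchy-Schwarz bounds [dot a] on [K] by the norm of the maximal heights, so [b] lies strictly
   below that norm. *)
have bT : b < Num.sqrt (\sum_i top i ^+ 2).
  apply: lt_le_trans z2b _; have [s [w [s0 s1 Ww zE]]] := Kw _ Kz2.
  rewrite (dotE _ _ _ zE); apply: le_trans (sum_le_sqrt _ s1); apply: ler_sum => i _.
  by rewrite ler_wpM2l//; have [_ _ /(_ _ (Ww i))/andP[_]] := bnd i.
have bB : - b < Num.sqrt (\sum_i bot i ^+ 2).
  rewrite ltrNl; apply: le_lt_trans z1b; have [s [w [s0 s1 Ww zE]]] := Kw _ Kz1.
  rewrite (dotE _ _ _ zE) lerNl -sumrN; apply: le_trans (sum_le_sqrt _ s1); apply: ler_sum => i _.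
  by rewrite -mulrN ler_wpM2l// lerNl; have [_ _ /(_ _ (Ww i))/andP[]] := bnd i.
have [x1 x1P Fx1] : exists2 x, 0 < x < P & b < F x.
  have [c [c0 c1 cb]] := square_factor (sqrtr_ge0 _) bT.
  have [d d0 Hd] := finite_threshold (fun i => let: ex_intro2 d d0 H := chords_top (Hq i) c0 c1 in
    ex_intro2 _ _ d d0 (fun x xd xP => H x xP xd)).
  pose x := Num.min d P / 2.
  have m0 : 0 < Num.min d P by rewrite lt_min d0.
  have /andP[m1 m2] : (Num.min d P <= d) && (Num.min d P <= P) by rewrite !ge_min !lexx orbT.
  have xP : 0 < x < P by rewrite /x; apply/andP; split; lra.
  exists x => //; apply: lt_le_trans cb _.
  have xd : x < d by rewrite /x; lra.
  apply: (@ratio_ge _ _ _ _ _ c (2 * x)) => //.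
  - by case/andP: xP => x0 _; rewrite mulr_gt0.
  - by move=> i; have [] := bnd i.
  - by move=> i; have [] := Hd i x xd xP.
  - by move=> i; have [] := Hd i x xd xP.
  - exact: G0.
have [x2 x2P Fx2] : exists2 x, 0 < x < P & F x < b.
  have [c [c0 c1 cb]] := square_factor (sqrtr_ge0 _) bB.
  have [|d d0 Hd] := @finite_threshold R n (fun i y => 0 < y < P ->
      c * (2 * y * g i (P - y)) <= - height i a (u i (P - y)) /\ c * bot i <= 2 * y * g i (P - y)).
    move=> i; have [d d0 H] := chords_bot (Hq i) c0 c1; exists d => // y yd yP.
    have := H (P - y); rewrite opprB addrCA subrr addr0; apply => //.
    by apply/andP; split; lra.
  pose y := Num.min d P / 2.
  have m0 : 0 < Num.min d P by rewrite lt_min d0.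
  have /andP[m1 m2] : (Num.min d P <= d) && (Num.min d P <= P) by rewrite !ge_min !lexx orbT.
  have yP : 0 < y < P by rewrite /y; apply/andP; split; lra.
  have yd : y < d by rewrite /y; lra.
  have xP : 0 < P - y < P by apply/andP; split; lra.
  exists (P - y) => //; rewrite -ltrN2; apply: lt_le_trans cb _.
  have -> : - F (P - y) =
      (\sum_i g i (P - y) * - height i a (u i (P - y))) / Num.sqrt (G (P - y)).
    by rewrite /F -mulNr -sumrN; congr (_ / _); apply: eq_bigr => i _; rewrite mulrN.
  apply: (@ratio_ge _ _ _ _ _ c (2 * y)) => //.
  - by case/andP: yP => y0 _; rewrite mulr_gt0.
  - by move=> i; have [] := bnd i.
  - by move=> i; have [] := Hd i y yd yP.
  - by move=> i; have [] := Hd i y yd yP.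
  - exact: G0.
have cF x : 0 < x < P -> {for x, continuous F}.
  move=> xP; have cg i := (chords_continuous (Hq i) xP).1.
  have ch i := (chords_continuous (Hq i) xP).2.
  apply: cvgM.
    by apply: cvg_big => [|i _]; [exact: add_continuous|apply: cvgM; [exact: cg|exact: ch]].
  apply: cvgV; first by rewrite gt_eqF// sqrtr_gt0 G0.
  apply: (@continuous_comp _ _ _ G Num.sqrt); last exact: sqrt_continuous.
  by apply: cvg_big => [|i _]; [exact: add_continuous|apply: cvgM; exact: cg].
have [x xP Fx] : exists2 x, 0 < x < P & F x = b.
  case/andP: x1P => x10 x1P; case/andP: x2P => x20 x2P.
  have [xx|/ltW xx] := leP x1 x2.
  - have [||x] := @IVT R F x1 x2 b xx.
    + apply: continuous_in_subspaceT => y /set_mem; rewrite /= in_itv /= => /andP[y1 y2].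
      by apply: cF; rewrite (lt_le_trans x10 y1) (le_lt_trans y2 x2P).
    + by rewrite ge_min le_max (ltW Fx1) (ltW Fx2) orbT.
    + rewrite in_itv /= => /andP[y1 y2]; exists x => //.
      by rewrite (lt_le_trans x10 y1) (le_lt_trans y2 x2P).
  - have [||x] := @IVT R F x2 x1 b xx.
    + apply: continuous_in_subspaceT => y /set_mem; rewrite /= in_itv /= => /andP[y1 y2].
      by apply: cF; rewrite (lt_le_trans x20 y1) (le_lt_trans y2 x1P).
    + by rewrite ge_min le_max (ltW Fx1) (ltW Fx2) orbT.
    + rewrite in_itv /= => /andP[y1 y2]; exists x => //.
      by rewrite (lt_le_trans x20 y1) (le_lt_trans y2 x1P).
have N0 : 0 < Num.sqrt (G x) by rewrite sqrtr_gt0 G0.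
exists x, (Num.sqrt (G x))^-1, (fun i => g i x / Num.sqrt (G x)), (fun i => u i x); split => //.
- by rewrite invr_gt0.
- by move=> i; rewrite divr_ge0// ltW.
- under eq_bigr do rewrite expr_div_n.
  by rewrite -mulr_suml sqr_sqrtr ?ltW ?G0// mulfV// gt_eqF// G0.
- by move=> i; rewrite mulrAC (chords_x (Hq i) xP) mulrC mulrN mulNr.
- by move=> i; rewrite mulrAC (chords_y (Hq i) xP) mulrC.
- rewrite -Fx /F mulr_suml; apply: eq_bigr => i _; rewrite mulrAC; by [].
- by move=> i t; exact: (chords_above (Hq i)).
- by move=> i t; exact: (chords_below (Hq i)).
Qed.

End configuration.

(** * The symplectic 2-product as a convex body *)

Section matrix_compact.
Context {R : realType} {m n : nat}.

Lemma vec_mx_norm (v : 'rV[R]_(m * n)) : `|vec_mx v| <= `|v|.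
Proof. by apply: matrix_norm_le => // i j; rewrite mxE; exact: entry_norm. Qed.

Lemma bounded_closed_matrix_compact (A : set 'M[R]_(m, n)) C :
  (forall z, A z -> `|z| <= C) -> closed A -> compact A.
Proof.
move=> AC clA.
have cv : continuous (@vec_mx R m n).
  apply: (lipschitz_continuous ltr01) => x y.
  by rewrite -raddfB mul1r; exact: vec_mx_norm.
rewrite (_ : A = @vec_mx R m n @` (@vec_mx R m n @^-1` A)).
  apply: continuous_compact; first exact: continuous_subspaceT.
  apply: bounded_closed_compact; last by apply: closed_comp => // x _; exact: cv.
  exists C; split; first exact: num_real.
  move=> M CM v /= /AC vC; apply: le_trans (ltW CM); apply: le_trans vC.
  apply: matrix_norm_le => // i k; rewrite ord1; case/mxvec_indexP: k => i' j.
  by rewrite -[v in leLHS]vec_mxK mxvecE; exact: entry_norm.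
apply/seteqP; split=> [z Az|z [v /= Av <-]//].
by exists (mxvec z) => /=; rewrite mxvecK.
Qed.

End matrix_compact.

Section product_body.
Context {R : realType} {n : nat}.
Local Notation M := 'M[R]_(n, 2).
Variables (W : 'I_n -> set (R * R)).
Hypotheses (n0 : (0 < n)%N).
Hypotheses (cW : forall i, compact (W i)) (sW : forall i, segment_closed (W i)).
Hypothesis nW : forall i, nbhs (0 : R * R) (W i).
Local Notation K := (symplectic_2product W).

Definition square_gauge (z : M) := \sum_i gauge (W i) (plane i z) ^+ 2.

Lemma plane_norm i (z : M) : `|plane i z| <= `|z|.
Proof. by rewrite pair_norm_le !entry_norm. Qed.

(** The squared weights must sum to exactly 1, while the squared gauges may sum to less; the slack
    is added in the plane [i0]. A plane of weight zero has gauge zero, so its component vanishes. *)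
Lemma product_gauge z : K z <-> square_gauge z <= 1.
Proof.
split=> [/symplectic_2productP[r [r0 r1 H]]|z1].
  rewrite -r1; apply: ler_sum => i _; rewrite lerXn2r ?nnegrE ?(gauge_ge0 (@nW i))//.
  have [w /(gauge_le1 (@cW i) (@sW i) (@nW i)) w1 ->] := H i.
  have := r0 i; rewrite le_eqVlt => /predU1P[<-|ri]; first by rewrite scale0r (gauge0 (@nW i)).
  by rewrite (gauge_scale (@sW i) (@nW i))// ler_piMr// ltW.
apply/symplectic_2productP; pose s i := gauge (W i) (plane i z).
have s0 i : 0 <= s i by exact: (gauge_ge0 (@nW i)).
pose i0 : 'I_n := Ordinal n0.
pose r i := if i == i0 then Num.sqrt (s i0 ^+ 2 + (1 - square_gauge z)) else s i.
have sr i : s i <= r i.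
  rewrite /r; case: eqP => // ->; rewrite -[leLHS](ger0_norm (s0 _)) -sqrtr_sqr ler_wsqrtr//.
  by rewrite lerDl subr_ge0.
have r0 i : 0 <= r i by exact: le_trans (s0 i) (sr i).
exists r; split => //.
  rewrite (bigD1 i0)//= (eq_bigr (fun i => s i ^+ 2)); last by move=> i /negPf h; rewrite /r h.
  rewrite {1}/r eqxx sqr_sqrtr; last by rewrite addr_ge0 ?sqr_ge0// subr_ge0.
  by rewrite /square_gauge (bigD1 i0)//= -/(s i0); rewrite -/s; ring.
move=> i; have := r0 i; rewrite le_eqVlt => /predU1P[ri|ri].
  have si : s i = 0 by apply/le_anti; rewrite s0 ri sr.
  exists 0; first exact: nbhs_singleton.
  have [c [C [c0 C0 /(_ (plane i z))/andP[h _]]]] := gauge_bounds (@cW i) (@nW i).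
  rewrite scaler0; apply/eqP; rewrite -normr_le0 -(pmulr_rle0 _ c0).
  by apply: le_trans h _; rewrite -/(s i) si.
exists ((r i)^-1 *: plane i z); last by rewrite scalerA mulfV ?scale1r// gt_eqF.
apply/(gauge_le1 (@cW i) (@sW i) (@nW i)); rewrite (gauge_scale (@sW i) (@nW i)) ?invr_gt0//.
by rewrite mulrC ler_pdivrMr// mul1r sr.
Qed.

Lemma square_gauge_continuous : continuous square_gauge.
Proof.
apply: continuous_big => [|i _]; first exact: add_continuous.
have cg : continuous (fun z : M => gauge (W i) (plane i z)).
  have [C C0 HC] := gauge_lipschitz (@cW i) (@sW i) (@nW i).
  apply: (lipschitz_continuous C0) => x y; apply: le_trans (HC _ _) _.
  have -> : plane i x - plane i y = plane i (x - y) by rewrite /plane !mxE.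
  by rewrite ler_wpM2l ?plane_norm// ltW.
by move=> z; exact: (continuousM (cg z) (cg z)).
Qed.

Lemma product_interior z : square_gauge z < 1 -> K° z.
Proof.
move=> z1; have : nbhs (square_gauge z) [set x | x < 1].
  by apply: open_nbhs_nbhs; split => //; exact: open_lt.
move=> /square_gauge_continuous H; apply: (@filterS _ (nbhs z) _ _ _ _ H).
by move=> y /= /ltW /product_gauge.
Qed.

Lemma product_segment_closed : segment_closed K.
Proof.
move=> x y t /product_gauge x1 /product_gauge y1 /andP[t0 t1]; apply/product_gauge.
apply: (@le_trans _ _ (t * square_gauge x + (1 - t) * square_gauge y)); last first.
  have := ler_wpM2l t0 x1; have := @ler_wpM2l _ (1 - t) _ _ _ y1; rewrite subr_ge0 => /(_ t1); lra.
rewrite /square_gauge !mulr_sumr -big_split /=; apply: ler_sum => i _.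
rewrite planeD !planeZ.
have t1' : 0 <= 1 - t by rewrite subr_ge0.
have := @gauge_conic _ _ (@sW i) (@nW i) t (1 - t) (plane i x) (plane i y) t0 t1'.
have := gauge_ge0 (@nW i) (t *: plane i x + (1 - t) *: plane i y).
set p := gauge _ _; set q := gauge _ _; set s := gauge _ _ => p0 h.
have h2 : p ^+ 2 <= (t * q + (1 - t) * s) ^+ 2 by rewrite lerXn2r// nnegrE// (le_trans p0).
apply: le_trans h2 _.
have : 0 <= t * (1 - t) * (q - s) ^+ 2 by rewrite mulr_ge0 ?sqr_ge0// mulr_ge0.
lra.
Qed.

Lemma square_gauge0 : square_gauge 0 = 0.
Proof.
rewrite /square_gauge big1// => i _; rewrite (_ : plane i 0 = 0) ?(gauge0 (@nW i)) ?expr0n//.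
by rewrite /plane !mxE.
Qed.

Lemma product_convex_body : convex_body K.
Proof.
split.
- have /choice[C HC] : forall i, exists C, forall v, W i v -> `|v| <= C.
    by move=> i; have [C] := body_bounded (@cW i) (@nW i); exists C.
  apply: (@bounded_closed_matrix_compact _ _ _ _ (\sum_i `|C i|)).
    move=> z /product_gauge z1; apply: matrix_norm_le; first by apply: sumr_ge0.
    have le i : `|plane i z| <= \sum_i `|C i|.
      apply: (@le_trans _ _ (C i)).
        apply: HC; apply/(gauge_le1 (@cW i) (@sW i) (@nW i)).
        rewrite -(@expr_le1 _ 2) ?(gauge_ge0 (@nW i))//; apply: le_trans z1.
        by rewrite /square_gauge (bigD1 i)//= lerDl; apply: sumr_ge0 => j _; exact: sqr_ge0.
      by rewrite (bigD1 i)//=; apply: le_trans (ler_norm _) _; rewrite lerDl; apply: sumr_ge0.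
    move=> i j; move: (le i); rewrite pair_norm_le => /andP[h1 h2].
    by case: (ord2_cases j) => ->.
  rewrite (_ : K = square_gauge @^-1` [set x | x <= 1]).
    by apply: closed_comp => [z _|]; [exact: square_gauge_continuous|exact: closed_le].
  by apply/seteqP; split => z /product_gauge.
- by apply/convex_set_segment_closed; exact: product_segment_closed.
- by exists 0; apply: product_interior; rewrite square_gauge0.
Qed.

Lemma boundary_direction (A : set M) (z d : M) : A z ->
  (forall h : R, 0 < h -> ~ A (z + h *: d)) -> boundary A z.
Proof.
move=> Az H; split; first exact: subset_closure.
move=> /nbhs_ballP[e /= e0 He].
have D0 : 0 < `|d| + 1 by rewrite ltr_wpDl.
pose h := e / (`|d| + 1) / 2; have h0 : 0 < h by rewrite !divr_gt0.
apply: (H h h0); apply: He; rewrite -ball_normE /ball_ /= opprD addNKr normrN normrZ gtr0_norm//.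
have : h * (`|d| + 1) = e / 2 by rewrite /h; field; rewrite gt_eqF.
lra.
Qed.

Lemma square_gaugeZ c z : 0 < c -> square_gauge (c *: z) = c ^+ 2 * square_gauge z.
Proof.
move=> c0; rewrite /square_gauge mulr_sumr; apply: eq_bigr => i _.
by rewrite planeZ (gauge_scale (@sW i) (@nW i))// exprMn.
Qed.

Lemma product_outward z h : square_gauge z = 1 -> 0 < h -> ~ K (z + h *: z).
Proof.
move=> z1 h0 /product_gauge; rewrite -{1}[z]scale1r -scalerDl square_gaugeZ ?addr_gt0//.
rewrite z1 mulr1 leNgt => /negP; apply; have := exprn_gt0 2 h0.
have -> : (1 + h) ^+ 2 = 1 + 2 * h + h ^+ 2 by ring.
lra.
Qed.

End product_body.

(** * Cutting by a hyperplane through the interior *)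

Section halves.
Context {R : realType} {n : nat}.
Local Notation M := 'M[R]_(n, 2).

Lemma dot_bound (a z : M) : `|dot a z| <= (\sum_(i < n) (`|a i 0| + `|a i 1|)) * `|z|.
Proof.
apply: le_trans (ler_norm_sum _ _ _) _; rewrite mulr_suml; apply: ler_sum => i _.
apply: le_trans (ler_normD _ _) _.
by rewrite !normrM mulrDl lerD// ler_wpM2l// entry_norm.
Qed.

Lemma dotDr (a x y : M) : dot a (x + y) = dot a x + dot a y.
Proof. by rewrite -big_split /=; apply: eq_bigr => i _; rewrite !mxE; ring. Qed.

Lemma dotZr (a x : M) c : dot a (c *: x) = c * dot a x.
Proof. by rewrite mulr_sumr; apply: eq_bigr => i _; rewrite !mxE; ring. Qed.

Lemma dot_gt0 (a : M) : a != 0 -> 0 < dot a a.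
Proof.
move=> a0; have s i : 0 <= a i 0 * a i 0 + a i 1 * a i 1 by rewrite -!expr2 addr_ge0 ?sqr_ge0.
rewrite lt_neqAle sumr_ge0 ?andbT; last by move=> i _; exact: s.
apply: contra a0 => /eqP/esym/psumr_eq0P H; apply/eqP/matrix2P => i.
have /eqP := H (fun i _ => s i) i isT; rewrite -!expr2 paddr_eq0 ?sqr_ge0// !sqrf_eq0.
by rewrite /plane !mxE => /andP[/eqP -> /eqP ->].
Qed.

Lemma dot_continuous (a : M) : continuous (dot a).
Proof.
pose C := \sum_(i < n) (`|a i 0| + `|a i 1|) + 1.
have S0 : 0 <= \sum_(i < n) (`|a i 0| + `|a i 1|) by apply: sumr_ge0 => i _; rewrite addr_ge0.
have C0 : 0 < C by rewrite ltr_wpDl.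
apply: (lipschitz_continuous C0) => x y.
have -> : dot a x - dot a y = dot a (x - y) by rewrite dotDr -(scaleN1r y) dotZr mulN1r.
apply: le_trans (dot_bound _ _) _.
by rewrite ler_wpM2r// lerDl.
Qed.

Lemma cut_interior (K : set M) (a : M) (b : R) (z : M) : a != 0 -> K° z -> dot a z = b ->
  [/\ exists2 x, K x & dot a x < b, exists2 x, K x & b < dot a x,
    (K `&` [set x | dot a x <= b])° !=set0 & (K `&` [set x | b <= dot a x])° !=set0].
Proof.
move=> a0 Kz zb; have aa := dot_gt0 a0.
have : nbhs z K° by apply: nbhs_interior; exact: Kz.
move=> /nbhs_ballP[e /= e0 He].
have D0 : 0 < `|a| + 1 by rewrite ltr_wpDl.
pose h := e / (`|a| + 1) / 2; have h0 : 0 < h by rewrite !divr_gt0.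
have hh (c : R) : `|c| = 1 -> K° (z + (c * h) *: a).
  move=> c1; apply: He; rewrite -ball_normE /ball_ /= opprD addNKr normrN normrZ normrM c1 mul1r gtr0_norm//.
  have : h * (`|a| + 1) = e / 2 by rewrite /h; field; rewrite gt_eqF.
  lra.
have Kp := hh 1 ltac:(by rewrite normr1); have Km := hh (-1) ltac:(by rewrite normrN normr1).
have dp : b < dot a (z + (1 * h) *: a) by rewrite dotDr dotZr zb mul1r ltrDl mulr_gt0.
have dm : dot a (z + (-1 * h) *: a) < b.
  by rewrite dotDr dotZr zb mulN1r mulNr gtrBl mulr_gt0.
move: Kp Km dp dm; set zp := z + _; set zm := z + _ => Kp Km dp dm.
have : nbhs (dot a zp) [set x | b < x] by apply: open_nbhs_nbhs; split => //; exact: open_gt.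
have : nbhs (dot a zm) [set x | x < b] by apply: open_nbhs_nbhs; split => //; exact: open_lt.
move=> /dot_continuous Hm /dot_continuous Hp.
split.
- by exists zm; [exact: (interior_subset Km)|exact: dm].
- by exists zp; [exact: (interior_subset Kp)|exact: dp].
- exists zm; apply: filterI; first exact: Km.
  by apply: (@filterS _ (nbhs zm) _ _ _ _ Hm) => y /= /ltW.
- exists zp; apply: filterI; first exact: Kp.
  by apply: (@filterS _ (nbhs zp) _ _ _ _ Hp) => y /= /ltW.
Qed.

End halves.

(** * Closing up arcs into characteristics *)

Section loop.
Context {R : realType} {n : nat}.
Local Notation M := 'M[R]_(n, 2).
Notation mu := (@lebesgue_measure R).

(** That [x] maximises [omega0 _ w] means that [- mulI w] is an outer normal, and multiplication by
    i maps this normal to [w]. *)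
Lemma normal_cone_omega0 (A : set M) (x w : M) :
  (forall y, A y -> omega0 y w <= omega0 x w) -> (@mulI R n @` normal_cone A x) w.
Proof.
move=> H; exists (- mulI w).
  move=> y /H; rewrite -subr_le0; congr (_ <= _).
  rewrite /omega0 /dot -sumrB; apply: eq_bigr => i _.
  by rewrite !mxE /=; ring.
rewrite -[RHS]opprK -mulI_mulI; apply/matrix2P => i.
by rewrite /plane; congr pair; rewrite !mxE /= ?mxE /= ?opprK.
Qed.

Lemma derive_norm_le (f : R -> R) (x l C : R) : is_derive x 1 f l ->
  (forall h, `|f (x + h) - f x| <= C * `|h|) -> `|l| <= C.
Proof.
move=> /is_derive_epsP H HC; apply/ler_addgt0Pr => e e0.
have [d d0 Hd] := H e e0; pose h := d / 2.
have h0 : 0 < h by rewrite divr_gt0.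
have hn : `|h| = h by rewrite gtr0_norm.
have := Hd h; rewrite hn => /(_ ltac:(by rewrite /h; lra)) h1.
have := HC h; rewrite hn => h2.
have : `|l * h| <= (C + e) * h.
  have -> : l * h = (f (x + h) - f x) - (f (x + h) - f x - l * h) by ring.
  by apply: le_trans (ler_normB _ _) _; rewrite mulrDl lerD.
by rewrite normrM hn ler_pM2r.
Qed.

Lemma periodic_derive (V : normedModType R) (f : R -> V) (T : R) (k : int) (t : R) (l : V) :
  (forall t, f (t + T) = f t) -> is_derive t 1 f l -> is_derive (t + k%:~R * T) 1 f l.
Proof.
move=> per [df dl].
have E : (fun h : R => h^-1 *: ((f \o shift (t + k%:~R * T)) (h *: (1 : R)) - f (t + k%:~R * T))) =
    (fun h : R => h^-1 *: ((f \o shift t) (h *: (1 : R)) - f t)).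
  by apply/funext => h; rewrite /= addrA !periodic_int.
by split; [rewrite /derivable E|rewrite /derive E].
Qed.

Lemma periodic_lipschitz (V : normedModType R) (f : R -> V) (T C : R) : 0 < T ->
  (forall t, f (t + T) = f t) -> 0 <= C ->
  (forall x y, 0 <= x -> x <= y -> y <= T -> `|f y - f x| <= C * (y - x)) ->
  forall x y, `|f x - f y| <= C * `|x - y|.
Proof.
move=> T0 per C0 HC x y; wlog xy : x y / y <= x => [H|].
  by case: (leP y x) => [|/ltW] h; [|rewrite distrC (distrC x)]; exact: H.
rewrite [X in _ * X]ger0_norm ?subr_ge0//.
have red (z : R) : exists k : int, 0 <= z - k%:~R * T /\ z - k%:~R * T < T.
  exists (Num.floor (z / T)); have /andP[] := real_floor_itv (num_real (z / T)).
  by rewrite ler_pdivlMr// ltr_pdivrMr// intrD; lra.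
have [k [k1 k2]] := red y; have [j [j1 j2]] := red x.
have sh (z : R) (i : int) : f z = f (z - i%:~R * T).
  by rewrite -[in LHS](subrK (i%:~R * T) z) periodic_int.
have f0T : f T = f 0 by have := per 0; rewrite add0r.
rewrite (sh x j) (sh y k).
have [jk|] := ltP k j; last first.
  move=> jk; have jk' : (j%:~R : R) <= k%:~R by rewrite ler_int.
  have kj : (k%:~R : R) = j%:~R.
    apply/le_anti; rewrite jk' andbT; have : (k%:~R : R) < (j + 1)%:~R.
      have : (k%:~R : R) * T < (j%:~R + 1) * T by lra.
      by rewrite ltr_pM2r// intrD.
    by rewrite ltr_int ltzD1 ler_int.
  by rewrite kj; apply: le_trans (HC _ _ _ _ _) _; try (rewrite ?kj in k1 k2 *; lra).
have jk' : (k%:~R + 1 : R) <= j%:~R by rewrite -(intrD _ k 1) ler_int lezD1.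
have jT : (k%:~R + 1) * T <= j%:~R * T by rewrite ler_pM2r.
have h1 := HC 0 (x - j%:~R * T) (lexx _) j1 (ltW j2).
have h2 := HC (y - k%:~R * T) T k1 (ltW k2) (lexx _).
rewrite -[f (x - _) - _](subrKA (f 0)); apply: le_trans (ler_normD _ _) _.
rewrite f0T in h2; apply: le_trans (lerD h1 h2) _; rewrite -mulrDr ler_wpM2l//; lra.
Qed.

(** [S] is a primitive of the action integrand along the curve, so the action is bounded by an
    increment instead of being computed. The comparison principle applied to [- S] gives the one
    inequality that an upper bound for the capacity requires. *)
Lemma loop_characteristic (A : set M) (T C : R) (c : R -> M) (D : set R) (S : R -> R) :
  0 < T -> 0 < C ->
  (forall x y, 0 <= x -> x <= y -> y <= T -> `|c y - c x| <= C * (y - x)) ->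
  c T = c 0 -> (forall t, 0 <= t <= T -> boundary A (c t)) ->
  countable D -> lip_itv 0 T S ->
  (forall t, 0 < t < T -> ~ D t -> exists w : M, [/\ is_derive t 1 c w, w != 0,
    forall y, A y -> omega0 y w <= omega0 (c t) w & is_derive t 1 S (omega0 (c t) w)]) ->
  exists2 g, generalized_closed_characteristic A T g & twice_action T g <= S T - S 0.
Proof.
move=> T0 C0 cl cT0 cb cD lS Hd.
pose g t := c (t - (Num.floor (t / T))%:~R * T).
have per t : g (t + T) = g t.
  rewrite /g mulrDl mulfV ?gt_eqF// floorDrz ?intr1// floor1 intrD.
  by congr c; ring.
have gc0 t : 0 <= t < T -> g t = c t.
  move=> /andP[t0 tT]; rewrite /g (_ : Num.floor (t / T) = 0) ?mul0r ?subr0//.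
  by apply: floor_def; rewrite divr_ge0 ?(ltW T0)//= ltr_pdivrMr// mul1r.
have gc t : 0 <= t <= T -> g t = c t.
  rewrite le_eqVlt => /andP[t0]; rewrite le_eqVlt => /predU1P[->|tT]; last first.
    by apply: gc0; rewrite le_eqVlt t0.
  by have := per 0; rewrite add0r => ->; rewrite gc0 ?lexx.
have red (t : R) : exists k : int, 0 <= t - k%:~R * T < T.
  exists (Num.floor (t / T)); have /andP[] := real_floor_itv (num_real (t / T)).
  by rewrite ler_pdivlMr// ltr_pdivrMr// intrD => ? ?; apply/andP; split; lra.
have sh (t : R) (k : int) : g (t - k%:~R * T) = g t.
  by rewrite -[in RHS](subrK (k%:~R * T) t) periodic_int.
have glip x y : 0 <= x -> x <= y -> y <= T -> `|g y - g x| <= C * (y - x).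
  move=> x0 xy yT; rewrite !gc ?x0 ?yT ?(le_trans x0 xy) ?(le_trans xy yT)//.
  exact: cl.
have gL := periodic_lipschitz T0 per (ltW C0) glip.
have cg : continuous g by exact: lipschitz_continuous C0 gL.
have gd t : 0 < t < T -> ~ D t -> exists w : M, [/\ is_derive t 1 g w, w != 0,
    forall y, A y -> omega0 y w <= omega0 (g t) w & is_derive t 1 S (omega0 (g t) w)].
  move=> t0T Dt; have [w [dw w0 wA wS]] := Hd t t0T Dt.
  exists w; rewrite gc0; last by case/andP: t0T => /ltW -> ->.
  split => //; apply: near_eq_is_derive dw.
  near=> s; rewrite gc0//.
  have : s \in `]0, T[ by near: s; apply: near_in_itvoo; rewrite in_itv.
  by rewrite in_itv /= => /andP[/ltW -> ->].
(* The exceptional times are all translates by periods of [D] and of the junction time 0. *)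
have negB : mu.-negligible (\bigcup_(k in [set: int]) [set k%:~R * T + t | t in D `|` [set 0]]).
  apply: countable_negligible; apply: bigcup_countable => // k _.
  apply: sub_countable (card_image_le _ _) _.
  by apply: countable_setU => //; exact: countable1.
(* The derivative is bounded by the Lipschitz constant where it exists and equals the default
   [point] elsewhere. *)
have Dbound i j : exists B, forall t, `|('D_1 g t) i j| <= B.
  exists (Num.max C `|(point : M) i j|) => t; rewrite le_max.
  have [dg|ndg] := pselect (derivable g t 1); last first.
    by apply/orP; right; rewrite /derive dvgP.
  apply/orP; left; rewrite derive_mx// mxE.
  apply: (@derive_norm_le (fun t => g t i j) t).
    by apply: derivableP; exact: (derivable_mxP _ _ _).1.
  move=> h; have := entry_norm (g (t + h) - g t) i j; rewrite !mxE => /le_trans; apply.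
  by apply: le_trans (gL _ _) _; rewrite addrAC subrr add0r.
have sq_int i j : mu.-integrable `[0, T] (EFin \o (fun t => ('D_1 g t) i j * ('D_1 g t) i j)).
  have [B HB] := Dbound i j; apply: measurable_bounded_integrable => //.
  - by rewrite /= lebesgue_measure_itv /= lte_fin T0 sube0 ltry.
  - by apply: measurable_funTS; apply: measurable_funM; exact: measurable_derive_mx.
  - exists (B ^+ 2); split; first exact: num_real.
    move=> x Bx t _ /=; apply: le_trans (ltW Bx); rewrite normrM expr2.
    by apply: ler_pM => //; exact: HB.
have gK : generalized_closed_characteristic A T g.
  split => //.
  - move=> t; have [k /andP[k1 k2]] := red t; rewrite -(sh t k) gc0 ?k1//.
    by apply: cb; rewrite k1 ltW.
  - split; first exact: (lipschitz_abs_continuous glip).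
    rewrite (_ : (fun t => _) = (fun t => \sum_(i < n) ((('D_1 g t) i 0 * ('D_1 g t) i 0)%:E +
        (('D_1 g t) i 1 * ('D_1 g t) i 1)%:E))%E); last first.
      by apply/funext => t; rewrite /dot -sumEFin; apply: eq_bigr => i _; rewrite EFinD.
    by apply: integrable_sum => // i _; apply: integrableD => //; exact: sq_int.
  apply: negligibleS negB => t nt; apply: contrapT => tB; apply: nt.
  have [k /andP[k1 k2]] := red t.
  have nDt : ~ (D `|` [set 0]) (t - k%:~R * T).
    by move=> H; apply: tB; exists k => //; exists (t - k%:~R * T) => //; rewrite addrC subrK.
  have t0 : 0 < t - k%:~R * T.
    by rewrite lt_neqAle k1 andbT; apply/eqP => E; apply: nDt; right.
  have [w [dw w0 wA _]] := gd (t - k%:~R * T) ltac:(by rewrite t0) ltac:(by move=> H; apply: nDt; left).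
  have dt : is_derive t 1 g w.
    by rewrite -[t](subrK (k%:~R * T)); apply: periodic_derive.
  have [dg dgE] := dt; split => //; rewrite dgE//.
  by rewrite -(sh t k); apply: normal_cone_omega0.
exists g => //.
have iw := action_integrable gK.
rewrite /twice_action -lerN2 -[leRHS]mulN1r -RintegralZl// opprB.
have -> : S 0 - S T = - S T - - S 0 by ring.
apply: (@ac_le_integral _ 0 T (fun x => - S x) (fun x => -1 * omega0 (g x) ('D_1 g x)) D (ltW T0)).
- by have [L _ HL] := lip_itvN lS; exact: lipschitz_abs_continuous HL.
- by apply: (@integrableZl _ _ _ mu _ _ (-1) (EFin \o (fun t => omega0 (g t) ('D_1 g t)))).
- exact: countable_negligible.
move=> t t0T Dt; have [w [[_ dw] _ _ dS]] := gd t t0T Dt.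
by exists (- omega0 (g t) w); rewrite ?dw ?mulN1r//; exact: is_deriveN.
Unshelve. all: by end_near. Qed.

End loop.

(** * Product curves, and loops made of an arc and a segment *)

Section curve.
Context {R : realType} {n : nat}.
Local Notation M := 'M[R]_(n, 2).
Variables (W : 'I_n -> set (R * R)) (P : R) (ex ey th rho : 'I_n -> R -> R).
Hypotheses (n0 : (0 < n)%N).
Hypotheses (cW : forall i, compact (W i)) (sW : forall i, segment_closed (W i)).
Hypothesis nW : forall i, nbhs (0 : R * R) (W i).
Hypothesis bf : forall i, boundary_flow (W i) P (ex i) (ey i) (th i) (rho i).
Local Notation K := (symplectic_2product W).

Definition product_curve (r u : 'I_n -> R) (t : R) : M :=
  join_planes (fun i => r i *: (ex i (u i + t), ey i (u i + t))).

Lemma is_derive_matrix (g : R -> M) (t : R) (w : M) :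
  (forall i j, is_derive t 1 (fun t => g t i j) (w i j)) -> is_derive t 1 g w.
Proof.
move=> H; have dg : derivable g t 1 by apply/derivable_mxP => i j; have [] := H i j.
split => //; rewrite derive_mx//; apply/matrixP => i j; rewrite mxE.
by have [_ ->] := H i j.
Qed.

Section fixed_curve.
Variables (r u : 'I_n -> R).
Hypotheses (r0 : forall i, 0 <= r i) (r1 : \sum_i r i ^+ 2 = 1).
Local Notation g := (product_curve r u).

Lemma product_curve_gauge t : square_gauge W (g t) = 1.
Proof.
rewrite -r1; apply: eq_bigr => i _; rewrite join_planesK.
have := r0 i; rewrite le_eqVlt => /predU1P[<-|ri]; first by rewrite scale0r (gauge0 (@nW i)).
by rewrite (gauge_scale (@sW i) (@nW i))// (flow_gauge (bf i)) mulr1.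
Qed.

Lemma product_curve_in t : K (g t).
Proof. by apply/(product_gauge n0 cW sW nW); rewrite product_curve_gauge. Qed.

Lemma product_curve_lipschitz : exists2 C, 0 < C & forall x y, `|g x - g y| <= C * `|x - y|.
Proof.
have /choice[C HC] : forall i, exists C, 0 < C /\ forall s t,
    `|ex i s - ex i t| <= C * `|s - t| /\ `|ey i s - ey i t| <= C * `|s - t|.
  by move=> i; have [C C0 H] := flow_lip (bf i); exists C.
have S0 i : 0 <= r i * C i by rewrite mulr_ge0// ltW//; have [] := HC i.
have L0 : 0 < \sum_i r i * C i + 1 by rewrite ltr_wpDl// sumr_ge0.
exists (\sum_i r i * C i + 1) => // x y; apply: matrix_norm_le; first by rewrite mulr_ge0// ltW.
have le i : r i * C i * `|x - y| <= (\sum_i r i * C i + 1) * `|x - y|.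
  rewrite ler_wpM2r// (bigD1 i)//= -addrA lerDl addr_ge0//.
  by apply: sumr_ge0 => j _.
move=> i j; apply: le_trans (le i).
have [_ /(_ (u i + x) (u i + y))] := HC i; rewrite opprD addrACA subrr add0r => -[h1 h2].
rewrite !mxE; case: (ord2_cases j) => -> /=; rewrite /GRing.scale /= -mulrBr normrM (ger0_norm (r0 i)) -mulrA;
  by rewrite ler_wpM2l.
Qed.

(** Each plane contributes [2 * r i ^+ 2] to omega0 of the curve and its velocity, in total 2. A
    point of [K] with weights [s] gives at most 2 times the sum of the [r i * s i], and
    Cauchy-Schwarz bounds this by 2. *)
Lemma product_curve_derive : exists2 D : set R, countable D & forall t, ~ D t -> exists w : M,
  [/\ is_derive t 1 g w, omega0 (g t) w = 2 & forall y, K y -> omega0 y w <= 2].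
Proof.
have /choice[D HD] : forall i, exists D : set R, countable D /\ forall t, ~ D t ->
    exists v : R * R, [/\ is_derive t 1 (ex i) v.1, is_derive t 1 (ey i) v.2,
      det2 (ex i t, ey i t) v = 2 & forall p, W i p -> det2 p v <= 2].
  by move=> i; have [D cD H] := flow_tangent (@cW i) (@sW i) (@nW i) (bf i); exists D.
exists (\bigcup_(i in [set: 'I_n]) ((fun t => t - u i) @` D i)).
  apply: bigcup_countable => [|i _]; first exact: finite_set_countable.
  by apply: sub_countable; [exact: card_image_le|have [] := HD i].
move=> t nD.
have /choice[v Hv] : forall i, exists v : R * R, [/\ is_derive (u i + t) 1 (ex i) v.1,
    is_derive (u i + t) 1 (ey i) v.2, det2 (ex i (u i + t), ey i (u i + t)) v = 2 &
    forall p, W i p -> det2 p v <= 2].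
  move=> i; have [_] := HD i; apply => Dt; apply: nD; exists i => //; exists (u i + t) => //.
  by rewrite addrAC subrr add0r.
have dshift (f : R -> R) i l : is_derive (u i + t) 1 f l -> is_derive t 1 (fun t => f (u i + t)) l.
  move=> df; have dg : is_derive t 1 (fun t : R => u i + t) 1 by apply: is_derive_eq; rewrite add0r mulr1.
  by rewrite -[l]mulr1; exact: (is_derive1_comp df dg).
exists (join_planes (fun i => r i *: v i)); split.
- apply: is_derive_matrix => i j; have [dx dy _ _] := Hv i.
  have dx' := dshift _ _ _ dx; have dy' := dshift _ _ _ dy.
  case: (ord2_cases j) => ->; rewrite mxE /=.
    rewrite (_ : (fun t => _) = (fun t => r i * ex i (u i + t))); last by apply/funext => s; rewrite mxE.
    by apply: is_derive_eq; rewrite /GRing.scale /=; ring.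
  rewrite (_ : (fun t => _) = (fun t => r i * ey i (u i + t))); last by apply/funext => s; rewrite mxE.
  by apply: is_derive_eq; rewrite /GRing.scale /=; ring.
- transitivity (\sum_i 2 * r i ^+ 2); last by rewrite -mulr_sumr r1 mulr1.
  rewrite omega0E; apply: eq_bigr => i _.
  rewrite !join_planesK; have [_ _ <- _] := Hv i; rewrite /det2 /= /GRing.scale /=.
  by ring.
move=> y /symplectic_2productP[s [s0 s1 H]]; rewrite omega0E.
apply: (@le_trans _ _ (2 * \sum_i r i * s i)).
  rewrite mulr_sumr; apply: ler_sum => i _; rewrite join_planesK.
  have [p Wp ->] := H i; have [_ _ _ /(_ _ Wp) h] := Hv i.
  have -> : det2 (s i *: p) (r i *: v i) = r i * s i * det2 p (v i).
    by rewrite /det2 /= /GRing.scale /=; ring.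
  by rewrite mulrC ler_wpM2r// mulr_ge0.
rewrite -[leRHS]mulr1 ler_pM2l//; apply: le_trans (sum_le_sqrt _ r1) _.
by rewrite s1 sqrtr1.
Qed.

(** The arc contributes [2 * L]; the segment is run through in time 1 with velocity [d], along which
    [omega0 _ d] is constant and maximal on [A]. Points of the arc are boundary points because
    scaling them up leaves [K], points of the segment because a step in the direction [- mulI d]
    would exceed that maximum. *)
Lemma arc_loop (A : set M) (L : R) (d : M) : 0 < L -> A `<=` K -> segment_closed A ->
  (forall t, 0 <= t <= L -> A (g t)) -> d != 0 -> g L + d = g 0 ->
  (forall y, A y -> omega0 y d <= omega0 (g 0) d) ->
  exists2 c, generalized_closed_characteristic A (L + 1) c &
    twice_action (L + 1) c <= 2 * L + omega0 (g 0) d.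
Proof.
move=> L0 AK sA Ag d0 gd Ad.
have sw := @omega0_form R n.
have [C C0 HC] := product_curve_lipschitz; have [D cD HD] := product_curve_derive.
pose c t := if t <= L then g t else g L + (t - L) *: d.
pose S t := if t <= L then 2 * t else 2 * L + (t - L) * omega0 (g 0) d.
have cr t : L <= t -> c t = g L + (t - L) *: d.
  rewrite le_eqVlt /c => /predU1P[<-|Lt]; first by rewrite lexx subrr scale0r addr0.
  by rewrite leNgt Lt.
have cl t : t <= L -> c t = g t by rewrite /c => ->.
have Sr t : L <= t -> S t = 2 * L + (t - L) * omega0 (g 0) d.
  rewrite le_eqVlt /S => /predU1P[<-|Lt]; first by rewrite lexx subrr mul0r addr0.
  by rewrite leNgt Lt.
have Sl t : t <= L -> S t = 2 * t by rewrite /S => ->.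
have glue (V : normedModType R) (f : R -> V) (B B' : R) : 0 <= B -> 0 <= B' ->
    (forall x y, x <= y -> y <= L -> `|f y - f x| <= B * (y - x)) ->
    (forall x y, L <= x -> x <= y -> `|f y - f x| <= B' * (y - x)) ->
    forall x y, 0 <= x -> x <= y -> y <= L + 1 -> `|f y - f x| <= (B + B' + 1) * (y - x).
  move=> B0 B0' h1 h2 x y _ xy _; have yx : 0 <= y - x by rewrite subr_ge0.
  have k1 : 0 <= B * (y - x) by rewrite mulr_ge0.
  have k2 : 0 <= B' * (y - x) by rewrite mulr_ge0.
  have [yL|/ltW Ly] := leP y L; first by have := h1 x y xy yL; lra.
  have [Lx|/ltW xL] := leP L x; first by have := h2 x y Lx xy; lra.
  rewrite -[f y - _](subrKA (f L)); apply: le_trans (ler_normD _ _) _.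
  apply: le_trans (lerD (h2 L y (lexx _) Ly) (h1 x L xL (lexx _))) _.
  have := ler_wpM2l B0 (_ : L - x <= y - x); have := ler_wpM2l B0' (_ : y - L <= y - x).
  by rewrite !lerD2l !lerD2r lerN2 => /(_ xL) e1 /(_ Ly) e2; lra.
have wseg x : omega0 (g L + x *: d) d = omega0 (g 0) d.
  by rewrite -gd !(sformDl sw) (sformZl sw) (sformxx sw) mulr0.
have Aseg x : 0 <= x <= 1 -> A (g L + x *: d).
  move=> x01; have -> : g L + x *: d = x *: g 0 + (1 - x) *: g L.
    by rewrite -gd; move: (g L) => q; apply/matrixP => i j; rewrite !mxE; ring.
  by apply: sA => //; apply: Ag; rewrite lexx ltW.
have Acl t : 0 <= t <= L + 1 -> A (c t).
  move=> /andP[t0 t1]; have [tL|/ltW Lt] := leP t L; first by rewrite cl//; apply: Ag; rewrite t0.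
  by rewrite cr//; apply: Aseg; apply/andP; split; lra.
pose v := - mulI d.
have vE : mulI v = d.
  rewrite -[RHS]opprK -mulI_mulI; apply/matrix2P => i.
  by rewrite /plane; congr pair; rewrite !mxE /= ?mxE /= ?opprK.
have v0 : v != 0.
  apply: contra d0 => /eqP v0; rewrite -vE v0; apply/eqP/matrix2P => i.
  by rewrite /plane; congr pair; rewrite !mxE /= ?mxE /= ?oppr0.
have bdry t : 0 <= t <= L + 1 -> boundary A (c t).
  move=> t01; have /andP[t0 t1] := t01; have Ac := Acl t t01.
  have [tL|/ltW Lt] := leP t L.
    apply: (boundary_direction (d := c t) Ac) => h h0 /AK.
    by apply: (product_outward n0 cW sW nW) => //; rewrite cl// product_curve_gauge.
  apply: (boundary_direction (d := v) Ac) => h h0 /Ad; rewrite cr//.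
  rewrite (sformDl sw) wseg (sformZl sw) -{2}vE dot_omega0 leNgt ltrDl.
  by rewrite mulr_gt0// dot_gt0.
have cD' : countable (D `|` [set L]) by apply: countable_setU => //; exact: countable1.
have Clip : forall x y, 0 <= x -> x <= y -> y <= L + 1 -> `|c y - c x| <= (C + `|d| + 1) * (y - x).
  apply: glue => //; first exact: ltW.
    move=> x y xy yL; rewrite !cl ?(le_trans xy)//; apply: le_trans (HC _ _) _.
    by rewrite ger0_norm ?subr_ge0.
  move=> x y Lx xy; rewrite !cr ?(le_trans Lx)//.
  have -> : g L + (y - L) *: d - (g L + (x - L) *: d) = (y - x) *: d.
    by rewrite opprD addrACA subrr add0r -scalerBl opprB addrA subrK.
  by rewrite normrZ mulrC ger0_norm ?subr_ge0.
have Slip : lip_itv 0 (L + 1) S.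
  exists (2 + `|omega0 (g 0) d| + 1); first by have := normr_ge0 (omega0 (g 0) d); lra.
  apply: glue => //.
    move=> x y xy yL; rewrite !Sl ?(le_trans xy)// -mulrBr normrM ger0_norm// ger0_norm ?subr_ge0//.
  move=> x y Lx xy; rewrite !Sr ?(le_trans Lx)//.
  have -> : 2 * L + (y - L) * omega0 (g 0) d - (2 * L + (x - L) * omega0 (g 0) d) = (y - x) * omega0 (g 0) d.
    by ring.
  by rewrite normrM mulrC [`|y - x|]ger0_norm ?subr_ge0.
have SLS : S (L + 1) - S 0 = 2 * L + omega0 (g 0) d.
  by rewrite Sr ?lerDl// Sl ?(ltW L0)//; ring.
rewrite -SLS.
have CC0 : 0 < C + `|d| + 1 by have := normr_ge0 d; lra.
apply: (loop_characteristic (ltr_wpDl (ltW L0) ltr01) CC0 Clip _ bdry cD' Slip).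
  by rewrite cr ?lerDl// cl ?(ltW L0)// addrAC subrr add0r scale1r.
move=> t /andP[t0 t1] nD.
have [tL|Lt|tL] := ltgtP t L; last by exfalso; apply: nD; right.
- have [w [dw w2 wK]] := HD t (fun h => nD (or_introl h)).
  have ctE : c t = g t by rewrite cl// ltW.
  exists w; rewrite ctE w2; split.
  + apply: near_eq_is_derive dw; near=> s; rewrite cl//.
    by apply: ltW; near: s; exact: lt_nbhsl.
  + apply: contra_eq_neq w2 => ->; rewrite -[0](scale0r (0 : M)) (sformZr sw) mul0r.
    by rewrite eq_sym pnatr_eq0.
  + by move=> y /AK; exact: wK.
  + have dS : is_derive t 1 (fun s : R => 2 * s) 2.
      by apply: is_derive_eq; rewrite /GRing.scale /=; ring.
    apply: near_eq_is_derive dS; near=> s; rewrite Sl//.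
    by apply: ltW; near: s; exact: lt_nbhsl.
have ctE : c t = g L + (t - L) *: d by rewrite cr// ltW.
exists d; rewrite ctE wseg; split => //.
- suff dc : is_derive t 1 (fun s : R => g L + (s - L) *: d) d.
    apply: near_eq_is_derive dc; near=> s; rewrite cr//.
    by apply: ltW; near: s; exact: lt_nbhsr.
  apply: is_derive_matrix => i j.
  rewrite (_ : (fun t => _) = (fun t => g L i j + (t - L) * d i j)); last by apply/funext => s; rewrite !mxE.
  by apply: is_derive_eq; rewrite /GRing.scale /=; ring.
- have dS : is_derive t 1 (fun s : R => 2 * L + (s - L) * omega0 (g 0) d) (omega0 (g 0) d).
    by apply: is_derive_eq; rewrite /GRing.scale /=; ring.
  apply: near_eq_is_derive dS; near=> s; rewrite Sr//.
  by apply: ltW; near: s; exact: lt_nbhsr.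
Unshelve. all: by end_near. Qed.

End fixed_curve.
End curve.

(** * Capacities of the body and of its two pieces *)

Section upper_bounds.
Context {R : realType} {n : nat}.
Local Notation M := 'M[R]_(n, 2).
Variables (W : 'I_n -> set (R * R)) (P : R) (ex ey th rho : 'I_n -> R -> R).
Hypotheses (n0 : (0 < n)%N).
Hypotheses (cW : forall i, compact (W i)) (sW : forall i, segment_closed (W i)).
Hypothesis nW : forall i, nbhs (0 : R * R) (W i).
Hypothesis bf : forall i, boundary_flow (W i) P (ex i) (ey i) (th i) (rho i).
Local Notation K := (symplectic_2product W).
Let sw := @omega0_form R n.

Lemma product_curveP r u t : product_curve ex ey r u (t + P) = product_curve ex ey r u t.
Proof.
by apply/matrix2P => i; rewrite !join_planesK addrA (flow_xP (bf i)) (flow_yP (bf i)).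
Qed.

(** All the weight sits on the plane [i0], where the loop is the boundary of [W i0] run through
    once. *)
Lemma product_characteristic : exists2 g,
  generalized_closed_characteristic K P g & twice_action P g <= 2 * P.
Proof.
pose i0 : 'I_n := Ordinal n0; have P0 := flow_period_gt0 (bf i0).
pose r (i : 'I_n) : R := (i == i0)%:R.
have r0 i : 0 <= r i by rewrite ler0n.
have r1 : \sum_i r i ^+ 2 = 1.
  by rewrite (bigD1 i0)//= big1 /r ?eqxx ?expr1n ?addr0// => i /negPf ->; rewrite expr0n.
pose c := product_curve ex ey r (fun=> 0).
have [C C0 HC] : exists2 C, 0 < C & forall x y, `|c x - c y| <= C * `|x - y|.
  exact: (product_curve_lipschitz bf).
have [D cD HD] := product_curve_derive cW sW nW bf (fun=> 0) r0 r1.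
have cK t := product_curve_in n0 cW sW nW bf (fun=> 0) r0 r1 t.
have [||||||g gK gS] := @loop_characteristic R n K P C c D (fun t => 2 * t) P0 C0.
- by move=> x y _ xy _; apply: le_trans (HC _ _) _; rewrite ger0_norm ?subr_ge0.
- by rewrite -[P in LHS]add0r /c product_curveP.
- move=> t _; apply: (boundary_direction (d := c t)) => [|h h0]; first exact: cK.
  by apply: (product_outward n0 cW sW nW) => //; exact: (product_curve_gauge sW nW bf).
- exact: cD.
- by apply: lip_itvM; [exact: lip_itv_cst|exact: lip_itv_id].
- move=> t _ /HD[w [dw w2 wK]]; exists w; rewrite -/(c t) in w2 *; split => //.
  + apply: contra_eq_neq w2 => ->; rewrite -[0](scale0r (0 : M)) (sformZr sw) mul0r.
    by rewrite eq_sym pnatr_eq0.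
  + by rewrite w2.
  + by rewrite w2; apply: is_derive_eq; rewrite /GRing.scale /=; ring.
by exists g => //; move: gS; rewrite mulr0 subr0.
Qed.

(** The arc over [[0, tau]] is closed by the segment [- m *: mulI a] in the piece [b <= dot a x],
    the arc over [[tau, P]] by [m *: mulI a] in the other. Both closing velocities satisfy the
    maximality required by [arc_loop] because the segments lie on the hyperplane. *)
Lemma cut_characteristics (a : M) (b tau m : R) (r u : 'I_n -> R) :
  chord_configuration P ex ey a b tau m r u -> a != 0 -> exists T1 g1 T2 g2,
  [/\ generalized_closed_characteristic (K `&` [set x | dot a x <= b]) T1 g1,
      generalized_closed_characteristic (K `&` [set x | b <= dot a x]) T2 g2 &
      twice_action T1 g1 + twice_action T2 g2 <= 2 * P].
Proof.
move=> cc a0; have /andP[t0 tP] := config_tau cc; have m0 := config_m cc.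
have r0 := config_r0 cc; have r1 := config_r1 cc.
pose c := product_curve ex ey r u; pose u' i := u i + tau.
pose c' := product_curve ex ey r u'.
have c'E t : c' t = c (tau + t).
  by apply/matrix2P => i; rewrite !join_planesK /u' addrA.
have dotc t : dot a (c t) = \sum_i r i * flow_height (ex i) (ey i) (plane i a) (u i + t).
  apply: eq_bigr => i _; rewrite !mxE /= /flow_height /plane /= /GRing.scale /=; ring.
have jump : c tau - c 0 = m *: mulI a.
  apply/matrix2P => i; have h1 := config_x cc i; have h2 := config_y cc i.
  rewrite /plane; congr pair; rewrite !mxE /= /GRing.scale /= addr0 -mulrBr.
    by rewrite h1 mulrN mulNr.
  by rewrite h2.
have da : mulI a != 0.
  apply: contra a0 => /eqP E; rewrite -oppr_eq0 -mulI_mulI E; apply/eqP/matrix2P => i.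
  by rewrite /plane; congr pair; rewrite !mxE /= ?mxE /= ?oppr0.
have wa y s : omega0 y (s *: mulI a) = s * dot a y by rewrite (sformZr sw) dot_omega0 dotC.
have level0 : dot a (c 0) = b.
  by rewrite dotc -(config_level cc); apply: eq_bigr => i _; rewrite addr0.
have levelt : dot a (c tau) = b.
  rewrite -(subrK (c 0) (c tau)) jump dotDr level0 dotZr.
  rewrite (_ : dot a (mulI a) = 0) ?mulr0 ?add0r//.
  by rewrite /dot big1// => i _; rewrite !mxE /=; ring.
have sK := product_segment_closed n0 cW sW nW.
have sle : segment_closed (K `&` [set x | dot a x <= b]).
  move=> x y t [Kx xb] [Ky yb] t01; split; first exact: sK.
  move: xb yb t01; rewrite /= dotDr !dotZr => xb yb /andP[h0 h1].
  have := ler_wpM2l h0 xb; have := @ler_wpM2l _ (1 - t) _ _ _ yb; rewrite subr_ge0 => /(_ h1); lra.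
have sge : segment_closed (K `&` [set x | b <= dot a x]).
  move=> x y t [Kx xb] [Ky yb] t01; split; first exact: sK.
  move: xb yb t01; rewrite /= dotDr !dotZr => xb yb /andP[h0 h1].
  have := ler_wpM2l h0 xb; have := @ler_wpM2l _ (1 - t) _ _ _ yb; rewrite subr_ge0 => /(_ h1); lra.
have cK s t : K (product_curve ex ey r s t) := product_curve_in n0 cW sW nW bf s r0 r1 t.
have PP : c' (P - tau) = c 0 by rewrite c'E addrC subrK -[P in LHS]add0r /c product_curveP.
have [g2 gK2 gS2] : exists2 g, generalized_closed_characteristic (K `&` [set x | b <= dot a x]) (tau + 1) g &
    twice_action (tau + 1) g <= 2 * tau + omega0 (c 0) (- m *: mulI a).
  apply: (arc_loop n0 cW sW nW bf (u := u) r0 r1 t0 (@subIsetl _ _ _) sge).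
  - move=> t /andP[h1 h2]; split; first exact: cK.
    rewrite /= -/c dotc -(config_level cc); apply: ler_sum => i _; rewrite ler_wpM2l//.
    by apply: (config_above cc); rewrite lerDl h1 lerD2l.
  - by rewrite scaler_eq0 negb_or oppr_eq0 gt_eqF//.
  - by rewrite scaleNr -jump -/c opprB addrC subrK.
  - by move=> y [_ /= yb]; rewrite -/c !wa level0 !mulNr lerN2 ler_pM2l.
have Pt : 0 < P - tau by rewrite subr_gt0.
have [g1 gK1 gS1] : exists2 g, generalized_closed_characteristic (K `&` [set x | dot a x <= b]) (P - tau + 1) g &
    twice_action (P - tau + 1) g <= 2 * (P - tau) + omega0 (c' 0) (m *: mulI a).
  apply: (arc_loop n0 cW sW nW bf (u := u') r0 r1 Pt (@subIsetl _ _ _) sle).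
  - move=> t /andP[h1 h2]; split; first exact: cK.
    rewrite /= -/c' c'E dotc -(config_level cc); apply: ler_sum => i _; rewrite ler_wpM2l//.
    by apply: (config_below cc); rewrite addrA lerDl h1 -addrA lerD2l; lra.
  - by rewrite scaler_eq0 negb_or gt_eqF.
  - by rewrite -/c' PP c'E addr0 -jump addrC subrK.
  - by move=> y [_ /= yb]; rewrite -/c' !wa c'E addr0 levelt ler_pM2l.
exists (P - tau + 1), g1, (tau + 1), g2; split => //.
apply: le_trans (lerD gS1 gS2) _; rewrite !wa c'E addr0 level0 levelt.
by rewrite [leLHS](_ : _ = 2 * P)//; ring.
Qed.

End upper_bounds.

Section capacity.
Context {R : realType} {n : nat}.
Local Notation M := 'M[R]_(n, 2).
Local Notation actions K := [set A | exists T gamma,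
  generalized_closed_characteristic K T gamma /\ A = action T gamma].

Lemma actionE T (g : R -> M) : action T g = 2^-1 * twice_action T g.
Proof. by []. Qed.

Lemma c_EHZ_eq (K : set M) (A T : R) g :
  (forall T g, generalized_closed_characteristic K T g -> 2 * A <= twice_action T g) ->
  generalized_closed_characteristic K T g -> twice_action T g <= 2 * A -> c_EHZ K = A.
Proof.
move=> lb gK ub; have lbA : lbound (actions K) A.
  by move=> _ [T' [g' [gK' ->]]]; rewrite actionE ler_pdivlMl//; exact: lb gK'.
apply/le_anti/andP; split.
  apply: (@le_trans _ _ (action T g)); last by rewrite actionE ler_pdivrMl.
  by apply: ge_inf; [exists A|exists T, g].
by apply: lb_le_inf => //; exists (action T g), T, g.
Qed.

Lemma c_EHZ_sum_eq (K1 K2 : set M) (A T1 T2 : R) g1 g2 : K1° !=set0 -> K2° !=set0 ->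
  (forall T1 g1 T2 g2, generalized_closed_characteristic K1 T1 g1 ->
    generalized_closed_characteristic K2 T2 g2 ->
    2 * A <= twice_action T1 g1 + twice_action T2 g2) ->
  generalized_closed_characteristic K1 T1 g1 -> generalized_closed_characteristic K2 T2 g2 ->
  twice_action T1 g1 + twice_action T2 g2 <= 2 * A -> c_EHZ K1 + c_EHZ K2 = A.
Proof.
move=> i1 i2 lb gK1 gK2 ub.
(* [inf] is a lower bound only of a set that is bounded below; positivity of the actions ensures
   this for each piece separately. *)
have lb0 (K : set M) : K° !=set0 -> has_lbound (actions K).
  by move=> iK; exists 0 => _ [T [g [gK ->]]]; rewrite actionE mulr_ge0// ltW// (twice_action_gt0 gK iK).
apply/le_anti/andP; split.
  have h1 : c_EHZ K1 <= action T1 g1 by apply: ge_inf; [exact: lb0|exists T1, g1].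
  have h2 : c_EHZ K2 <= action T2 g2 by apply: ge_inf; [exact: lb0|exists T2, g2].
  by apply: le_trans (lerD h1 h2) _; rewrite !actionE -mulrDr ler_pdivrMl.
rewrite -lerBlDr; apply: lb_le_inf; first by exists (action T1 g1), T1, g1.
move=> _ [T1' [g1' [gK1' ->]]]; rewrite lerBlDr -lerBlDl.
apply: lb_le_inf; first by exists (action T2 g2), T2, g2.
move=> _ [T2' [g2' [gK2' ->]]]; rewrite lerBlDl !actionE -mulrDr ler_pdivlMl//.
exact: lb gK1' gK2'.
Qed.

End capacity.

Theorem corollary1p2 (R : realType) (n : nat) (hn : (0 < n)%N)
    (W : 'I_n -> set (R * R))
    (hW : forall i, convex_body (W i))
    (hW0 : forall i, (W i)° 0)
    (hWarea : forall i j, area (W i) = area (W j)) :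
  cuts_additively (symplectic_2product W).
Proof.
have cW i : compact (W i) by have [] := hW i.
have sW i : segment_closed (W i) by have [_ /convex_set_segment_closed] := hW i.
have nW i : nbhs (0 : R * R) (W i) := hW0 i.
have flow i : exists A q, area (W i) = A%:E /\
    boundary_flow (W i) A q.1.1.1 q.1.1.2 q.1.2 q.2.
  have [P [ex [ey [th [rho bf]]]]] := boundary_flow_exists (@cW i) (@sW i) (@nW i).
  have [xl [xr [lo [hi [Lo [Hi pr]]]]]] := planar_profile_exists (hW i).
  exists P, (ex, ey, th, rho); split => //.
  by rewrite (profile_area pr) -(flow_period_area (@cW i) (@sW i) (@nW i) bf pr).
have [A [_ [areaA _]]] := flow (Ordinal hn).
(* The period of each flow is the area of its body, so equal areas give all flows the common period
   [A]. *)
have /choice[q bf] i : exists q, boundary_flow (W i) A q.1.1.1 q.1.1.2 q.1.2 q.2.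
  have [B [q [areaB bf]]] := flow i; exists q.
  by move: areaB; rewrite (hWarea i (Ordinal hn)) areaA => -[->].
have areas i : area (W i) = A%:E by rewrite (hWarea i (Ordinal hn)).
have iso := product_isoperimetric hW (fun i => nbhs_singleton (hW0 i)) areas.
have A0 : 0 < A := flow_period_gt0 (bf (Ordinal hn)).
have bK := product_convex_body hn cW sW nW.
have [_ _ K0] := bK.
split => // a b a0 [z Kz zb].
have [lo up i1 i2] := cut_interior a0 Kz zb.
have [g gK gA] := product_characteristic hn cW sW nW bf.
rewrite (c_EHZ_eq (A := A) _ gK gA); last first.
  by move=> T' g' gK'; exact: (characteristic_action_ge iso K0 gK').
have [tau [m [r [u cc]]]] := chord_configuration_exists cW sW nW bf a0 lo up.
have [T1 [g1 [T2 [g2 [gK1 gK2 gS]]]]] := cut_characteristics hn cW sW nW bf cc a0.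
apply/esym/(c_EHZ_sum_eq i1 i2 _ gK1 gK2 gS) => T1' g1' T2' g2' gK1' gK2'.
apply: (cut_characteristics_ge _ _ iso lo up i1 i2 gK1' gK2').
  by rewrite mulr_ge0// ltW.
exact: product_segment_closed hn cW sW nW.
Qed.
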